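(* Let $0<\alpha\le3$ and $s>\frac14-\frac{\alpha}{4}$. For all sufficiently small $\epsilon>0$ (depending on $s$ and $\alpha$) there is a constant $C>0$ such that for all functions $u,v$ on $\mathbb{R}\times\mathbb{R}$ with finite right-hand side, $$\|uv\|_{L^2(\mathbb{R}\times\mathbb{R})}\le C\,\|u\|_{X^{-1/2,\,1/2-\epsilon}_\alpha}\,\|v\|_{X^{s,\,1/2}_\alpha}.$$
   Context: $\langle\cdot\rangle=(1+|\cdot|^2)^{1/2}$; $\hat u(\xi,\tau)$ is the space-time Fourier transform of $u(x,t)$. For $s,b\in\mathbb{R}$, $$\|u\|_{X^{s,b}_\alpha}=\big\|\langle i(\tau-\xi^3)+|\xi|^\alpha\rangle^b\langle\xi\rangle^s\hat u(\xi,\tau)\big\|_{L^2_{\xi,\tau}(\mathbb{R}^2)}.$$ The inequality is an a priori estimate: for Schwartz functions $u,v$ the product is the pointwise one, and for general elements of the spaces on the right-hand side it is understood by continuous extension (density). *)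

(* Defs.v *)
From HB Require Import structures.
From mathcomp Require Import all_boot all_order all_algebra.
From mathcomp Require Import all_classical all_reals all_analysis.
From mathcomp Require Import complex.
Set Implicit Arguments.
Unset Strict Implicit.
Unset Printing Implicit Defensive.
Import Order.TTheory GRing.Theory Num.Theory.
Import numFieldNormedType.Exports.
Local Open Scope classical_set_scope.
Local Open Scope ring_scope.
Local Open Scope complex_scope.

Section Defs.
Context {R : realType}.
Implicit Types (u v w F G : R * R -> R[i]) (alpha s b : R).

Definition leb2 := (@lebesgue_measure R \x @lebesgue_measure R)%E.

Definition cmeasurable (F : R * R -> R[i]) :=
  measurable_fun [set: R * R] (fun z => complex.Re (F z)) /\
  measurable_fun [set: R * R] (fun z => complex.Im (F z)).

(* Mixed partial derivative of order k in the first and l in the second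
   variable. *)
Definition partial (k l : nat) (f : R * R -> R) : R * R -> R :=
  iter k (fun g z => 'D_((1, 0) : R * R) g z)
    (iter l (fun g z => 'D_((0, 1) : R * R) g z) f).

(* Fréchet differentiability of every [partial k l f] amounts to f being
   smooth. *)
Definition schwartz_real (f : R * R -> R) :=
  (forall k l z, differentiable (partial k l f) z) /\
  (forall k l m n, exists M : R, forall z : R * R,
    `|z.1 ^+ m * z.2 ^+ n * partial k l f z| <= M).

Definition schwartz (u : R * R -> R[i]) :=
  schwartz_real (fun z => complex.Re (u z)) /\
  schwartz_real (fun z => complex.Im (u z)).

Definition cintegral (f : R * R -> R[i]) : R[i] :=
  Rintegral leb2 setT (fun z => complex.Re (f z)) +i*
  Rintegral leb2 setT (fun z => complex.Im (f z)).

(* \hat u (xi, tau), the integral of u(x, t) e^{-i(x xi + t tau)}; the choice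
   of normalization only affects multiplicative constants. *)
Definition fourier (u : R * R -> R[i]) (zeta : R * R) : R[i] :=
  cintegral (fun z => let theta := z.1 * zeta.1 + z.2 * zeta.2 in
    u z * (cos theta -i* sin theta)).

Definition bracket (z : R[i]) : R := Num.sqrt (1 + Normc.normc z ^+ 2).

Definition weight alpha s b (zeta : R * R) : R :=
  let: (xi, tau) := zeta in
  bracket ((`|xi| `^ alpha) +i* (tau - xi ^+ 3)) `^ b * bracket (xi%:C) `^ s.

Definition L2norm (w : R * R -> R[i]) : \bar R :=
  ('N[leb2]_(2%:E) [(fun z => (Normc.normc (w z))%:E)])%E.

(* An element of X^{s,b}_alpha is represented by its Fourier transform F, a
   measurable function with Xhat_norm alpha s b F < +oo. For negative s or b
   such an element need not be a function of (x, t). *)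
Definition Xhat_norm alpha s b (F : R * R -> R[i]) : \bar R :=
  L2norm (fun zeta => (weight alpha s b zeta)%:C * F zeta).

Definition Xnorm alpha s b (u : R * R -> R[i]) : \bar R :=
  Xhat_norm alpha s b (fourier u).

Definition X_approx alpha s b F (u_ : nat -> R * R -> R[i]) :=
  (forall n, schwartz (u_ n)) /\
  (Xhat_norm alpha s b (fun zeta => fourier (u_ n) zeta - F zeta)
     @[n --> \oo] --> 0%E).

(* w is the value at (F, G) of the continuous extension of the pointwise
   product from Schwartz functions to X^{s1,b1}_alpha x X^{s2,b2}_alpha, with
   values in L^2. *)
Definition is_product alpha s1 b1 s2 b2 F G (w : R * R -> R[i]) :=
  forall u_ v_ : nat -> R * R -> R[i],
    X_approx alpha s1 b1 F u_ -> X_approx alpha s2 b2 G v_ ->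
    (L2norm (fun z => u_ n z * v_ n z - w z) @[n --> \oo] --> 0%E).

End Defs.

(* Main.v *)
(* Write A = |E_d u^| and B = |E_d v^|, where E_d is the cutoff
   exp (- d |xi| - d |tau|). Its Fourier transform is a product of Poisson
   kernels, so the inverse transforms of E_d u^ and E_d v^ are Poisson averages
   of u and v and converge to u and v as d -> 0; a Plancherel identity against
   the weight E_d bounds the integral of E_d |u_d v_d|^2 by a constant times
   the square norm of the convolution H = A * B. Fatou's lemma then reduces the
   claim to an estimate for H.

   The square norm of H is the trilinear integral of A(z1) B(z2) H(z1 + z2). Put
   X_i = <xi_i>^alpha + |tau_i - xi_i^3| and M = max (<xi_1>, <xi_2>). If
   |<xi_1> - <xi_2>| <= 6 M^((alpha - 1) / 2), the kernel is square integrable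
   in the variable z_i with the smaller X_i. Otherwise the resonance identity
   bounds max (X_1, X_2) from below by M |<xi_1> - <xi_2>| times the distance
   of |xi_1 - xi / 2| to a critical value, and the kernel is square integrable
   in z_1 for fixed z_1 + z_2. Cauchy-Schwarz closes the estimate by absorbing
   the square norm of H, which is finite because of the cutoff.

   The extension to all elements of the spaces is by completeness of L^2. *)

(* The hypothesis on [s] says that -2 s < (alpha - 1) / 2. A small [kap] is taken out of this gap:
   sg = (alpha - 1) / 2 - 4 kap still dominates -2 s, and the estimates keep a power M^(-2 kap) in
   reserve, while [eps <= kap / 4] pays for the weaker exponent of the first weight. No dyadic
   decomposition is made: the reserve turns the borderline kernel into integrable functions of a
   single frequency. In both frequency regimes the exponents match exactly at [alpha = 3], and this
   is how [alpha <= 3] enters them.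

   On the physical side the cutoff [E_d] is chosen because it and its transform are both explicit
   and nonnegative. The weighted Plancherel identity then reduces to exchanges of absolutely
   convergent integrals, and positivity of the transform allows both factors to be replaced by their
   absolute values on the Fourier side, where the estimate for H ignores all phases. *)
Require Import Defs.
From HB Require Import structures.
From mathcomp Require Import all_boot all_order all_algebra.
From mathcomp Require Import all_classical all_reals all_analysis.
From mathcomp Require Import measurable_realfun complex.
From mathcomp Require Import ring lra.
Set Implicit Arguments.
Unset Strict Implicit.
Unset Printing Implicit Defensive.
Import Order.TTheory GRing.Theory Num.Theory.
Import numFieldNormedType.Exports.
Local Open Scope classical_set_scope.
Local Open Scope ring_scope.

(** * Integrals on the line *)

Section OneDim.
Context {R : realType}.
Local Notation mu := (@lebesgue_measure R).
Local Open Scope ereal_scope.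

Lemma preimage_shift_itvoc (a x y : R) :
  (fun t : R => t + a)%R @^-1` `]x, y]%classic = `](x - a)%R, (y - a)%R]%classic.
Proof.
by apply/seteqP; split => t /=; rewrite !in_itv /= => /andP[h1 h2]; apply/andP; split; lra.
Qed.

Lemma measurable_shift (a : R) :
  measurable_fun [set: R] ((fun t : R => t + a)%R : R -> R).
Proof. exact: measurable_funD. Qed.

(** A translate of Lebesgue measure agrees with it on half-open intervals, and these determine the
    measure. *)
Lemma lebesgue_measure_shift (a : R) (A : set R) : measurable A ->
  pushforward mu ((fun t => t + a)%R : _ -> measurableTypeR R) A = mu A.
Proof.
pose g : measurableTypeR R -> measurableTypeR R := (fun t : R => t + a)%R.
have ma : @measurable_fun _ _ (measurableTypeR R) (measurableTypeR R) setT g.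
  exact: measurable_shift.
pose gM := isMeasurableFun.Build _ _ (measurableTypeR R) (measurableTypeR R) g ma.
pose f : {mfun measurableTypeR R >-> measurableTypeR R} := HB.pack g gM.
move=> mA; apply/esym.
have := @lebesgue_measure_unique R
  [the {measure set (measurableTypeR R) -> \bar R} of pushforward mu f].
apply=> // _ [[x y]] _ <-.
rewrite /pushforward [X in mu X = _](_ : _ = `]x, y]%classic)//.
rewrite [X in _ = mu X](preimage_shift_itvoc a x y) /= !lebesgue_measure_itv/=.
by rewrite !lte_fin ltrD2r -!EFinB; case: ifP => // _; congr EFin; lra.
Qed.

Lemma ge0_integral_shift (f : R -> \bar R) (a : R) :
  measurable_fun [set: R] f -> (forall r, 0 <= f r) ->
  \int[mu]_x f (x + a)%R = \int[mu]_x f x.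
Proof.
move=> mf f0.
have ma : measurable_fun [set: measurableTypeR R]
  ((fun t => t + a)%R : measurableTypeR R -> measurableTypeR R).
  exact: measurable_shift.
have := ge0_integral_pushforward ma mu measurableT mf (fun y _ => f0 y).
rewrite preimage_setT => <-.
by apply: eq_measure_integral => //= A mA AS; exact: lebesgue_measure_shift.
Qed.

Lemma ge0_integral_opp (f : R -> \bar R) :
  measurable_fun [set: R] f -> (forall r, 0 <= f r) ->
  \int[mu]_x f (- x)%R = \int[mu]_x f x.
Proof.
move=> mf f0.
have ma : measurable_fun [set: measurableTypeR R]
  ((fun t => - t)%R : measurableTypeR R -> measurableTypeR R).
  exact: oppr_measurable.
have := ge0_integral_pushforward ma mu measurableT mf (fun y _ => f0 y).
rewrite preimage_setT => <-.
by apply: eq_measure_integral => //= A mA AS; exact: lebesgue_measureN.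
Qed.

Lemma ge0_integral_sub (f : R -> \bar R) (a : R) :
  measurable_fun [set: R] f -> (forall r, 0 <= f r) ->
  \int[mu]_x f (a - x)%R = \int[mu]_x f x.
Proof.
move=> mf f0; rewrite -(ge0_integral_shift a mf f0).
rewrite -(@ge0_integral_opp (fun x => f (x + a)%R))//.
  by apply: eq_integral => x _; rewrite addrC.
by apply: (measurableT_comp mf); exact: measurable_shift.
Qed.

(** Evenness reduces to the half-line, where |x| may be replaced by [x]. The derivative of [F] is
    therefore prescribed on [0 <= x] only, and [F] may be a formula that is wrong for negative
    [x]. *)
Lemma ge0_integral_symm (f F : R -> R) (l : R) :
  (forall x, 0 <= f x)%R -> continuous f -> (forall x, f (- x) = f x)%R ->
  F x @[x --> +oo%R] --> l ->
  (forall x : R, (0 <= x)%R -> is_derive x 1%R F (f x)) ->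
  \int[mu]_x (f x)%:E = (2 * (l - F 0))%:E.
Proof.
move=> f0 cf fN Fl dF.
rewrite ge0_symfun_integralT//; last by move=> x /=; rewrite fN.
rewrite EFinM; congr (_ * _).
rewrite -set_itvcy (@ge0_continuous_FTC2y R f F 0%R l)//.
- by apply: continuous_subspaceT => x; exact: cf.
- by move=> x x0; have [] := dF x (ltW x0).
- apply: cvg_at_right_filter.
  by apply/differentiable_continuous/derivable1_diffP; have [] := dF 0%R (lexx _).
- move=> x; rewrite in_itv /= andbT => x0.
  by rewrite derive1E; have [_ ->] := dF x (ltW x0).
Qed.

Lemma cvg_expRNM (d : R) : (0 < d)%R ->
  (expR (- (d * x)))%R @[x --> +oo%R] --> (0 : R)%R.
Proof.
move=> d0; have h : (d * x)%R @[x --> +oo%R] --> +oo%R.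
  exact: gt0_cvgMry d0 (@cvg_id _ _).
exact: (cvg_comp _ _ h (@cvgr_expR R)).
Qed.

Lemma cvg_expRNM_bounded (d M : R) (g : R -> R) : (0 < d)%R ->
  (forall x, `|g x| <= M)%R ->
  (expR (- (d * x)) * g x)%R @[x --> +oo%R] --> (0 : R)%R.
Proof.
move=> d0 gM; apply/cvgr0Pnorm_le => e e0.
have M0 : (0 <= M)%R by exact: le_trans (gM 0%R).
have e1 : (0 < e / (M + 1))%R by rewrite divr_gt0// ltr_wpDl.
have /cvgr0Pnorm_le /(_ _ e1) := cvg_expRNM d0.
apply: filterS => x; rewrite normrM => h.
rewrite (le_trans (ler_pM _ _ h (gM x)))//.
rewrite mulrAC ler_pdivrMr ?ltr_wpDl// ler_pM2l//; lra.
Qed.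

Lemma is_derive_continuous (f : R -> R) (x df : R) :
  is_derive x 1%R f df -> {for x, continuous f}.
Proof. by case=> h _; exact/differentiable_continuous/derivable1_diffP. Qed.

Lemma continuous_cosM (y : R) : continuous (fun x : R => cos (x * y))%R.
Proof. by move=> x; apply: is_derive_continuous. Qed.

Lemma continuous_sinM (y : R) : continuous (fun x : R => sin (x * y))%R.
Proof. by move=> x; apply: is_derive_continuous. Qed.

(** One-dimensional factor of the cutoff [E_d]. *)
Definition expk (d x : R) : R := expR (- (d * `|x|)).

Lemma expk_ge0 (d x : R) : (0 <= expk d x)%R. Proof. exact: expR_ge0. Qed.

Lemma expk_le1 (d x : R) : (0 <= d)%R -> (expk d x <= 1)%R.
Proof. by move=> d0; rewrite expR_le1 oppr_le0 mulr_ge0. Qed.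

Lemma expkN (d x : R) : (expk d (- x) = expk d x)%R.
Proof. by rewrite /expk normrN. Qed.

Lemma continuous_expk (d : R) : continuous (expk d).
Proof.
move=> x; apply: (@continuous_comp _ _ _ (fun x => - (d * `|x|))%R expR); last exact: continuous_expR.
apply: (@continuousN R R^o _ (fun x => d * `|x|)%R).
by apply: continuousM; [exact: cvg_cst|exact: norm_continuous].
Qed.

Lemma measurable_expk (d : R) : measurable_fun [set: R] (expk d).
Proof. by apply: continuous_measurable_fun; exact: continuous_expk. Qed.

Lemma integral_expk (d : R) : (0 < d)%R ->
  \int[mu]_x (expk d x)%:E = (2 / d)%:E.
Proof.
move=> d0.
have hs : (forall x : R, 0 <= x -> is_derive x 1 (fun t : R => - (expR (- (d * t)) / d)) (expk d x))%R.
  move=> x x0; apply: is_derive_eq; rewrite /GRing.scale /= /expk ger0_norm//.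
  field; lra.
rewrite (ge0_integral_symm (expk_ge0 d) (@continuous_expk d) (expkN d) _ hs (l := 0%R)).
  by congr EFin; rewrite mulr0 oppr0 expR0; field; lra.
rewrite -oppr0; apply: (@cvgN R R^o).
rewrite -(mul0r (d^-1)%R); apply: cvgM; [exact: cvg_expRNM|exact: cvg_cst].
Qed.

(** The Fourier transform of [expk d], without normalization: its total mass is 2 pi for every
    [d > 0]. *)
Definition poisson (d y : R) : R := (2 * d / (d ^+ 2 + y ^+ 2))%R.

(** The summand 1 makes the integrand nonnegative, so that an antiderivative evaluates the integral;
    the cosine integral is then recovered by subtraction. *)
Lemma integral_expk_1cos (d y : R) : (0 < d)%R ->
  \int[mu]_x (expk d x * (1 + cos (x * y)))%:E = (2 / d + poisson d y)%:E.
Proof.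
move=> d0.
have dy0 : (d ^+ 2 + y ^+ 2 != 0)%R by rewrite gt_eqF// ltr_pwDl ?exprn_gt0// sqr_ge0.
pose F := (fun t : R => expR (- (d * t)) * ((y * sin (t * y) - d * cos (t *y)) / (d^+2 + y ^+2) - d^-1))%R.
have hs : (forall x : R, 0 <= x -> is_derive x 1 F (expk d x * (1 + cos (x * y))))%R.
  move=> x x0; apply: is_derive_eq; rewrite /GRing.scale /= /expk ger0_norm//.
  field; rewrite dy0/=; lra.
rewrite (ge0_integral_symm _ _ _ _ hs (l := 0%R)).
- congr EFin; rewrite /F /poisson !mul0r mulr0 oppr0 expR0 sin0 cos0; field; rewrite dy0/=; lra.
- by move=> x; rewrite mulr_ge0 ?expk_ge0//; have := cos_geN1 (x * y); lra.
- move=> x; apply: continuousM; first exact: continuous_expk.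
  apply: (@continuousD R R^o); first exact: cvg_cst.
  exact: continuous_cosM.
- by move=> x; rewrite expkN mulNr cosN.
- apply: (@cvg_expRNM_bounded _ ((`|y| + `|d|) / (d^+2 + y ^+2) + d^-1)) => // x.
  rewrite (le_trans (ler_normB _ _))//; apply: lerD; last by rewrite gtr0_norm// invr_gt0.
  have dp : (0 < (d ^+ 2 + y ^+ 2)^-1)%R by rewrite invr_gt0 ltr_pwDl ?exprn_gt0// sqr_ge0.
  rewrite normrM (gtr0_norm dp) ler_pM2r//.
  rewrite (le_trans (ler_normB _ _))// !normrM lerD//.
    by rewrite ler_piMr// sin_max.
  by rewrite ler_piMr// cos_max.
Qed.

Lemma integrable_expk (d : R) : (0 < d)%R -> mu.-integrable setT (EFin \o expk d).
Proof.
move=> d0; apply/integrableP; split; first by apply/measurable_EFinP; exact: measurable_expk.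
under eq_integral do rewrite /= ger0_norm ?expk_ge0//.
by rewrite integral_expk// ltry.
Qed.

Lemma measurable_cosM (y : R) : measurable_fun [set: R] (fun x : R => cos (x * y)).
Proof.
by apply: continuous_measurable_fun; exact: continuous_cosM.
Qed.

Lemma measurable_sinM (y : R) : measurable_fun [set: R] (fun x : R => sin (x * y)).
Proof.
by apply: continuous_measurable_fun; exact: continuous_sinM.
Qed.

Lemma integrable_expk_bounded (d : R) (g : R -> R) : (0 < d)%R ->
  measurable_fun [set: R] g -> (forall x, `|g x| <= 1)%R ->
  mu.-integrable setT (fun x => (expk d x * g x)%:E).
Proof.
move=> d0 mg g1; apply: (le_integrable _ _ _ (integrable_expk d0)) => //.
  by apply/measurable_EFinP; apply: measurable_funM => //; exact: measurable_expk.
move=> x _ /=; rewrite lee_fin normrM ler_piMr//.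
Qed.

Lemma Rintegral_expk_cos (d y : R) : (0 < d)%R ->
  (\int[mu]_x (expk d x * cos (x * y)))%R = poisson d y.
Proof.
move=> d0; have ic := integrable_expk_bounded d0 (measurable_cosM y) (fun x => cos_max _).
have : (\int[mu]_x (expk d x * (1 + cos (x * y))))%R = (2 / d + poisson d y)%R.
  by rewrite /Rintegral integral_expk_1cos.
under eq_Rintegral do rewrite mulrDr mulr1.
rewrite RintegralD//; last exact: integrable_expk.
by rewrite {1}/Rintegral integral_expk//= => /addrI.
Qed.

(** The integrand is odd. Reflection invariance is available for nonnegative functions, hence the
    detour through [1 + sin]: with p and q the integrals of the two summands, reflection gives p - q
    = p + q. *)
Lemma Rintegral_expk_sin (d y : R) : (0 < d)%R ->
  (\int[mu]_x (expk d x * sin (x * y)))%R = 0%R.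
Proof.
move=> d0; have gen (p q : R) : (p - q = p + q -> q = 0)%R by lra.
have ms := measurable_sinM y.
have iD := integrable_expk d0.
have is1 := integrable_expk_bounded d0 ms (fun x => sin_max _).
pose f x : R := (expk d x * (1 + sin (x * y)))%R.
have f0 x : (0 <= f x)%R.
  by rewrite mulr_ge0 ?expk_ge0//; have := sin_geN1 (x * y); lra.
have mf : measurable_fun [set: R] f.
  apply: measurable_funM; first exact: measurable_expk.
  exact: measurable_funD.
have e1 : (\int[mu]_x f (- x) = \int[mu]_x f x)%R.
  rewrite /Rintegral (@ge0_integral_opp (EFin \o f))//.
  exact/measurable_EFinP.
have h1 : (\int[mu]_x f x = \int[mu]_x expk d x + \int[mu]_x (expk d x * sin (x * y)))%R.
  by rewrite -RintegralD//; apply: eq_Rintegral => x _; rewrite /f mulrDr mulr1.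
have h2 : (\int[mu]_x f (- x) = \int[mu]_x expk d x - \int[mu]_x (expk d x * sin (x * y)))%R.
  rewrite -RintegralB//; apply: eq_Rintegral => x _.
  by rewrite /f expkN mulNr sinN mulrBr mulr1.
by move: e1; rewrite h1 h2 => /gen.
Qed.

Lemma poisson_ge0 (d y : R) : (0 < d)%R -> (0 <= poisson d y)%R.
Proof. by move=> d0; rewrite /poisson divr_ge0// ?addr_ge0 ?sqr_ge0//; lra. Qed.

Lemma continuous_poisson (d : R) : (0 < d)%R -> continuous (poisson d).
Proof.
move=> d0 y; apply: cvgM; first exact: cvg_cst.
apply: cvgV; first by rewrite gt_eqF// ltr_pwDl ?exprn_gt0// sqr_ge0.
by apply: cvgD; [exact: cvg_cst|exact: exprn_continuous].
Qed.

Lemma measurable_poisson (d : R) : (0 < d)%R -> measurable_fun [set: R] (poisson d).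
Proof. by move=> d0; apply: continuous_measurable_fun; exact: continuous_poisson. Qed.

Lemma integral_poisson (d : R) : (0 < d)%R ->
  \int[mu]_y (poisson d y)%:E = (2 * pi)%:E.
Proof.
move=> d0.
have hs : (forall x : R, 0 <= x -> is_derive x 1 (fun t : R => 2 * atan (d^-1 * t)) (poisson d x))%R.
  move=> x x0; apply: is_derive_eq; rewrite /GRing.scale /= /poisson.
  field; rewrite (_ : d == 0 = false)%R ?gt_eqF//=.
  by rewrite ltr_pwDl ?exprn_gt0// sqr_ge0.
rewrite (ge0_integral_symm (fun y => poisson_ge0 y d0) (continuous_poisson d0) _ _ hs (l := pi)).
- by rewrite mulr0 atan0 mulr0 subr0.
- by move=> x; rewrite /poisson sqrrN.
- rewrite (_ : pi = 2 * (pi / 2))%R; last by lra.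
  apply: cvgM; first exact: cvg_cst.
  have h : (d^-1 * x)%R @[x --> +oo%R] --> +oo%R.
    by apply: gt0_cvgMry; [rewrite invr_gt0|exact: cvg_id].
  exact: (cvg_comp _ _ h (@cvgy_atan R)).
Qed.

End OneDim.

(** * An integrable kernel with a power singularity *)

Section SingularKernel.
Context {R : realType}.
Local Notation mu := (@lebesgue_measure R).

(** For [a > 0] the singularity at the origin is shifted away, so that the function is continuous
    and the fundamental theorem of calculus applies. *)
Definition gker (k a y : R) : R :=
  k * (`|y| + a) `^ (k - 1) / (1 + (`|y| + a) `^ k) ^+ 2.

Lemma gker_ge0 (k a y : R) : 0 <= k -> 0 <= gker k a y.
Proof. by move=> k0; rewrite /gker divr_ge0 ?sqr_ge0// mulr_ge0// powR_ge0. Qed.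

Lemma continuous_powR (p x : R) : 0 < x -> {for x, continuous (@powR R ^~ p)}.
Proof. by move=> x0; exact: (is_derive_continuous (is_derive1_powR p x0)). Qed.

Lemma gker_den_neq0 (k a y : R) : 1 + (`|y| + a) `^ k != 0.
Proof. by rewrite gt_eqF// ltr_pwDl// powR_ge0. Qed.

Lemma continuous_gker (k a : R) : 0 < a -> continuous (gker k a).
Proof.
move=> a0 x; have xa : 0 < `|x| + a by rewrite ltr_wpDl.
have cxa : {for x, continuous (fun y : R => `|y| + a)}.
  by apply: cvgD; [exact: norm_continuous|exact: cvg_cst].
have cp (p : R) : {for x, continuous (fun y : R => (`|y| + a) `^ p)}.
  exact: (continuous_comp cxa (@continuous_powR p _ xa)).
apply: cvgM; first by apply: cvgM; [exact: cvg_cst|exact: cp].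
apply: cvgV; first by rewrite sqrf_eq0 gker_den_neq0.
have c1 : {for x, continuous (fun y : R => 1 + (`|y| + a) `^ k)}.
  by apply: cvgD; [exact: cvg_cst|exact: cp].
exact: (continuous_comp c1 (@exprn_continuous R 2 _)).
Qed.

Lemma cvgy_powR (k a : R) : 0 < k -> 0 < a -> (x + a) `^ k @[x --> +oo] --> +oo.
Proof.
move=> k0 a0; apply/cvgryPge => A.
near=> x.
have xA : 0 <= x by near: x; exact: nbhs_pinfty_ge.
have xA2 : (Num.max A 0) `^ (k^-1) <= x by near: x; apply: nbhs_pinfty_ge; rewrite num_real.
apply: (@le_trans _ _ (Num.max A 0)); first by rewrite le_max lexx.
have M0 : 0 <= Num.max A 0 by rewrite le_max lexx orbT.
rewrite -{1}(powRr1 M0) -(mulVf (negbT (gt_eqF k0))) powRrM.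
by rewrite ge0_ler_powR ?nnegrE ?powR_ge0 ?addr_ge0// ltW// (le_lt_trans xA2)// ltrDl.
Unshelve. all: by end_near. Qed.

(** The antiderivative -(1 + (x + a)^k)^-1 rises from at least -1 to 0, so each half-line
    contributes at most 1, uniformly in [a]. *)
Lemma integral_gker_le (k a : R) : 0 < k -> 0 < a ->
  (\int[mu]_y (gker k a y)%:E <= 2%:E)%E.
Proof.
move=> k0 a0.
pose F (x : R) := - (1 + (x + a) `^ k)^-1.
have dF (x : R) : 0 <= x -> is_derive x 1 F (gker k a x).
  move=> x0; have xa : 0 < x + a by rewrite ltr_wpDl.
  have d1 : is_derive x 1 (fun x : R => (x + a) `^ k) (k * (x + a) `^ (k - 1)).
    have := @is_derive1_comp _ (@powR R ^~ k) (fun x : R => x + a) x _ _ (is_derive1_powR k xa) _.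
    by move=> /(_ 1); rewrite mulr1; apply; apply: is_derive_eq; rewrite addr0.
  have n0 : 1 + (x + a) `^ k != 0.
    by have := gker_den_neq0 k a x; rewrite ger0_norm.
  have d2 : is_derive x 1 (fun x : R => 1 + (x + a) `^ k) (k * (x + a) `^ (k - 1)).
    have := is_deriveD (is_derive_cst (1 : R) x (1 : R)) d1.
    by rewrite add0r.
  have d3 := @is_deriveV _ (fun x => 1 + (x + a) `^ k) _ _ _ n0 d2.
  apply: is_derive_eq; rewrite /gker ger0_norm// /GRing.scale /=.
  by rewrite mulNr opprK mulrC.
rewrite (ge0_integral_symm _ (continuous_gker a0) _ _ dF (l := 0)) => [|y|y|].
- rewrite lee_fin /F !add0r opprK.
  suff : (1 + a `^ k)^-1 <= 1 by lra.
  by rewrite invf_le1 ?ltr_pwDl ?powR_ge0// lerDl powR_ge0.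
- exact: gker_ge0 (ltW k0).
- by rewrite /gker normrN.
- rewrite -oppr0; apply: cvgN.
  apply/gtr0_cvgV0; first by apply: nearW => x; rewrite ltr_pwDl// powR_ge0.
  apply/cvgryPge => A; have /cvgryPge /(_ A) := cvgy_powR k0 a0.
  by apply: filterS => x /le_trans; apply; rewrite lerDr.
Qed.

Lemma ler_powR_neg (p x y : R) : p <= 0 -> 0 < x -> x <= y -> y `^ p <= x `^ p.
Proof.
move=> p0 x0 xy; have y0 : 0 < y by exact: lt_le_trans xy.
rewrite -(opprK p) powRN [leRHS]powRN lef_pV2 ?posrE ?powR_gt0//.
by rewrite ge0_ler_powR ?nnegrE ?oppr_ge0// ltW.
Qed.

(** For [k <= 1] the numerator decreases and the denominator increases with the shift; hence the
    kernels increase to [gsing] as the shift tends to 0. *)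
Lemma gker_anti (k a b y : R) : 0 < k <= 1 -> 0 < a -> a <= b -> gker k b y <= gker k a y.
Proof.
move=> /andP[k0 k1] a0 ab; rewrite /gker.
have ya : 0 < `|y| + a by rewrite ltr_wpDl.
have yb : `|y| + a <= `|y| + b by rewrite lerD2l.
apply: ler_pM; rewrite ?(mulr_ge0 (ltW k0)) ?powR_ge0 ?invr_ge0 ?sqr_ge0//.
  by rewrite ler_pM2l// ler_powR_neg// subr_le0.
rewrite lef_pV2 ?posrE ?exprn_gt0 ?ltr_pwDl ?powR_ge0//.
rewrite ler_pXn2r ?nnegrE ?addr_ge0 ?powR_ge0// lerD2l.
by rewrite ge0_ler_powR ?nnegrE ?(ltW k0)// ltW// (lt_le_trans ya).
Qed.

(* An integrable function dominating, up to constants, both [`|y| `^ (k - 1)]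
   near 0 and [`|y| `^ (- 1 - k)] at infinity. It is the monotone limit of
   derivatives of [- (1 + (`|y| + a) `^ k)^-1], so its integral is explicit. *)
Definition gsing (k y : R) : \bar R := limn (fun n => (gker k n.+1%:R^-1 y)%:E).

Lemma nondecreasing_gker (k y : R) : 0 < k <= 1 ->
  {homo (fun n => (gker k n.+1%:R^-1 y)%:E) : n m / (n <= m)%N >-> (n <= m)%E}.
Proof.
move=> k01 n m nm; rewrite lee_fin gker_anti ?invr_gt0//.
by rewrite lef_pV2 ?posrE// ler_nat ltnS.
Qed.

Lemma gsing_ge (k y : R) n : 0 < k <= 1 -> ((gker k n.+1%:R^-1 y)%:E <= gsing k y)%E.
Proof.
move=> k01; have h := ereal_nondecreasing_cvgn (@nondecreasing_gker k y k01).
by rewrite /gsing (cvg_lim _ h)//; apply: ereal_sup_ubound; exists n.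
Qed.

Lemma measurable_gker (k a : R) : 0 < a -> measurable_fun [set: R] (gker k a).
Proof. by move=> a0; apply: continuous_measurable_fun; exact: continuous_gker. Qed.

Lemma measurable_gsing (k : R) : 0 < k <= 1 -> measurable_fun [set: R] (gsing k).
Proof.
move=> k01; apply: (emeasurable_fun_cvg (fun n y => (gker k n.+1%:R^-1 y)%:E)).
  by move=> n; apply/measurable_EFinP; apply: measurable_gker; rewrite invr_gt0.
by move=> y _; exact/ereal_nondecreasing_is_cvgn/nondecreasing_gker.
Qed.

Lemma gsing_ge0 (k y : R) : 0 < k <= 1 -> (0 <= gsing k y)%E.
Proof.
move=> k01; apply: le_trans (gsing_ge y 0%N k01); rewrite lee_fin gker_ge0//.
by case/andP: k01 => /ltW.
Qed.

Lemma integral_gsing_le (k : R) : 0 < k <= 1 -> (\int[mu]_y gsing k y <= 2%:E)%E.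
Proof.
move=> k01; have [k0 k1] := andP k01.
rewrite /gsing monotone_convergence//.
- apply: lime_le; last by apply: nearW => n; apply: integral_gker_le; rewrite ?invr_gt0.
  apply: ereal_nondecreasing_is_cvgn => n m nm; apply: ge0_le_integral => //.
  + by move=> y _; rewrite lee_fin gker_ge0 ?ltW.
  + by apply/measurable_EFinP; apply: measurable_gker; rewrite invr_gt0.
  + by apply/measurable_EFinP; apply: measurable_gker; rewrite invr_gt0.
  + by move=> y _; exact: nondecreasing_gker.
- by move=> n; apply/measurable_EFinP; apply: measurable_gker; rewrite invr_gt0.
- by move=> n y _; rewrite lee_fin gker_ge0 ?ltW.
- by move=> y _; exact: nondecreasing_gker.
Qed.

(** The shift 1, that is the index [n = 0], already decays at the right rate: with s = 1 + |y| the
    denominator is at most 4 s^(2k). *)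
Lemma gsing_decay (k y : R) : 0 < k <= 1 ->
  ((k / 4 * (1 + `|y|) `^ (- 1 - k))%:E <= gsing k y)%E.
Proof.
move=> k01; have [k0 k1] := andP k01.
apply: le_trans (gsing_ge y 0%N k01); rewrite lee_fin /gker invr1.
set s : R := 1 + `|y|; rewrite [_ + 1]addrC -/s.
have s1 : 1 <= s by rewrite lerDl.
have s0 : 0 < s by exact: lt_le_trans s1.
have sk1 : 1 <= s `^ k by rewrite -(powRr0 s) ler_powR// ltW.
rewrite ler_pdivlMr ?exprn_gt0 ?ltr_pwDl ?powR_ge0//.
have -> : s `^ (k - 1) = s `^ (- 1 - k) * (s `^ k) ^+ 2.
  rewrite -powR_mulrn ?powR_ge0// -powRrM -powRD; last by rewrite (gt_eqF s0) implybT.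
  by congr (_ `^ _); lra.
have pp : 0 < s `^ (- 1 - k) by rewrite powR_gt0.
have : (1 + s `^ k) ^+ 2 <= 4 * (s `^ k) ^+ 2 by nra.
move: (s `^ k) (s `^ (-1 - k)) sk1 pp => a b a1 b0 h.
have : k * b * (1 + a) ^+ 2 <= k * b * (4 * a ^+ 2).
  by rewrite ler_pM2l// mulr_gt0.
by lra.
Qed.

(** With a shift of at most [X] the argument |y| + a lies below 2 X <= 2. The numerator loses a
    factor 2 and the denominator is at most 9, whence 18. *)
Lemma gsing_singular (k y X : R) : 0 < k <= 1 -> `|y| <= X -> 0 < X -> X <= 1 ->
  ((k / 18 * X `^ (k - 1))%:E <= gsing k y)%E.
Proof.
move=> k01 yX X0 X1; have [k0 k1] := andP k01.
pose n := Num.truncn X^-1.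
have nX : n.+1%:R^-1 <= X.
  rewrite -[leRHS]invrK lef_pV2 ?posrE ?invr_gt0//.
  by rewrite ltW// truncnS_gt.
apply: le_trans (gsing_ge y n k01); rewrite lee_fin /gker.
set t : R := `|y| + _.
have t0 : 0 < t by rewrite /t ltr_wpDl// invr_gt0.
have tX : t <= 2 * X by rewrite mulr2n mulrDl mul1r; exact: lerD yX nX.
have h1 : (2 * X) `^ (k - 1) <= t `^ (k - 1) by rewrite ler_powR_neg// subr_le0.
have h2 : X `^ (k - 1) / 2 <= (2 * X) `^ (k - 1).
  rewrite powRM ?(ltW X0)// mulrC ler_pM2r ?powR_gt0//.
  rewrite -(powR_inv1 (ler0n R 2)) ler_powR//; lra.
have h3 : t `^ k <= 2.
  apply: (@le_trans _ _ (2 `^ k)).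
    have t2 : t <= 2 by lra.
    by rewrite ge0_ler_powR ?nnegrE ?(ltW k0) ?(ltW t0).
  by rewrite -[leRHS](powRr1 (ler0n R 2)) ler_powR// ler1n.
rewrite ler_pdivlMr ?exprn_gt0 ?ltr_pwDl ?powR_ge0//.
have tk0 : 0 <= t `^ k := powR_ge0 _ _.
have h4 : (1 + t `^ k) ^+ 2 <= 9 by nra.
have h5 : 0 <= X `^ (k - 1) := powR_ge0 _ _.
apply: (@le_trans _ _ (k * (X `^ (k - 1) / 2))); last by rewrite ler_pM2l// (le_trans h2).
move: (X `^ (k-1)) (t `^ k) h5 h4 tk0 => a b a0 h4 b0.
have : k / 18 * a * (1 + b)^+2 <= k / 18 * a * 9.
  by rewrite ler_wpM2l// mulr_ge0// divr_ge0// ltW.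
lra.
Qed.

End SingularKernel.

Section PointwiseKernel.
Context {R : realType}.
Implicit Types (k kap x y X Y M p q alpha sg eps : R).

Lemma powRDp x r s : 0 < x -> x `^ (r + s) = x `^ r * x `^ s.
Proof. by move=> x0; rewrite powRD// (gt_eqF x0) implybT. Qed.

Lemma inv_le_powR (x p : R) : 1 <= x -> - 1 <= p -> x^-1 <= x `^ p.
Proof. by move=> x1 p1; rewrite -powR_inv1 ?ler_powR// (le_trans _ x1). Qed.

(** * The resonance kernel *)

(** A product of a power of the frequency size [M] and a power of [X] is split into functions of one
    variable. For [X <= 1] the singularity of [gsing k y] absorbs the power of [X], and that of [M]
    is at most 1. For [X > 1] both powers decay, and transferring them to the smaller of 1 + |x| and
    1 + |y| gives the exponent -1 - kap, at most the integrable -1 - k. *)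
Lemma gsing_pair k kap x y X M : 0 < k -> k <= kap -> kap <= 1 ->
  `|y| <= X -> 0 < X -> 1 + `|x| <= M ->
  ((M `^ (- 2 * kap) * X `^ (kap - 1))%:E <=
   (18 / k)%:E * (gsing k x + gsing k y))%E.
Proof.
move=> k0 kkap kap1 yX X0 xM.
have k01 : 0 < k <= 1 by rewrite k0 (le_trans kkap).
have [gx gy] := (gsing_ge0 x k01, gsing_ge0 y k01).
have x1 : 1 <= 1 + `|x| by rewrite lerDl.
have M1 : 1 <= M by exact: le_trans xM.
have C0 : 0 < 18 / k by rewrite divr_gt0.
have mono (a b : \bar R) : (a <= b -> (18 / k)%:E * a <= (18 / k)%:E * b)%E.
  by move: (18 / k) C0 => c c0; rewrite lee_pmul2l.
have [X1|X1] := leP X 1.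
  apply: (@le_trans _ _ ((18 / k)%:E * gsing k y)%E); last first.
    exact: (mono _ _ (leeDr (gsing k y) gx)).
  apply: (@le_trans _ _ ((18 / k)%:E * (k / 18 * X `^ (k - 1))%:E)%E); last first.
    by apply: mono; exact: gsing_singular.
  rewrite -EFinM lee_fin mulrA (_ : 18 / k * (k / 18) = 1); last by field; rewrite gt_eqF.
  apply: ler_pM; rewrite ?powR_ge0//.
    by rewrite -[leRHS](powRr0 M) ler_powR//; lra.
  by apply: ger_powR; [rewrite X0|rewrite lerD2r].
have y1 : 1 <= 1 + `|y| by rewrite lerDl.
have y0 : 0 < 1 + `|y| by exact: lt_le_trans y1.
have x0 : 0 < 1 + `|x| by exact: lt_le_trans x1.
have h1 : X `^ (kap - 1) <= 2 * (1 + `|y|) `^ (kap - 1).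
  apply: (@le_trans _ _ (((1 + `|y|) / 2) `^ (kap - 1))).
    apply: ler_powR_neg; [by lra|by rewrite divr_gt0|lra].
  rewrite powRM ?invr_ge0 ?(ltW y0)// mulrC ler_pM2r ?powR_gt0//.
  rewrite -[X in X^-1](powRr1 (ler0n R 2)) -powRN -powRrM -[leRHS](powRr1 (ler0n R 2)).
  by rewrite ler_powR//; lra.
have h2 : M `^ (- 2 * kap) <= (1 + `|x|) `^ (- 2 * kap) by apply: ler_powR_neg => //; lra.
have h3 : (1 + `|x|) `^ (- 2 * kap) * (1 + `|y|) `^ (kap - 1) <=
  (1 + `|x|) `^ (- 1 - k) + (1 + `|y|) `^ (- 1 - k).
  have [xy|yx] := leP (1 + `|x|) (1 + `|y|).
    apply: (@le_trans _ _ ((1 + `|x|) `^ (- 1 - k))); last by rewrite lerDl powR_ge0.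
    apply: (@le_trans _ _ ((1 + `|x|) `^ (- 2 * kap) * (1 + `|x|) `^ (kap - 1))).
      by rewrite ler_wpM2l ?powR_ge0//; apply: ler_powR_neg => //; lra.
    by rewrite -powRDp// ler_powR//; lra.
  apply: (@le_trans _ _ ((1 + `|y|) `^ (- 1 - k))); last by rewrite lerDr powR_ge0.
  apply: (@le_trans _ _ ((1 + `|y|) `^ (- 2 * kap) * (1 + `|y|) `^ (kap - 1))).
    by rewrite ler_wpM2r ?powR_ge0//; apply: ler_powR_neg => //; [lra|exact: ltW].
  by rewrite -powRDp// ler_powR//; lra.
apply: (@le_trans _ _ ((18 / k)%:E * ((k / 4 * (1 + `|x|) `^ (- 1 - k))%:E +
   (k / 4 * (1 + `|y|) `^ (- 1 - k))%:E))%E); last first.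
  by apply: mono; apply: leeD; exact: gsing_decay.
rewrite -EFinD -EFinM lee_fin -mulrDr mulrA (_ : 18 / k * (k / 4) = 18 / 4); last by field; rewrite gt_eqF.
apply: (@le_trans _ _ ((1 + `|x|) `^ (- 2 * kap) * (2 * (1 + `|y|) `^ (kap - 1)))).
  by apply: ler_pM; rewrite ?powR_ge0.
have := powR_ge0 (1 + `|x|) (-1 - k); have := powR_ge0 (1 + `|y|) (-1 - k).
move: h3; lra.
Qed.

(** The sum of the two exponents is kept. The smaller modulus receives the decay kap - 2 eps beyond
    -1, which makes it integrable in the modulation; the larger one keeps [kap - 1] for the
    resonance. *)
Lemma powR_maxmin X Y kap eps : 1 <= X -> 1 <= Y -> 0 <= eps -> 2 * eps <= kap ->
  X `^ (2 * eps - 1) * Y `^ (- 1) <=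
  Num.max X Y `^ (kap - 1) * Num.min X Y `^ (- 1 - (kap - 2 * eps)).
Proof.
move=> X1 Y1 e0 ek.
have X0 : 0 < X by exact: lt_le_trans X1.
have Y0 : 0 < Y by exact: lt_le_trans Y1.
have [XY|YX] := leP X Y.
  rewrite [X in _ * _ `^ X](_ : _ = (kap - 1) + (- kap)); last by lra.
  rewrite powRDp// mulrCA ler_wpM2l ?powR_ge0//.
  apply: (@le_trans _ _ (X `^ (2 * eps - 1) * X `^ (- kap))).
    by rewrite ler_wpM2l ?powR_ge0//; apply: ler_powR_neg => //; lra.
  by rewrite -powRDp//; apply: ler_powR => //; lra.
rewrite (_ : 2 * eps - 1 = (kap - 1) + (- (kap - 2 * eps)))//; last by lra.
rewrite powRDp// -mulrA ler_wpM2l ?powR_ge0//.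
apply: (@le_trans _ _ (Y `^ (- (kap - 2 * eps)) * Y `^ (- 1))).
  by rewrite ler_wpM2r ?powR_ge0//; apply: ler_powR_neg => //; [lra|exact: ltW].
by rewrite -powRDp//; apply: ler_powR => //; lra.
Qed.

(** Comparable with the bracket of [x] up to a factor 2, and free of the square root. *)
Definition japan x : R := 1 + `|x|.

Lemma japan_ge1 x : 1 <= japan x. Proof. by rewrite lerDl. Qed.

Lemma japan_gt0 x : 0 < japan x. Proof. exact: lt_le_trans (japan_ge1 x). Qed.

Definition modulus alpha (z : R * R) : R := japan z.1 `^ alpha + `|z.2 - z.1 ^+ 3|.

Definition dec k x : R := japan x `^ (- 1 - k).

(* Majorant, up to constants, of the squared reciprocal of the product of the
   two weights; [sg] is an exponent at least [- 2 * s]. *)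
Definition bkernel alpha sg eps (z1 z2 : R * R) : R :=
  japan z1.1 * japan z2.1 `^ sg *
  (modulus alpha z1 `^ (2 * eps - 1) * modulus alpha z2 `^ (- 1)).

Definition jmax (z1 z2 : R * R) : R := Num.max (japan z1.1) (japan z2.1).

(** D = M^((alpha - 1) / 2) solves M D^2 = M^alpha: at this distance the bound M^alpha for the
    larger modulus and a resonance of size M D^2 meet. The factor 6 forces [jmax] to be at least 3
    off the diagonal. *)
Definition near_diag alpha (z1 z2 : R * R) : bool :=
  `| japan z1.1 - japan z2.1 | <= 6 * jmax z1 z2 `^ ((alpha - 1) / 2).

Lemma jmax_ge1 (z1 z2 : R * R) : 1 <= jmax z1 z2.
Proof. by rewrite le_max japan_ge1. Qed.

Lemma modulus_ge alpha (z : R * R) : 0 <= alpha -> 1 + `|z.2 - z.1 ^+ 3| <= modulus alpha z.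
Proof.
by move=> a0; rewrite lerD2r -(powRr0 (japan z.1)) ler_powR// japan_ge1.
Qed.

Lemma modulus_ge1 alpha (z : R * R) : 0 <= alpha -> 1 <= modulus alpha z.
Proof. by move=> a0; apply: le_trans (modulus_ge z a0); rewrite lerDl. Qed.

Lemma max_modulus_ge alpha (z1 z2 : R * R) : 0 <= alpha ->
  jmax z1 z2 `^ alpha <= Num.max (modulus alpha z1) (modulus alpha z2).
Proof.
move=> a0; rewrite /jmax le_max; have [h|h] := leP (japan z1.1) (japan z2.1).
  by rewrite /modulus (lerDl (japan z2.1 `^ alpha)) normr_ge0 orbT.
by rewrite /modulus (lerDl (japan z1.1 `^ alpha)) normr_ge0.
Qed.

Lemma modulus_dec alpha k m (z : R * R) : 0 <= alpha -> 0 <= k -> k <= m ->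
  modulus alpha z `^ (- 1 - m) <= dec k (z.2 - z.1 ^+ 3).
Proof.
move=> a0 k0 km; apply: (@le_trans _ _ (japan (z.2 - z.1 ^+ 3) `^ (- 1 - m))).
  by apply: ler_powR_neg; [lra|exact: japan_gt0|exact: modulus_ge].
by apply: ler_powR; [exact: japan_ge1|lra].
Qed.

Lemma sg_gt alpha kap sg : 0 < alpha -> kap <= 1 / 4 ->
  sg = (alpha - 1) / 2 - 4 * kap -> - 2 <= sg.
Proof. by move=> a0 k4 ->; lra. Qed.

(** [c] bounds the ratio of [M] to [q]; since [- 2 <= sg], the loss c^(-sg) is at most c^2. *)
Lemma powR_sg_le (c M q sg : R) : - 2 <= sg -> 0 < c -> 1 <= c -> 0 < M -> M / c <= q ->
  sg <= 0 -> q `^ sg <= c ^+ 2 * M `^ sg.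
Proof.
move=> sg2 c0 c1 M0 Mq sgle0.
apply: (@le_trans _ _ ((M / c) `^ sg)); first by apply: ler_powR_neg; rewrite ?divr_gt0.
rewrite powRM ?invr_ge0 ?(ltW c0) ?(ltW M0)// mulrC ler_pM2r ?powR_gt0//.
rewrite -[X in X^-1](powRr1 (ltW c0)) -powRN -powRrM -powR_mulrn ?(ltW c0)//.
by apply: ler_powR => //; lra.
Qed.

(** For [sg < 0] the sign hypothesis gives [alpha <= 1], so the threshold is at most 6 and the two
    values of [japan] differ by a factor of at most 7: hence 49 = 7^2. The factor 6 of the
    threshold, raised to [kap - 1], costs another 6, and 294 = 49 * 6. *)
Lemma near_diag_bound alpha kap sg (z1 z2 : R * R) :
  0 < alpha -> alpha <= 3 -> 0 < kap -> kap <= 1 / 4 ->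
  sg = (alpha - 1) / 2 - 4 * kap -> alpha <= 1 \/ 0 <= sg ->
  near_diag alpha z1 z2 ->
  japan z1.1 * japan z2.1 `^ sg * (jmax z1 z2 `^ alpha) `^ (kap - 1) <=
  294 * (jmax z1 z2 `^ (- 2 * kap) *
         (6 * jmax z1 z2 `^ ((alpha - 1) / 2)) `^ (kap - 1)).
Proof.
move=> alpha0 alpha3 kap0 kap4 sgE sg_sign; have sg2 := sg_gt alpha0 kap4 sgE.
rewrite /near_diag; set M := jmax z1 z2; set p := japan z1.1; set q := japan z2.1.
move=> hA.
have M1 : 1 <= M := jmax_ge1 z1 z2.
have M0 : 0 < M by exact: lt_le_trans M1.
have pM : p <= M by rewrite le_max lexx.
have qM : q <= M by rewrite le_max lexx orbT.
have [p1 q1] : 1 <= p /\ 1 <= q by split; exact: japan_ge1.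
have h1 : q `^ sg <= 49 * M `^ sg.
  have [/[dup] sglt0 /ltW sgle0|sggt0] := ltP sg 0; last first.
    apply: (@le_trans _ _ (M `^ sg)); first by rewrite ge0_ler_powR ?nnegrE//; lra.
    by rewrite ler_peMl ?powR_ge0//; lra.
  have al1 : alpha <= 1.
    by case: sg_sign => // sgge0; move: sgge0 sglt0; lra.
  rewrite [X in X * _](_ : _ = 7 ^+ 2); last by lra.
  apply: powR_sg_le => //; first by lra.
  have Me : M `^ ((alpha - 1) / 2) <= 1.
    by rewrite -[leRHS](powRr0 M) ler_powR//; lra.
  have := le_trans hA (ler_wpM2l (ler0n R 6) Me).
  have : M = p \/ M = q by rewrite /M /jmax -/p -/q; case: leP; [right|left].
  rewrite ler_norml => -[->|->] /andP[]; lra.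
have E : M `^ 1 * M `^ sg * (M `^ alpha) `^ (kap - 1) <=
    M `^ (- 2 * kap) * (M `^ ((alpha - 1) / 2)) `^ (kap - 1).
  rewrite -!powRrM -!powRDp//; apply: ler_powR => //.
  (* The left exponent minus the right one is kap (alpha - 3) / 2, nonpositive for [alpha <= 3]. *)
  rewrite sgE; nra.
rewrite powRr1 ?(ltW M0)// in E.
have six : 6^-1 <= (6 : R) `^ (kap - 1).
  by apply: inv_le_powR; rewrite ?ler1n// lerBrDr addNr ltW.
rewrite (powRM _ (ler0n R 6) (powR_ge0 _ _)).
move: (M `^ (- 2 * kap)) ((M `^ ((alpha - 1) / 2)) `^ (kap - 1)) (powR_ge0 M (- 2 * kap))
  (powR_ge0 (M `^ ((alpha - 1) / 2)) (kap - 1)) E => a b a0 b0 E.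
apply: (@le_trans _ _ (49 * (M * M `^ sg * (M `^ alpha) `^ (kap - 1)))).
  rewrite mulrA ler_wpM2r ?powR_ge0//.
  rewrite mulrCA; apply: ler_pM => //; rewrite ?powR_ge0//; lra.
apply: (@le_trans _ _ (49 * (a * b))); first by rewrite ler_pM2l.
have : 6^-1 * (a * b) <= 6 `^ (kap - 1) * (a * b) by rewrite ler_wpM2r ?mulr_ge0.
lra.
Qed.

(** Off the diagonal 6 / M < |p - q| <= M - 1, because (alpha - 1) / 2 >= -1; then M (M - 1) > 6
    forces M > 3. *)
Lemma off_diag_jmax alpha (z1 z2 : R * R) : 0 < alpha ->
  ~~ near_diag alpha z1 z2 -> 3 <= jmax z1 z2.
Proof.
move=> alpha0; rewrite /near_diag -ltNge; set M := jmax z1 z2; set p := japan z1.1; set q := japan z2.1.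
move=> hB.
have M1 : 1 <= M := jmax_ge1 z1 z2.
have M0 : 0 < M by exact: lt_le_trans M1.
have [p1 q1] : 1 <= p /\ 1 <= q by split; exact: japan_ge1.
have pM : p <= M by rewrite le_max lexx.
have qM : q <= M by rewrite le_max lexx orbT.
have h : `|p - q| <= M - 1 by rewrite ler_norml; apply/andP; split; lra.
have Me : M^-1 <= M `^ ((alpha - 1) / 2).
  by rewrite -(powR_inv1 (ltW M0)) ler_powR//; lra.
have : 6 / M < M - 1 by move: (lt_le_trans hB h); lra.
rewrite ltr_pdivrMr//; nra.
Qed.

(** Either the power of [japan z2.1] is at most 4 times that of [jmax], and |p - q| >= M^((alpha -
    1) / 2) balances the exponents; or [sg <= 0] and the second frequency is small, and then its
    power is at most 1 while |p - q| >= M / 2. *)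
Lemma off_diag_bound alpha kap sg (z1 z2 : R * R) :
  0 < alpha -> alpha <= 3 -> 0 < kap -> kap <= 1 / 4 ->
  sg = (alpha - 1) / 2 - 4 * kap -> alpha <= 1 \/ 0 <= sg ->
  ~~ near_diag alpha z1 z2 ->
  japan z1.1 * japan z2.1 `^ sg *
    (`|japan z1.1 - japan z2.1| * jmax z1 z2) `^ (kap - 1) <=
  4 * jmax z1 z2 `^ (- 2 * kap).
Proof.
move=> alpha0 alpha3 kap0 kap4 sgE sg_sign; have sg2 := sg_gt alpha0 kap4 sgE.
move=> /[dup] /(off_diag_jmax alpha0); rewrite /near_diag -ltNge.
set M := jmax z1 z2; set p := japan z1.1; set q := japan z2.1.
move=> M3 hB.
have M1 : 1 <= M := jmax_ge1 z1 z2.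
have M0 : 0 < M by exact: lt_le_trans M1.
have [p1 q1] : 1 <= p /\ 1 <= q by split; exact: japan_ge1.
have pM : p <= M by rewrite le_max lexx.
have qM : q <= M by rewrite le_max lexx orbT.
have [qs|[sgle0 qs]] : q `^ sg <= 4 * M `^ sg \/ (sg <= 0 /\ q < M / 2).
- have [/[dup] sglt0 /ltW sgle0|sggt0] := ltP sg 0; last first.
    left; apply: (@le_trans _ _ (M `^ sg)); first by rewrite ge0_ler_powR ?nnegrE//; lra.
    by rewrite ler_peMl ?powR_ge0//; lra.
  have [qM2|qM2] := ltP q (M / 2); [by right|left].
  by rewrite (_ : 4 = 2 ^+ 2); [apply: powR_sg_le => //; rewrite ?ler1n|lra].
- have h : (`|p - q| * M) `^ (kap - 1) <= (M `^ ((alpha + 1) / 2)) `^ (kap - 1).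
    apply: ler_powR_neg; [by lra|by rewrite powR_gt0|].
    rewrite (_ : (alpha + 1) / 2 = (alpha - 1) / 2 + 1); last by lra.
    rewrite powRDp// powRr1 ?(ltW M0)// ler_pM2r//.
    apply: le_trans (ltW hB); rewrite ler_peMl ?powR_ge0//; lra.
  have E : M `^ 1 * M `^ sg * (M `^ ((alpha + 1) / 2)) `^ (kap - 1) <= M `^ (- 2 * kap).
    rewrite -!powRrM -!powRDp//; apply: ler_powR => //.
    (* The exponents again differ by kap (alpha - 3) / 2. *)
    rewrite sgE; nra.
  rewrite powRr1 ?(ltW M0)// in E.
  apply: (@le_trans _ _ (4 * (M * M `^ sg * (M `^ ((alpha + 1) / 2)) `^ (kap - 1)))).
    rewrite [leRHS]mulrA; apply: ler_pM => //; rewrite ?powR_ge0// ?mulr_ge0 ?powR_ge0//; first lra.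
    by rewrite mulrCA; apply: ler_pM => //; rewrite ?powR_ge0//; lra.
  by rewrite ler_pM2l.
- have pE : M = p.
    rewrite /M /jmax -/p -/q max_l// leNgt; apply/negP => pq.
    by move: qs; rewrite /M /jmax -/p -/q max_r ?(ltW pq)//; lra.
  have h : (`|p - q| * M) `^ (kap - 1) <= 2 * M `^ (2 * (kap - 1)).
    apply: (@le_trans _ _ ((2^-1 * (M * M)) `^ (kap - 1))).
      apply: ler_powR_neg; [by lra|by rewrite !mulr_gt0|].
      by rewrite mulrA ler_pM2r// ger0_norm; lra.
    rewrite powRM ?mulr_ge0 ?(ltW M0)//.
    rewrite [X in _ * X](_ : _ = M `^ (2 * (kap - 1))); last first.
      by rewrite powRM ?(ltW M0)// -powRDp//; congr (_ `^ _); lra.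
    rewrite ler_pM2r ?powR_gt0//.
    rewrite -[X in X^-1](powRr1 (ler0n R 2)) -powRN -powRrM -[leRHS](powRr1 (ler0n R 2)).
    by rewrite ler_powR//; lra.
  have q2 : q `^ sg <= 1.
    by rewrite -[leRHS](powRr0 q) ler_powR.
  apply: (@le_trans _ _ (M * 1 * (2 * M `^ (2 * (kap - 1))))).
    apply: ler_pM; rewrite ?mulr_ge0 ?powR_ge0//; first lra.
    by apply: ler_pM; rewrite ?powR_ge0//; lra.
  (* The inequality 1 + 2 (kap - 1) <= -2 kap is exactly [kap <= 1 / 4]. *)
  have E : M `^ 1 * M `^ (2 * (kap - 1)) <= M `^ (- 2 * kap).
    by rewrite -!powRDp//; apply: ler_powR => //; lra.
  rewrite powRr1 ?(ltW M0)// in E.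
  have := powR_ge0 M (- 2 * kap); move: E; lra.
Qed.


(* On [xi1 + xi2 = xi] the resonance function vanishes where
   [`|xi1 - xi / 2|] equals this value; if the radicand is negative, [Num.sqrt]
   gives 0, which still satisfies the lower bound of [resonance]. *)
Definition critical (xi tau : R) : R := Num.sqrt ((tau - xi ^+ 3 / 4) / (3 * xi)).

(* [xi1^3 + xi2^3 = xi^3/4 + 3 xi h^2] for [xi1 = xi/2 + h], [xi2 = xi/2 - h]. *)
Lemma resonance (z1 z2 : R * R) (xi := z1.1 + z2.1) (tau := z1.2 + z2.2) :
  3 / 2 * `|z1.1 ^+ 2 - z2.1 ^+ 2| * `| `|z1.1 - xi / 2| - critical xi tau| <=
  `|z1.2 - z1.1 ^+ 3| + `|z2.2 - z2.1 ^+ 3|.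
Proof.
apply: (le_trans _ (ler_normD _ _)).
set h := z1.1 - xi / 2; set c := critical xi tau.
have [xi0|xi0] := eqVneq xi 0.
  rewrite (_ : z1.1 ^+ 2 - z2.1 ^+ 2 = xi * (z1.1 - z2.1)); last by rewrite /xi; ring.
  by rewrite xi0 mul0r normr0 mulr0 mul0r.
set a := (tau - xi ^+ 3 / 4) / (3 * xi).
have -> : z1.2 - z1.1 ^+ 3 + (z2.2 - z2.1 ^+ 3) = 3 * xi * (a - h ^+ 2).
  rewrite /a mulrBr [3 * xi * _]mulrC divfK; last by rewrite mulf_neq0.
  by rewrite /h /xi /tau; field.
have -> : z1.1 ^+ 2 - z2.1 ^+ 2 = 2 * xi * h by rewrite /h /xi; field.
(* If a = c^2, the right side factors with c + |h| >= |h| as one factor. If a <= 0 then c = 0 and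
   the claim is h^2 <= h^2 - a. *)
have key : `|h| * `| `|h| - c| <= `|a - h ^+ 2|.
  have [a0|a0] := leP a 0.
    rewrite /c /critical -/a (ler0_sqrtr a0) subr0 normr_id [leRHS]ler0_norm.
      by rewrite -normrM -expr2 ger0_norm ?sqr_ge0// opprB lerDl oppr_ge0.
    by rewrite subr_le0 (le_trans a0)// sqr_ge0.
  have c0 : 0 <= c by rewrite sqrtr_ge0.
  have -> : a = c ^+ 2 by rewrite /c /critical sqr_sqrtr// ltW.
  rewrite -(real_normK (num_real h)) -[leRHS]normrN opprB subr_sqr normrM mulrC.
  rewrite ler_wpM2l// (ger0_norm (addr_ge0 (normr_ge0 h) c0)).
  by rewrite lerDl.
rewrite !normrM !normr_nat.
move: (ler_wpM2l (normr_ge0 xi) key); lra.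
Qed.

Lemma bkernel_maxmin alpha kap sg eps (z1 z2 : R * R) :
  0 < alpha -> 0 <= eps -> eps <= kap / 4 -> 0 < kap ->
  bkernel alpha sg eps z1 z2 <=
  japan z1.1 * japan z2.1 `^ sg *
  (Num.max (modulus alpha z1) (modulus alpha z2) `^ (kap - 1) *
   Num.min (modulus alpha z1) (modulus alpha z2) `^ (- 1 - (kap - 2 * eps))).
Proof.
move=> a0 e0 e4 k0; rewrite ler_wpM2l ?mulr_ge0 ?powR_ge0 ?(ltW (japan_gt0 _))//.
by apply: powR_maxmin => //; [exact: modulus_ge1 (ltW a0)|exact: modulus_ge1 (ltW a0)|lra].
Qed.

Lemma bkernel_near alpha kap sg eps (z1 z2 : R * R) :
  0 < alpha -> alpha <= 3 -> 0 < kap -> kap <= 1 / 4 ->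
  sg = (alpha - 1) / 2 - 4 * kap -> alpha <= 1 \/ 0 <= sg ->
  0 <= eps -> eps <= kap / 4 -> near_diag alpha z1 z2 ->
  bkernel alpha sg eps z1 z2 <=
  294 * (jmax z1 z2 `^ (- 2 * kap) *
         (6 * jmax z1 z2 `^ ((alpha - 1) / 2)) `^ (kap - 1)) *
   Num.min (modulus alpha z1) (modulus alpha z2) `^ (- 1 - (kap - 2 * eps)).
Proof.
move=> a0 a3 k0 k4 sgE sgs e0 e4 hA.
apply: (le_trans (bkernel_maxmin sg z1 z2 a0 e0 e4 k0)).
rewrite mulrA ler_wpM2r ?powR_ge0//.
apply: le_trans (near_diag_bound a0 a3 k0 k4 sgE sgs hA).
rewrite ler_wpM2l ?mulr_ge0 ?powR_ge0 ?(ltW (japan_gt0 _))//.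
apply: ler_powR_neg; [by lra| |exact: max_modulus_ge (ltW a0)].
by rewrite powR_gt0// (lt_le_trans _ (jmax_ge1 _ _)).
Qed.

(** The resonance identity bounds |y| by X, a multiple of the larger modulus over |p - q| M. Trading
    the larger modulus for X produces the factor that [off_diag_bound] controls. This gives the
    constant 32 / 3; the larger 294 is shared with [bkernel_near]. *)
Lemma bkernel_off alpha kap sg eps (z1 z2 : R * R)
  (y := `|z1.1 - (z1.1 + z2.1) / 2| - critical (z1.1 + z2.1) (z1.2 + z2.2)) :
  0 < alpha -> alpha <= 3 -> 0 < kap -> kap <= 1 / 4 ->
  sg = (alpha - 1) / 2 - 4 * kap -> alpha <= 1 \/ 0 <= sg ->
  0 <= eps -> eps <= kap / 4 -> ~~ near_diag alpha z1 z2 ->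
  exists X : R, [/\ 0 < X, `|y| <= X &
  bkernel alpha sg eps z1 z2 <=
  294 * (jmax z1 z2 `^ (- 2 * kap) * X `^ (kap - 1)) *
   Num.min (modulus alpha z1) (modulus alpha z2) `^ (- 1 - (kap - 2 * eps))].
Proof.
move=> a0 a3 k0 k4 sgE sgs e0 e4 hB.
have M3 := off_diag_jmax a0 hB.
set M := jmax z1 z2 in M3 *; set p := japan z1.1; set q := japan z2.1.
have M0 : 0 < M by lra.
set Z := Num.max (modulus alpha z1) (modulus alpha z2).
have Z1 : 1 <= Z by rewrite le_max modulus_ge1// ltW.
have pq0 : 0 < `|p - q|.
  move: hB; rewrite /near_diag -ltNge; apply: le_lt_trans.
  by rewrite mulr_ge0// powR_ge0.
(* 3/8 collects 3/2 from the resonance identity, 1/2 from p + q - 2 >= M / 2, and 1/2 because the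
   two modulations add up to at most 2 Z. *)
pose a : R := 3 / 8 * (`|p - q| * M).
have a_gt0 : 0 < a by rewrite !mulr_gt0.
exists (Z / a); split.
- by rewrite divr_gt0//; lra.
- rewrite ler_pdivlMr//.
  have h1 : `|z1.2 - z1.1 ^+ 3| + `|z2.2 - z2.1 ^+ 3| <= 2 * Z.
    have := modulus_ge z1 (ltW a0); have := modulus_ge z2 (ltW a0).
    have : modulus alpha z1 <= Z by rewrite le_max lexx.
    have : modulus alpha z2 <= Z by rewrite le_max lexx orbT.
    lra.
  have := le_trans (resonance z1 z2) h1; rewrite -/y.
  have -> : `|z1.1 ^+ 2 - z2.1 ^+ 2| = `|p - q| * (p + q - 2).
    rewrite -[X in `|X - _|](real_normK (num_real _)) -[X in `|_ - X|](real_normK (num_real _)).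
    rewrite subr_sqr normrM [X in _ * X]ger0_norm ?addr_ge0//.
    by rewrite /p /q /japan; congr (`|_| * _); ring.
  have [p1 q1] : 1 <= p /\ 1 <= q by split; exact: japan_ge1.
  have hM : M / 2 <= p + q - 2.
    by have [MM|MM] : M = p \/ M = q; [rewrite /M /jmax -/p -/q; case: leP; [right|left]|lra|lra].
  have h2 : `|p - q| * (M / 2) * `|y| <= `|p - q| * (p + q - 2) * `|y|.
    by rewrite ler_wpM2r// ler_wpM2l.
  rewrite /a; lra.
- apply: (le_trans (bkernel_maxmin sg z1 z2 a0 e0 e4 k0)); rewrite -/Z.
  rewrite mulrA ler_wpM2r ?powR_ge0//.
  rewrite -{1}(divfK (lt0r_neq0 a_gt0) Z) powRM ?(ltW a_gt0) ?divr_ge0 ?(ltW a_gt0)//; last lra.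
  rewrite [in leRHS]mulrA [X in _ * X]mulrC mulrA ler_wpM2r ?powR_ge0//.
  have h3 : a `^ (kap - 1) <= 8 / 3 * (`|p - q| * M) `^ (kap - 1).
    have n38 : 0 <= 3 / 8 :> R by lra.
    rewrite /a (powRM _ n38 (mulr_ge0 (normr_ge0 _) (ltW M0))).
    rewrite ler_pM2r ?powR_gt0 ?mulr_gt0//.
    rewrite (_ : 8 / 3 = (3 / 8) `^ (- 1)).
      by apply: ger_powR; [apply/andP; split; lra|lra].
    by rewrite powR_inv1; [field|lra].
  have := off_diag_bound a0 a3 k0 k4 sgE sgs hB; rewrite -/M -/p -/q.
  have pq : 0 <= p * q `^ sg by rewrite mulr_ge0 ?powR_ge0 ?(ltW (japan_gt0 _)).
  have := ler_wpM2l pq h3.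
  have := powR_ge0 M (- 2 * kap).
  lra.
Qed.

End PointwiseKernel.

(** * The weights against powers of [japan] and [modulus] *)

Section WeightBounds.
Context {R : realType}.
Implicit Types (alpha s b eps sg x : R) (z : R * R).

Lemma bracket_ge1 (w : R[i]) : 1 <= bracket w.
Proof. by rewrite /bracket -[leLHS]sqrtr1 ler_wsqrtr// lerDl sqr_ge0. Qed.

Lemma bracket_gt0 (w : R[i]) : 0 < bracket w.
Proof. exact: lt_le_trans (bracket_ge1 w). Qed.

Lemma bracketE (a b : R) : bracket (a +i* b)%C = Num.sqrt (1 + (a ^+ 2 + b ^+ 2)).
Proof. by rewrite /bracket /= sqr_sqrtr// addr_ge0 ?sqr_ge0. Qed.

Lemma weightE alpha s b z : weight alpha s b z =
  bracket (`|z.1| `^ alpha +i* (z.2 - z.1 ^+ 3))%C `^ b * bracket z.1%:C%C `^ s.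
Proof. by case: z. Qed.

Lemma weight_gt0 alpha s b z : 0 < weight alpha s b z.
Proof. by rewrite weightE mulr_gt0// powR_gt0// bracket_gt0. Qed.

Lemma weight_sqrV alpha s b z : weight alpha s b z ^- 2 =
  bracket (`|z.1| `^ alpha +i* (z.2 - z.1 ^+ 3))%C `^ (- (2 * b)) * bracket z.1%:C%C `^ (- (2 * s)).
Proof.
rewrite weightE; move: (bracket _) (bracket _) => A B.
rewrite exprMn invfM -!powR_mulrn ?powR_ge0// -!powRrM -!powRN.
by rewrite [b * 2]mulrC [s * 2]mulrC.
Qed.

Lemma bracket_le_japan x : bracket x%:C%C <= japan x.
Proof.
rewrite bracketE expr0n addr0 -[leRHS]ger0_norm ?(ltW (japan_gt0 x))//.
rewrite -sqrtr_sqr ler_wsqrtr// /japan -(real_normK (num_real x)).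
have := normr_ge0 x; nra.
Qed.

Lemma japan_le_bracket x : japan x / 2 <= bracket x%:C%C.
Proof.
rewrite bracketE expr0n addr0 -[leLHS]ger0_norm ?divr_ge0 ?(ltW (japan_gt0 x))//.
rewrite -sqrtr_sqr ler_wsqrtr// /japan -(real_normK (num_real x)).
have := normr_ge0 x; nra.
Qed.

(** 1 + |x| is at most twice the larger of 1 and |x|, and 2^alpha <= 8. *)
Lemma japan_powR_le alpha x : 0 < alpha -> alpha <= 3 ->
  japan x `^ alpha <= 8 * (1 + `|x| `^ alpha).
Proof.
move=> a0 a3; have x0 := normr_ge0 x.
have h8 : 2 `^ alpha <= 8 :> R.
  rewrite (_ : 8 = 2 `^ 3); first by rewrite ler_powR// ler1n.
  by rewrite powR_mulrn//; lra.
have [x1|x1] := leP `|x| 1.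
  apply: (@le_trans _ _ (2 `^ alpha)).
    by rewrite ge0_ler_powR ?nnegrE ?(ltW a0) ?(ltW (japan_gt0 x))// /japan; lra.
  have := powR_ge0 `|x| alpha; lra.
apply: (@le_trans _ _ ((2 * `|x|) `^ alpha)).
  by rewrite ge0_ler_powR ?nnegrE ?(ltW a0) ?(ltW (japan_gt0 x)) ?mulr_ge0// /japan; lra.
rewrite powRM// mulrDr mulr1; apply: (@le_trans _ _ (8 * `|x| `^ alpha)); last by lra.
by rewrite ler_wpM2r ?powR_ge0.
Qed.

Lemma modulus_le_bracket alpha z : 0 < alpha -> alpha <= 3 ->
  modulus alpha z / 16 <= bracket (`|z.1| `^ alpha +i* (z.2 - z.1 ^+ 3))%C.
Proof.
move=> a0 a3; rewrite bracketE.
have h := japan_powR_le z.1 a0 a3.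
have m0 : 0 <= modulus alpha z by rewrite (le_trans _ (modulus_ge1 z (ltW a0))).
rewrite -[leLHS]ger0_norm ?divr_ge0//.
rewrite -sqrtr_sqr ler_wsqrtr//.
move: h m0; rewrite /modulus -(real_normK (num_real (z.2 - z.1 ^+ 3))).
move: (`|z.1| `^ alpha) (powR_ge0 `|z.1| alpha) `|z.2 - z.1 ^+ 3| (normr_ge0 (z.2 - z.1 ^+ 3)) (japan z.1 `^ alpha)
  (powR_ge0 (japan z.1) alpha) => A A0 B B0 J J0 h m0.
apply: (@le_trans _ _ (((8 * (1 + A) + B) / 16) ^+ 2)).
  by rewrite ler_pXn2r ?nnegrE ?divr_ge0//; lra.
(* The three squares absorb the cross terms 128 A, 16 B and 16 A B of the expanded square. *)
have := sqr_ge0 (A - 1); have := sqr_ge0 (8 - B); have := sqr_ge0 (8 * A - B).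
move: (sqr_ge0 A) (sqr_ge0 B); lra.
Qed.

Lemma powR_div_le (c x y p : R) : - 2 <= p -> p <= 0 -> 1 <= c -> 0 < x ->
  x / c <= y -> y `^ p <= c ^+ 2 * x `^ p.
Proof.
move=> p2 p0 c1 x0 xy.
exact: powR_sg_le p2 (lt_le_trans ltr01 c1) c1 x0 xy p0.
Qed.

Lemma weight1_sqrV_le alpha eps z : 0 < alpha -> alpha <= 3 -> 0 <= eps -> eps <= 1 / 2 ->
  weight alpha (- (1 / 2)) (1 / 2 - eps) z ^- 2 <=
  256 * (japan z.1 * modulus alpha z `^ (2 * eps - 1)).
Proof.
move=> a0 a3 e0 e1; rewrite weight_sqrV.
rewrite (_ : - (2 * (1 / 2 - eps)) = 2 * eps - 1); last by field.
rewrite (_ : - (2 * - (1 / 2)) = 1); last by field.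
rewrite powRr1 ?(ltW (bracket_gt0 _))// mulrCA mulrC.
apply: ler_pM; rewrite ?powR_ge0 ?(ltW (bracket_gt0 _)) ?bracket_le_japan//.
rewrite (_ : 256 = 16 ^+ 2); last by lra.
apply: powR_div_le; [lra|lra|lra|exact: lt_le_trans (modulus_ge1 z (ltW a0))|].
exact: modulus_le_bracket.
Qed.

(** The power [sg] of the bracket compares with that of [japan] by the lower bound for the bracket
    if [sg <= 0], at the cost of 4, and by the upper bound otherwise. *)
Lemma weight2_sqrV_le alpha s sg z : 0 < alpha -> alpha <= 3 -> - 2 <= sg ->
  - (2 * s) <= sg ->
  weight alpha s (1 / 2) z ^- 2 <=
  256 * 4 * (japan z.1 `^ sg * modulus alpha z `^ (- 1)).
Proof.
move=> a0 a3 sg2 ssg; rewrite weight_sqrV.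
rewrite (_ : - (2 * (1 / 2)) = - 1); last by field.
have h1 : bracket (`|z.1| `^ alpha +i* (z.2 - z.1 ^+ 3))%C `^ (- 1) <= 256 * modulus alpha z `^ (- 1).
  rewrite (_ : 256 = 16 ^+ 2); last by lra.
  apply: powR_div_le; [lra|lra|lra|exact: lt_le_trans (modulus_ge1 z (ltW a0))|].
  exact: modulus_le_bracket.
have h2 : bracket z.1%:C%C `^ (- (2 * s)) <= 4 * japan z.1 `^ sg.
  apply: (@le_trans _ _ (bracket z.1%:C%C `^ sg)); first by rewrite ler_powR// bracket_ge1.
  have [sg0|/ltW sg0] := leP sg 0.
    rewrite (_ : 4 = 2 ^+ 2); last by lra.
    by apply: powR_div_le => //; [lra|exact: japan_gt0|exact: japan_le_bracket].
  apply: (@le_trans _ _ (japan z.1 `^ sg)); last by rewrite ler_peMl ?powR_ge0//; lra.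
  by rewrite ge0_ler_powR ?nnegrE ?(ltW (japan_gt0 _)) ?(ltW (bracket_gt0 _)) ?bracket_le_japan.
apply: (le_trans (ler_pM (powR_ge0 _ _) (powR_ge0 _ _) h1 h2)).
by rewrite mulrACA [X in _ * X]mulrC; rewrite le_eqVlt; apply/orP; left; apply/eqP; ring.
Qed.

End WeightBounds.

(** * Lebesgue measure on the plane *)

Section Plane.
Context {R : realType}.
Local Notation mu := (@lebesgue_measure R).
Local Notation TR := (measurableTypeR R).
Local Open Scope ereal_scope.

HB.instance Definition _ := Measure.on (@leb2 R).

(** Squares of sets exhausting the line exhaust the plane. The resulting structure is what Tonelli's
    theorem on pairs of points asks for. *)
Let leb2_sigma_finite : sigma_finite setT (@leb2 R).
Proof.
have /sigma_finiteP[F [TF ndF Foo]] := sigma_finiteT mu.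
exists (fun n => F n `*` F n).
  apply/esym; rewrite -subTset => -[x y] _.
  have [n _ Fx] : (\bigcup_n F n) x by rewrite -TF.
  have [m _ Fy] : (\bigcup_n F n) y by rewrite -TF.
  exists (maxn n m) => //; split => /=.
  - by have /subsetPset := ndF _ _ (leq_maxl n m); exact.
  - by have /subsetPset := ndF _ _ (leq_maxr n m); exact.
move=> n; have [mF Fn] := Foo n; split; first exact: measurableX.
by rewrite /leb2 product_measure1E// lte_mul_pinfty// ge0_fin_numE.
Qed.

HB.instance Definition _ := Measure_isSigmaFinite.Build _ _ _ (@leb2 R) leb2_sigma_finite.

Lemma plane_tonelli (f : TR * TR -> \bar R) : measurable_fun setT f -> (forall z, 0 <= f z) ->
  \int[leb2]_z f z = \int[mu]_x \int[mu]_y f (x, y).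
Proof. by move=> mf f0; rewrite fubini_tonelli1. Qed.

Lemma measurable_pair_fix (f : TR * TR -> \bar R) (x : TR) :
  measurable_fun setT f -> measurable_fun setT (fun y : TR => f (x, y)).
Proof. by move=> mf; apply: (measurableT_comp mf); exact: pair1_measurable. Qed.

Lemma measurable_planeB d (T : measurableType d) (f g : T -> TR * TR) :
  measurable_fun setT f -> measurable_fun setT g ->
  measurable_fun setT (fun t => (f t - g t)%R : TR * TR).
Proof.
move=> mf mg; apply/measurable_fun_pair => /=; apply: measurable_funB.
- exact: (measurableT_comp measurable_fst mf).
- exact: (measurableT_comp measurable_fst mg).
- exact: (measurableT_comp measurable_snd mf).
- exact: (measurableT_comp measurable_snd mg).
Qed.

Lemma plane_sub (f : TR * TR -> \bar R) (a : TR * TR) :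
  measurable_fun setT f -> (forall z, 0 <= f z) ->
  \int[leb2]_z f (a - z)%R = \int[leb2]_z f z.
Proof.
move=> mf f0.
have ms : measurable_fun setT (fun z : TR * TR => (a - z)%R : TR * TR).
  apply/measurable_fun_pair => /=; apply: measurable_funB => //.
rewrite (plane_tonelli (f := fun z => f (a - z)%R))//; last exact: (measurableT_comp mf).
rewrite (plane_tonelli mf f0).
under eq_integral => x _.
  rewrite (_ : (fun y => _) = fun y : R => f ((a.1 - x)%R, (a.2 - y)%R))//.
  rewrite (@ge0_integral_sub _ (fun y => f ((a.1 - x)%R, y)))//; last first.
    exact: measurable_pair_fix.
  over.
rewrite (@ge0_integral_sub _ (fun x => \int[mu]_y f (x, y)))//.
- exact: measurable_fun_fubini_tonelli_F.
- by move=> x; apply: integral_ge0.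
Qed.

Lemma plane_shift (f : TR * TR -> \bar R) (a : TR * TR) :
  measurable_fun setT f -> (forall z, 0 <= f z) ->
  \int[leb2]_z f (z + a)%R = \int[leb2]_z f z.
Proof.
move=> mf f0.
have mN : measurable_fun setT (fun z : TR * TR => (0 - z)%R : TR * TR).
  by apply/measurable_fun_pair => /=; apply: measurable_funB => //.
rewrite -(plane_sub a mf f0) -(@plane_sub (fun z => f (a - z)%R) 0%R)//.
- by apply: eq_integral => z _; rewrite sub0r opprK addrC.
- apply: (measurableT_comp mf).
  by apply/measurable_fun_pair => /=; apply: measurable_funB => //.
Qed.

Lemma plane2_tonelli (f : (TR * TR) * (TR * TR) -> \bar R) :
  measurable_fun setT f -> (forall z, 0 <= f z) ->
  \int[leb2]_x \int[leb2]_y f (x, y) = \int[leb2]_y \int[leb2]_x f (x, y).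
Proof. by move=> mf f0; rewrite fubini_tonelli. Qed.

End Plane.

(** * Measurability of the weights *)

Section MeasurableKernels.
Context {R : realType}.
Context d (T : measurableType d).
Implicit Types (f g : T -> R).
Local Open Scope ereal_scope.

Lemma measurable_sqrtr : measurable_fun [set: R] (@Num.sqrt R).
Proof. by apply: continuous_measurable_fun; exact: sqrt_continuous. Qed.

Lemma measurable_japan : measurable_fun [set: R] (@japan R).
Proof. exact: measurable_funD. Qed.

Lemma measurable_modulus (alpha : R) (f g : T -> R) :
  measurable_fun setT f -> measurable_fun setT g ->
  measurable_fun setT (fun t => modulus alpha (f t, g t)).
Proof.
move=> mf mg; apply: measurable_funD => /=.
  apply: (measurableT_comp (@measurable_powR R alpha)).
  exact: (measurableT_comp measurable_japan).
apply: (measurableT_comp (@normr_measurable R setT)).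
by apply: measurable_funB => //; exact: measurable_funX.
Qed.

Lemma measurable_weight (alpha s b : R) (f g : T -> R) :
  measurable_fun setT f -> measurable_fun setT g ->
  measurable_fun setT (fun t => weight alpha s b (f t, g t)).
Proof.
move=> mf mg; rewrite (_ : (fun t => _) = fun t => (
  Num.sqrt (1 + ((`|f t| `^ alpha) ^+ 2 + (g t - f t ^+ 3) ^+ 2)) `^ b *
  Num.sqrt (1 + (f t ^+ 2 + 0 ^+ 2)) `^ s)%R); last first.
  by apply/funext => t; rewrite weightE !bracketE.
apply: measurable_funM; apply: (measurableT_comp (@measurable_powR R _));
  apply: (measurableT_comp measurable_sqrtr); apply: measurable_funD => //;
  apply: measurable_funD => //; apply: measurable_funX => //.
- apply: (measurableT_comp (@measurable_powR R _)).
  exact: (measurableT_comp (@normr_measurable R setT)).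
- by apply: measurable_funB => //; exact: measurable_funX.
Qed.

End MeasurableKernels.

Lemma ge0_le_integralT d (T : measurableType d) (R : realType)
    (m : {measure set T -> \bar R}) (f g : T -> \bar R) :
  (forall x, 0 <= f x)%E -> measurable_fun setT f -> measurable_fun setT g ->
  (forall x, f x <= g x)%E -> (\int[m]_x f x <= \int[m]_x g x)%E.
Proof. by move=> f0 mf mg fg; apply: ge0_le_integral. Qed.

(** * Uniform bounds for kernel integrals *)

Section SupBounds.
Context {R : realType}.
Local Notation mu := (@lebesgue_measure R).
Local Notation TR := (measurableTypeR R).
Local Open Scope ereal_scope.

Lemma measurable_dec (k : R) : measurable_fun [set: R] (dec k).
Proof. by apply: (measurableT_comp (@measurable_powR R _)); exact: measurable_japan. Qed.

Lemma dec_ge0 (k x : R) : (0 <= dec k x)%R. Proof. exact: powR_ge0. Qed.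

Lemma decN (k x : R) : dec k (- x) = dec k x.
Proof. by rewrite /dec /japan normrN. Qed.

Lemma integral_dec_le (k : R) : (0 < k <= 1)%R -> \int[mu]_x (dec k x)%:E <= (8 / k)%:E.
Proof.
move=> k01; have [k0 k1] := andP k01.
have h : \int[mu]_x ((k / 4)%:E * (dec k x)%:E) <= 2%:E.
  apply: le_trans (integral_gsing_le k01).
  apply: ge0_le_integral => //.
  - by move=> x _; rewrite -EFinM lee_fin mulr_ge0 ?dec_ge0// divr_ge0// ltW.
  - by apply: measurable_funeM; apply/measurable_EFinP; exact: measurable_dec.
  - exact: measurable_gsing.
  - by move=> x _; rewrite -EFinM; exact: gsing_decay.
rewrite ge0_integralZl// in h; last 3 first.
- by apply/measurable_EFinP; exact: measurable_dec.
- by move=> x _; rewrite lee_fin dec_ge0.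
- by rewrite lee_fin divr_ge0// ltW.
rewrite -(@lee_pmul2l _ (k / 4)%:E)//; last by rewrite lte_fin divr_gt0.
by apply: (le_trans h); rewrite -EFinM lee_fin le_eqVlt; apply/orP; left; apply/eqP; field; rewrite gt_eqF.
Qed.

Lemma measurable_decB (k : R) (b : R -> R) : measurable_fun [set: R] b ->
  measurable_fun [set: TR * TR] (fun z : TR * TR => (dec k (z.2 - b z.1))%:E).
Proof.
move=> mb; apply/measurable_EFinP; apply: (measurableT_comp (measurable_dec k)).
by apply: measurable_funB => //; exact: (measurableT_comp mb).
Qed.

(** In the inner integral the curve [b] is only a translation, so [dec] contributes the same
    constant at every [z.1]. *)
Lemma plane_decB_le (k : R) (b : R -> R) (phi : R -> \bar R) : (0 < k <= 1)%R ->
  measurable_fun [set: R] b -> measurable_fun [set: R] phi -> (forall x, 0 <= phi x) ->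
  \int[leb2]_z (phi z.1 * (dec k (z.2 - b z.1))%:E) <= (8 / k)%:E * \int[mu]_x phi x.
Proof.
move=> k01 mb mphi phi0.
have [k0 k1] := andP k01.
rewrite plane_tonelli; first last.
- by move=> z; rewrite mule_ge0// lee_fin dec_ge0.
- apply: emeasurable_funM; first exact: (measurableT_comp mphi).
  exact: measurable_decB.
rewrite -ge0_integralZl//; last by rewrite lee_fin divr_ge0// ltW.
apply: ge0_le_integral => //.
- move=> x _; apply: integral_ge0 => y _ /=; rewrite mule_ge0// lee_fin dec_ge0//.
- apply: (measurable_fun_fubini_tonelli_F (fun z : TR * TR => phi z.1 * (dec k (z.2 - b z.1))%:E)).
    apply: emeasurable_funM; first exact: (measurableT_comp mphi).
    exact: measurable_decB.
  by move=> z; rewrite mule_ge0// lee_fin dec_ge0.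
- exact: measurable_funeM.
- move=> x _ /=; rewrite ge0_integralZl//; last first.
  + by move=> y _; rewrite lee_fin dec_ge0.
  + apply/measurable_EFinP; apply: (measurableT_comp (measurable_dec k)).
    exact: measurable_funB.
  rewrite muleC lee_wpmul2r//.
  have mD : measurable_fun [set: R] (fun x => (dec k x)%:E).
    by apply/measurable_EFinP; exact: measurable_dec.
  rewrite (@ge0_integral_shift _ (fun x => (dec k x)%:E) (- b x)%R mD); last first.
    by move=> y; rewrite lee_fin dec_ge0.
  exact: integral_dec_le.
Qed.

(** |x - a| - c always coincides, up to the sign of x - a, with one of two affine functions of slope
    1 and -1, so two copies of the integral of [gsing] dominate. *)
Lemma integral_gsing_abs_le (k a c : R) : (0 < k <= 1)%R ->
  \int[mu]_x gsing k (`|x - a| - c)%R <= 4%:E.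
Proof.
move=> k01; have mg := measurable_gsing k01.
have g0 x := gsing_ge0 x k01.
have m1 : measurable_fun [set: R] (fun x : R => gsing k (x - (a + c))%R).
  by apply: (measurableT_comp mg); exact: measurable_funB.
have m2 : measurable_fun [set: R] (fun x : R => gsing k ((a - c) - x)%R).
  by apply: (measurableT_comp mg); exact: measurable_funB.
apply: (@le_trans _ _ (\int[mu]_x (gsing k (x - (a + c))%R + gsing k ((a - c) - x)%R))).
  apply: ge0_le_integralT => [x|||x].
  - exact: g0.
  - apply: (measurableT_comp mg); apply: measurable_funB => //.
    by apply: (measurableT_comp (@normr_measurable R setT)); exact: measurable_funB.
  - exact: (emeasurable_funD m1 m2).
  - have [h|h] := leP 0%R (x - a)%R.
      by rewrite (ger0_norm h) opprD addrA leeDl.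
    by rewrite (ltr0_norm h) opprB addrAC leeDr.
rewrite (ge0_integralD mu measurableT (fun x _ => g0 _) m1 (fun x _ => g0 _) m2).
rewrite [X in X + _](ge0_integral_shift (- (a + c))%R mg g0).
rewrite [X in _ + X](ge0_integral_sub (a - c)%R mg g0).
apply: (le_trans (leeD (integral_gsing_le k01) (integral_gsing_le k01))).
by rewrite -EFinD lee_fin; lra.
Qed.

(** One bound for all three regions: [gsing] controls the frequency, and [dec] the modulation about
    the curves [b] and [b']. The constant is 96 = 2 * 8 * 6, from two curves, 8 / k for [dec], and 2
    + 4 for the two singular terms. *)
Lemma sup_bound (k C0 a c : R) (b b' : R -> R) (Phi : TR * TR -> R) : (0 < k <= 1)%R ->
  (0 <= C0)%R ->
  measurable_fun [set: R] b -> measurable_fun [set: R] b' ->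
  measurable_fun [set: TR * TR] Phi -> (forall z, 0 <= Phi z)%R ->
  (forall z, (Phi z)%:E <= C0%:E * (gsing k z.1 + gsing k (`|z.1 - a| - c)%R) *
     (dec k (z.2 - b z.1) + dec k (z.2 - b' z.1))%:E) ->
  \int[leb2]_z (Phi z)%:E <= (C0 * (96 / k))%:E.
Proof.
move=> k01 C00 mb mb' mPhi Phi0 PhiL.
have [k0 k1] := andP k01.
have mg := measurable_gsing k01.
have g0 x := gsing_ge0 x k01.
pose phi x := C0%:E * (gsing k x + gsing k (`|x - a| - c)%R).
have phi0 x : 0 <= phi x by rewrite mule_ge0// adde_ge0.
have m2 : measurable_fun [set: R] (fun x : R => gsing k (`|x - a| - c)%R).
  apply: (measurableT_comp mg); apply: measurable_funB => //.
  by apply: (measurableT_comp (@normr_measurable R setT)); exact: measurable_funB.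
have mphi : measurable_fun [set: R] phi.
  by apply: measurable_funeM; exact: (emeasurable_funD mg m2).
have md (b0 : R -> R) : measurable_fun [set: R] b0 ->
    measurable_fun [set: TR * TR] (fun z : TR * TR => phi z.1 * (dec k (z.2 - b0 z.1))%:E).
  move=> mb0; apply: emeasurable_funM; first exact: (measurableT_comp mphi).
  exact: measurable_decB.
have pd0 (b0 : R -> R) (z : TR * TR) : 0 <= phi z.1 * (dec k (z.2 - b0 z.1))%:E.
  by rewrite mule_ge0// lee_fin dec_ge0.
have Iphi : \int[mu]_x phi x <= (C0 * 6)%:E.
  rewrite ge0_integralZl//; last 2 first.
  - exact: (emeasurable_funD mg m2).
  - by move=> x _; rewrite adde_ge0.
  rewrite EFinM lee_wpmul2l//.
  rewrite (ge0_integralD mu measurableT (fun x _ => g0 x) mg (fun x _ => g0 _) m2).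
  apply: (le_trans (leeD (integral_gsing_le k01) (integral_gsing_abs_le a c k01))).
  by rewrite -EFinD lee_fin; lra.
apply: (@le_trans _ _ (\int[leb2]_z (phi z.1 * (dec k (z.2 - b z.1))%:E +
   phi z.1 * (dec k (z.2 - b' z.1))%:E))).
  apply: ge0_le_integral => //.
  - by move=> z _; rewrite lee_fin.
  - exact/measurable_EFinP.
  - by apply: emeasurable_funD; exact: md.
  - move=> z _; rewrite -ge0_muleDr ?lee_fin ?dec_ge0// -EFinD; exact: PhiL.
rewrite ge0_integralD//; [|exact: md|exact: md].
have h (b0 : R -> R) : measurable_fun [set: R] b0 ->
    \int[leb2]_z (phi z.1 * (dec k (z.2 - b0 z.1))%:E) <= (8 / k * (C0 * 6))%:E.
  move=> mb0; apply: (le_trans (plane_decB_le k01 mb0 mphi phi0)).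
  by rewrite [leRHS]EFinM lee_wpmul2l// lee_fin divr_ge0// ltW.
apply: (le_trans (leeD (h b mb) (h b' mb'))); rewrite -EFinD lee_fin.
by rewrite le_eqVlt; apply/orP; left; apply/eqP; field; rewrite gt_eqF.
Qed.

End SupBounds.

(** * Trilinear forms and Cauchy-Schwarz *)

Section Trilinear.
Context {R : realType}.
Local Notation TR := (measurableTypeR R).
Local Notation P := (TR * TR)%type.
Local Notation leb4 := (@leb2 R \x @leb2 R)%E.
Local Open Scope ereal_scope.

Lemma measurable_plane_add : measurable_fun setT (fun z : P * P => (z.1 + z.2)%R : P).
Proof.
apply/measurable_fun_pair => /=; apply: measurable_funD.
- exact: (measurableT_comp measurable_fst measurable_fst).
- exact: (measurableT_comp measurable_fst measurable_snd).
- exact: (measurableT_comp measurable_snd measurable_fst).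
- exact: (measurableT_comp measurable_snd measurable_snd).
Qed.

Lemma measurable_plane_shear : measurable_fun setT (fun z : P * P => (z.1, z.2 - z.1)%R : P * P).
Proof.
apply/measurable_fun_pair => //=; apply/measurable_fun_pair => /=; apply: measurable_funB.
- exact: (measurableT_comp measurable_fst measurable_snd).
- exact: (measurableT_comp measurable_fst measurable_fst).
- exact: (measurableT_comp measurable_snd measurable_snd).
- exact: (measurableT_comp measurable_snd measurable_fst).
Qed.

Lemma amgm (l a b : R) : (0 < l -> 0 <= a -> 0 <= b -> a * b <= l * a ^+ 2 + l^-1 * b ^+ 2)%R.
Proof.
move=> l0 a0 b0; have li : (0 < l^-1)%R by rewrite invr_gt0.
have e : (l * l^-1 = 1)%R by rewrite divff// gt_eqF.
have : (0 <= l^-1 * (l * a - b) ^+ 2)%R by rewrite mulr_ge0 ?sqr_ge0// ltW.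
have -> : (l^-1 * (l * a - b) ^+ 2 =
  (l * l^-1) * (l * a ^+ 2) - 2 * (l * l^-1) * (a * b) + l^-1 * b ^+ 2)%R by ring.
have : (0 <= a * b)%R by rewrite mulr_ge0.
by rewrite e; lra.
Qed.

Lemma leb4_tonelli1 (f : P * P -> \bar R) : measurable_fun setT f -> (forall z, 0 <= f z) ->
  \int[leb4]_z f z = \int[leb2]_x \int[leb2]_y f (x, y).
Proof. by move=> mf f0; rewrite fubini_tonelli1. Qed.

Lemma leb4_tonelli2 (f : P * P -> \bar R) : measurable_fun setT f -> (forall z, 0 <= f z) ->
  \int[leb4]_z f z = \int[leb2]_y \int[leb2]_x f (x, y).
Proof. by move=> mf f0; rewrite fubini_tonelli2. Qed.

Definition sqint (f : P -> R) : \bar R := \int[leb2]_z (f z ^+ 2)%:E.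

Lemma measurable_sqr (d : measure_display) (T : measurableType d) (f : T -> R) :
  measurable_fun setT f -> measurable_fun setT (fun z => (f z ^+ 2)%:E).
Proof. by move=> mf; apply/measurable_EFinP; exact: measurable_funX. Qed.

Lemma sqint_ge0 (f : P -> R) : 0 <= sqint f.
Proof. by apply: integral_ge0 => z _; rewrite lee_fin sqr_ge0. Qed.

Lemma integral_FH (F H : P -> R) : measurable_fun setT F -> measurable_fun setT H ->
  \int[leb4]_z ((F z.1 ^+ 2)%:E * (H (z.1 + z.2)%R ^+ 2)%:E) = sqint F * sqint H.
Proof.
move=> mF mH; rewrite leb4_tonelli1; first last.
- by move=> z; rewrite mule_ge0// lee_fin sqr_ge0.
- apply: emeasurable_funM; apply: measurable_sqr.
    exact: (measurableT_comp mF).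
  exact: (measurableT_comp mH measurable_plane_add).
rewrite /sqint -ge0_integralZr//; first last.
- exact: sqint_ge0.
- by move=> x _; rewrite lee_fin sqr_ge0.
- exact: measurable_sqr.
apply: eq_integral => x _ /=; rewrite ge0_integralZl//; first last.
- by rewrite lee_fin sqr_ge0.
- by move=> y _; rewrite lee_fin sqr_ge0.
- apply: measurable_sqr; apply: (measurableT_comp mH).
  exact: (measurableT_comp measurable_plane_add (pair1_measurable x)).
congr (_ * _); under eq_integral do rewrite addrC.
rewrite (@plane_shift _ (fun z => (H z ^+ 2)%:E) x)//; first exact: measurable_sqr.
by move=> z; rewrite lee_fin sqr_ge0.
Qed.

Lemma integral_FG (F G : P -> R) : measurable_fun setT F -> measurable_fun setT G ->
  \int[leb4]_z ((F z.1 ^+ 2)%:E * (G z.2 ^+ 2)%:E) = sqint F * sqint G.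
Proof.
move=> mF mG; rewrite leb4_tonelli1; first last.
- by move=> z; rewrite mule_ge0// lee_fin sqr_ge0.
- by apply: emeasurable_funM; apply: measurable_sqr; exact: measurableT_comp.
rewrite /sqint -ge0_integralZr//; first last.
- exact: sqint_ge0.
- by move=> x _; rewrite lee_fin sqr_ge0.
- exact: measurable_sqr.
apply: eq_integral => x _ /=; rewrite ge0_integralZl//; first last.
- by rewrite lee_fin sqr_ge0.
- by move=> y _; rewrite lee_fin sqr_ge0.
- exact: measurable_sqr.
Qed.

Lemma integral_weighted_le (G : P -> R) (C : R) (K : P * P -> R) :
  measurable_fun setT G -> (0 <= C)%R ->
  measurable_fun setT K ->
  (forall y, \int[leb2]_x (K (x, y) ^+ 2)%:E <= C%:E) ->
  \int[leb4]_z ((G z.2 ^+ 2)%:E * (K z ^+ 2)%:E) <= C%:E * sqint G.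
Proof.
move=> mG C0 mK hK; rewrite leb4_tonelli2; first last.
- by move=> z; rewrite mule_ge0// lee_fin sqr_ge0.
- by apply: emeasurable_funM; apply: measurable_sqr => //; exact: measurableT_comp.
rewrite /sqint -ge0_integralZl//; first last.
- by move=> z _; rewrite lee_fin sqr_ge0.
- exact: measurable_sqr.
have h0 (z : P * P) : 0 <= (G z.2 ^+ 2)%:E * (K z ^+ 2)%:E by rewrite mule_ge0// lee_fin sqr_ge0.
have mGK : measurable_fun setT (fun z : P * P => (G z.2 ^+ 2)%:E * (K z ^+ 2)%:E).
  by apply: emeasurable_funM; apply: measurable_sqr => //; exact: measurableT_comp.
apply: ge0_le_integralT => [y|||y].
- by apply: integral_ge0 => x _; exact: (h0 (x, y)).
- exact: (measurable_fun_fubini_tonelli_G (fun z : P * P => (G z.2 ^+ 2)%:E * (K z ^+ 2)%:E)).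
- by apply: measurable_funeM; exact: measurable_sqr.
- rewrite /= ge0_integralZl//; first last.
  + by rewrite lee_fin sqr_ge0.
  + by move=> x _; rewrite lee_fin sqr_ge0.
  + apply: measurable_sqr; exact: (measurableT_comp mK (pair2_measurable y)).
  by rewrite muleC lee_wpmul2r// lee_fin sqr_ge0.
Qed.

(** The shear (x, y) -> (x, y - x) preserves the measure and turns z1 + z2 into a free variable, for
    fixed values of which the hypothesis on [K] is stated. *)
Lemma integral_shear_le (H : P -> R) (C : R) (K : P * P -> R) :
  measurable_fun setT H -> (0 <= C)%R ->
  measurable_fun setT K ->
  (forall z, \int[leb2]_x (K (x, z - x)%R ^+ 2)%:E <= C%:E) ->
  \int[leb4]_z ((H (z.1 + z.2)%R ^+ 2)%:E * (K z ^+ 2)%:E) <= C%:E * sqint H.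
Proof.
move=> mH C0 mK hK.
pose f (z : P * P) := (H (z.1 + z.2)%R ^+ 2)%:E * (K z ^+ 2)%:E.
have f0 z : 0 <= f z by rewrite mule_ge0// lee_fin sqr_ge0.
have mf : measurable_fun setT f.
  apply: emeasurable_funM; apply: measurable_sqr => //.
  exact: (measurableT_comp mH measurable_plane_add).
pose g (z : P * P) := f (z.1, z.2 - z.1)%R.
have g0 z : 0 <= g z by exact: f0.
have mg : measurable_fun setT g by exact: (measurableT_comp mf measurable_plane_shear).
rewrite -[leLHS]/(\int[leb4]_z f z).
have -> : \int[leb4]_z f z = \int[leb4]_z g z.
  rewrite (leb4_tonelli1 mf f0) (leb4_tonelli1 mg g0); apply: eq_integral => x _.
  rewrite /g /=.
  rewrite (@plane_shift _ (fun y => f (x, y)) (- x)%R)//.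
  exact: (measurableT_comp mf (pair1_measurable x)).
rewrite (leb4_tonelli2 mg g0) /sqint -ge0_integralZl//; first last.
- by move=> z _; rewrite lee_fin sqr_ge0.
- exact: measurable_sqr.
apply: ge0_le_integralT => [y|||y].
- by apply: integral_ge0 => x _; exact: (g0 (x, y)).
- exact: (measurable_fun_fubini_tonelli_G g).
- by apply: measurable_funeM; exact: measurable_sqr.
- have -> : \int[leb2]_x g (x, y) = \int[leb2]_x ((H y ^+ 2)%:E * (K (x, y - x)%R ^+ 2)%:E).
    by apply: eq_integral => x _; rewrite /g /f /= addrC subrK.
  rewrite ge0_integralZl//; first last.
  + by rewrite lee_fin sqr_ge0.
  + by move=> x _; rewrite lee_fin sqr_ge0.
  + apply: measurable_sqr; apply: (measurableT_comp mK).
    exact: (measurableT_comp measurable_plane_shear (pair2_measurable y)).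
  by rewrite muleC lee_wpmul2r// lee_fin sqr_ge0.
Qed.

End Trilinear.

Section TrilinearEstimates.
Context {R : realType}.
Local Notation TR := (measurableTypeR R).
Local Notation P := (TR * TR)%type.
Local Notation leb4 := (@leb2 R \x @leb2 R)%E.
Local Open Scope ereal_scope.

(* Each trilinear estimate is Cauchy-Schwarz in the AM-GM form with a free
   parameter [l], which avoids square roots of extended reals. *)
Lemma integral_amgm d (T : measurableType d) (m : {measure set T -> \bar R})
    (l : R) (a b : T -> R) : (0 < l)%R ->
  measurable_fun setT a -> measurable_fun setT b ->
  (forall x, 0 <= a x)%R -> (forall x, 0 <= b x)%R ->
  \int[m]_x (a x * b x)%:E <=
  l%:E * \int[m]_x (a x ^+ 2)%:E + l^-1%:E * \int[m]_x (b x ^+ 2)%:E.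
Proof.
move=> l0 ma mb a0 b0.
have [ma2 mb2] := (measurable_sqr ma, measurable_sqr mb).
have li : (0 <= l^-1)%R by rewrite invr_ge0 ltW.
rewrite -!ge0_integralZl//; last 3 first.
- by move=> x _; rewrite lee_fin sqr_ge0.
- by move=> x _; rewrite lee_fin sqr_ge0.
- by rewrite lee_fin ltW.
have p1 x : 0 <= l%:E * (a x ^+ 2)%:E by rewrite -EFinM lee_fin mulr_ge0 ?sqr_ge0// ltW.
have p2 x : 0 <= l^-1%:E * (b x ^+ 2)%:E by rewrite -EFinM lee_fin mulr_ge0 ?sqr_ge0.
rewrite -ge0_integralD//; [|exact: measurable_funeM|exact: measurable_funeM].
apply: ge0_le_integralT => [x|||x].
- by rewrite lee_fin mulr_ge0.
- by apply/measurable_EFinP; exact: measurable_funM.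
- by apply: emeasurable_funD; exact: measurable_funeM.
- by rewrite -!EFinM -EFinD lee_fin; exact: amgm.
Qed.

Variables (F G H : P -> R) (C : R).
Hypotheses (mF : measurable_fun setT F) (mG : measurable_fun setT G) (mH : measurable_fun setT H).
Hypotheses (F0 : forall z, (0 <= F z)%R) (G0 : forall z, (0 <= G z)%R) (H0 : forall z, (0 <= H z)%R).
Hypothesis C0 : (0 <= C)%R.
Variable K : P * P -> R.
Hypotheses (mK : measurable_fun setT K) (K0 : forall z, (0 <= K z)%R).

Let mF1 : measurable_fun setT (fun z : P * P => F z.1).
Proof. exact: measurableT_comp. Qed.
Let mG2 : measurable_fun setT (fun z : P * P => G z.2).
Proof. exact: measurableT_comp. Qed.
Let mHD : measurable_fun setT (fun z : P * P => H (z.1 + z.2)%R).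
Proof. exact: (measurableT_comp mH measurable_plane_add). Qed.

(** [F] is grouped with [H] and [G] with [K], so that the kernel is integrated in its first
    argument. *)
Lemma trilinear1 (l : R) : (0 < l)%R ->
  (forall y, \int[leb2]_x (K (x, y) ^+ 2)%:E <= C%:E) ->
  \int[leb4]_z (F z.1 * G z.2 * H (z.1 + z.2)%R * K z)%:E <=
  l%:E * (sqint F * sqint H) + l^-1%:E * (C%:E * sqint G).
Proof.
move=> l0 hK.
have E z : (F z.1 * G z.2 * H (z.1 + z.2) * K z = (F z.1 * H (z.1 + z.2)) * (G z.2 * K z))%R by ring.
under eq_integral do rewrite E.
apply: (le_trans (@integral_amgm _ _ leb4 l (fun z => F z.1 * H (z.1 + z.2))%R
  (fun z => G z.2 * K z)%R l0 (measurable_funM mF1 mHD) (measurable_funM mG2 mK) _ _)).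
- by move=> z; rewrite mulr_ge0.
- by move=> z; rewrite mulr_ge0.
apply: leeD; apply: lee_wpmul2l; rewrite ?lee_fin ?invr_ge0 ?(ltW l0)//.
- by rewrite -integral_FH//; under eq_integral do rewrite exprMn EFinM.
- by under eq_integral do rewrite exprMn EFinM; exact: integral_weighted_le.
Qed.

(** [F] is grouped with [G] and [H] with [K], so that the kernel is integrated over pairs with a
    fixed sum. *)
Lemma trilinear3 (l : R) : (0 < l)%R ->
  (forall z, \int[leb2]_x (K (x, z - x)%R ^+ 2)%:E <= C%:E) ->
  \int[leb4]_z (F z.1 * G z.2 * H (z.1 + z.2)%R * K z)%:E <=
  l%:E * (sqint F * sqint G) + l^-1%:E * (C%:E * sqint H).
Proof.
move=> l0 hK.
under eq_integral do rewrite -mulrA.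
apply: (le_trans (@integral_amgm _ _ leb4 l (fun z => F z.1 * G z.2)%R
  (fun z => H (z.1 + z.2) * K z)%R l0 (measurable_funM mF1 mG2) (measurable_funM mHD mK) _ _)).
- by move=> z; rewrite mulr_ge0.
- by move=> z; rewrite mulr_ge0.
apply: leeD; apply: lee_wpmul2l; rewrite ?lee_fin ?invr_ge0 ?(ltW l0)//.
- by rewrite -integral_FG//; under eq_integral do rewrite exprMn EFinM.
- by under eq_integral do rewrite exprMn EFinM; exact: integral_shear_le.
Qed.

End TrilinearEstimates.

Section TrilinearSwap.
Context {R : realType}.
Local Notation TR := (measurableTypeR R).
Local Notation P := (TR * TR)%type.
Local Notation leb4 := (@leb2 R \x @leb2 R)%E.
Local Open Scope ereal_scope.
Variables (F G H : P -> R) (C : R).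
Hypotheses (mF : measurable_fun setT F) (mG : measurable_fun setT G) (mH : measurable_fun setT H).
Hypotheses (F0 : forall z, (0 <= F z)%R) (G0 : forall z, (0 <= G z)%R) (H0 : forall z, (0 <= H z)%R).
Hypothesis C0 : (0 <= C)%R.
Variable K : P * P -> R.
Hypotheses (mK : measurable_fun setT K) (K0 : forall z, (0 <= K z)%R).

(** Obtained from [trilinear1] by exchanging the two points. *)
Lemma trilinear2 (l : R) : (0 < l)%R ->
  (forall x, \int[leb2]_y (K (x, y) ^+ 2)%:E <= C%:E) ->
  \int[leb4]_z (F z.1 * G z.2 * H (z.1 + z.2)%R * K z)%:E <=
  l%:E * (sqint G * sqint H) + l^-1%:E * (C%:E * sqint F).
Proof.
move=> l0 hK.
have mS : measurable_fun setT (fun z : P * P => (z.2, z.1)).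
  exact: measurable_fun_pair.
have mK' : measurable_fun setT (fun z : P * P => K (z.2, z.1)).
  exact: (measurableT_comp mK mS).
apply: le_trans (trilinear1 mG mF mH G0 F0 H0 C0 mK' (fun z => K0 _) l0 hK).
have m0 : measurable_fun setT (fun z : P * P => (F z.1 * G z.2 * H (z.1 + z.2)%R * K z)%:E).
  apply/measurable_EFinP; apply: measurable_funM => //; apply: measurable_funM.
    by apply: measurable_funM; exact: measurableT_comp.
  exact: (measurableT_comp mH measurable_plane_add).
have m0' : measurable_fun setT (fun z : P * P => (G z.1 * F z.2 * H (z.1 + z.2)%R * K (z.2, z.1))%:E).
  apply: (eq_measurable_fun (fun z : P * P => (F z.2 * G z.1 * H (z.2 + z.1)%R * K (z.2, z.1))%:E)).
    by move=> z _; rewrite [(F _ * _)%R]mulrC [(z.2 + _)%R]addrC.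
  exact: (measurableT_comp m0 mS).
rewrite (leb4_tonelli1 m0); last by move=> z; rewrite lee_fin !mulr_ge0.
rewrite (leb4_tonelli2 m0'); last by move=> z; rewrite lee_fin !mulr_ge0.
rewrite le_eqVlt; apply/orP; left; apply/eqP.
apply: eq_integral => x _; apply: eq_integral => y _ /=.
by rewrite [(F x * G y)%R]mulrC [(x + y)%R]addrC.
Qed.

End TrilinearSwap.

(** * Kernel bounds on the three regions *)

Section BilinearEstimate.
Context {R : realType}.
Local Notation TR := (measurableTypeR R).
Local Notation P := (TR * TR)%type.
Local Notation leb4 := (@leb2 R \x @leb2 R)%E.

(** In terms of F = w1 f and G = w2 g, the product f g is F G times this kernel. *)
Definition kern (alpha s eps : R) (z : P * P) : R :=
  (weight alpha (- (1 / 2)) (1 / 2 - eps) z.1 * weight alpha s (1 / 2) z.2)^-1.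

Lemma kern_ge0 alpha s eps z : 0 <= kern alpha s eps z.
Proof. by rewrite invr_ge0 mulr_ge0// ltW// weight_gt0. Qed.

Lemma measurable_weightP d (T : measurableType d) (alpha s b : R) (f : T -> P) :
  measurable_fun setT f -> measurable_fun setT (fun t => weight alpha s b (f t)).
Proof.
move=> mf.
have m1 : measurable_fun setT (fun t => (f t).1) by exact: (measurableT_comp measurable_fst).
have m2 : measurable_fun setT (fun t => (f t).2) by exact: (measurableT_comp measurable_snd).
apply: (eq_measurable_fun (fun t => weight alpha s b ((f t).1, (f t).2))).
  by move=> t _; case: (f t).
exact: measurable_weight.
Qed.

Lemma measurable_kern alpha s eps : measurable_fun setT (kern alpha s eps).
Proof.
rewrite (_ : kern alpha s eps = fun z =>
  (weight alpha (- (1 / 2)) (1 / 2 - eps) z.1 * weight alpha s (1 / 2) z.2) `^ (- 1)); last first.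
  by apply/funext => z; rewrite powR_inv1// mulr_ge0// ltW// weight_gt0.
apply: (measurableT_comp (@measurable_powR R _)).
by apply: measurable_funM; apply: measurable_weightP.
Qed.

Lemma kern_sqr_le alpha s sg eps : 0 < alpha -> alpha <= 3 ->
  - 2 <= sg -> - (2 * s) <= sg -> 0 <= eps -> eps <= 1 / 2 ->
  exists2 C : R, 0 < C &
  forall z, kern alpha s eps z ^+ 2 <= C * bkernel alpha sg eps z.1 z.2.
Proof.
move=> a0 a3 sg2 ssg e0 e1; exists (256 * (256 * 4)).
  exact: (mulr_gt0 (ltr0Sn _ _) (mulr_gt0 (ltr0Sn _ _) (ltr0Sn _ _))).
move=> z; rewrite /kern exprVn exprMn invfM.
apply: (le_trans (ler_pM _ _ (weight1_sqrV_le z.1 a0 a3 e0 e1) (weight2_sqrV_le z.2 a0 a3 sg2 ssg))).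
- by rewrite invr_ge0 sqr_ge0.
- by rewrite invr_ge0 sqr_ge0.
move: 256 => c1.
by rewrite /bkernel le_eqVlt; apply/orP; left; apply/eqP; ring.
Qed.

Definition region1 (alpha : R) (z : P * P) :=
  near_diag alpha z.1 z.2 && (modulus alpha z.1 <= modulus alpha z.2).
Definition region2 (alpha : R) (z : P * P) :=
  near_diag alpha z.1 z.2 && ~~ (modulus alpha z.1 <= modulus alpha z.2).
Definition region3 (alpha : R) (z : P * P) := ~~ near_diag alpha z.1 z.2.

Definition kern_on (alpha s eps : R) (b : P * P -> bool) (z : P * P) : R :=
  if b z then kern alpha s eps z else 0.

Lemma kern_split alpha s eps z : kern alpha s eps z =
  kern_on alpha s eps (region1 alpha) z + kern_on alpha s eps (region2 alpha) z +
  kern_on alpha s eps (region3 alpha) z.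
Proof.
rewrite /kern_on /region1 /region2 /region3; case: near_diag => /=; last by rewrite !add0r.
by case: (_ <= _) => /=; rewrite ?add0r !addr0.
Qed.

Lemma kern_on_ge0 alpha s eps b z : 0 <= kern_on alpha s eps b z.
Proof. by rewrite /kern_on; case: ifP => // _; exact: kern_ge0. Qed.

Lemma measurable_near_diag alpha : measurable_fun setT (fun z : P * P => near_diag alpha z.1 z.2).
Proof.
have mp1 : measurable_fun setT (fun z : P * P => japan z.1.1).
  exact: (measurableT_comp (@measurable_japan R) (measurableT_comp measurable_fst measurable_fst)).
have mp2 : measurable_fun setT (fun z : P * P => japan z.2.1).
  exact: (measurableT_comp (@measurable_japan R) (measurableT_comp measurable_fst measurable_snd)).
apply: measurable_fun_ler.
  apply: (measurableT_comp (@normr_measurable R setT)); exact: measurable_funB.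
apply: measurable_funM => //; apply: (measurableT_comp (@measurable_powR R _)).
exact: measurable_maxr.
Qed.

Lemma measurable_modulusP d (T : measurableType d) (alpha : R) (f : T -> P) :
  measurable_fun setT f -> measurable_fun setT (fun t => modulus alpha (f t)).
Proof.
move=> mf.
have m1 : measurable_fun setT (fun t => (f t).1) by exact: (measurableT_comp measurable_fst).
have m2 : measurable_fun setT (fun t => (f t).2) by exact: (measurableT_comp measurable_snd).
exact: (measurable_modulus alpha m1 m2).
Qed.

Lemma measurable_regions alpha : [/\ measurable_fun setT (region1 alpha),
  measurable_fun setT (region2 alpha) & measurable_fun setT (region3 alpha)].
Proof.
have mm : measurable_fun setT (fun z : P * P => modulus alpha z.1 <= modulus alpha z.2).
  by apply: measurable_fun_ler; apply: measurable_modulusP.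
have mn := measurable_near_diag alpha.
split; [exact: measurable_and|apply: measurable_and => //|]; exact: measurable_neg.
Qed.

Lemma measurable_kern_on alpha s eps b : measurable_fun setT b ->
  measurable_fun setT (kern_on alpha s eps b).
Proof. by move=> mb; apply: measurable_fun_ifT => //; exact: measurable_kern. Qed.

Lemma combine_bounds (Phi C1 AB dmin dd k : R) (G : \bar R) :
  0 < C1 -> 0 <= AB -> 0 <= dmin -> Phi <= C1 * AB * dmin -> dmin <= dd -> (0 <= G)%E ->
  (AB%:E <= (18 / k)%:E * G)%E ->
  (Phi%:E <= (C1 * (18 / k))%:E * G * dd%:E)%E.
Proof.
move=> C0 AB0 d0 h1 h2 G0 h3.
apply: (@le_trans _ _ ((C1 * AB) * dmin)%:E); first by rewrite lee_fin.
rewrite EFinM; apply: lee_pmul; rewrite ?lee_fin ?mulr_ge0 ?(ltW C0)//.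
by rewrite EFinM [X in (_ <= X * _)%E]EFinM -muleA lee_pmul2l.
Qed.

Section constants.
Variables (alpha s kap eps sg : R).
Hypotheses (alpha0 : 0 < alpha) (alpha3 : alpha <= 3).
Hypotheses (kap0 : 0 < kap) (kap4 : kap <= 1 / 4).
Hypothesis sgE : sg = (alpha - 1) / 2 - 4 * kap.
Hypothesis sg_sign : alpha <= 1 \/ 0 <= sg.
Hypotheses (eps0 : 0 <= eps) (eps4 : eps <= kap / 4).
Variables (Cw Cn : R).
Hypotheses (Cw0 : 0 < Cw) (CnE : Cn = 294).
Hypothesis kernL : forall z, kern alpha s eps z ^+ 2 <= Cw * bkernel alpha sg eps z.1 z.2.

(** Since [eps <= kap / 4], the decay kap - 2 eps of the smaller modulus is at least kap / 2; this
    half is thus admissible both in [gsing_pair] and in [dec]. *)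
Let k := kap / 2.
Let Ck : R := Cw * Cn * (18 / k).
Let Cn0 : 0 < Cn. Proof. by rewrite CnE ltr0Sn. Qed.
Definition kern_const : R := Ck * (96 / k).

Let k01 : 0 < k <= 1. Proof. by move: kap0 kap4; rewrite /k => *; apply/andP; split; lra. Qed.
Let k_le : k <= kap. Proof. by move: kap0; rewrite /k; lra. Qed.
Let kap1 : kap <= 1. Proof. by move: kap4; lra. Qed.
Let Ck0 : 0 <= Ck.
Proof. by have /andP[h _] := k01; rewrite /Ck ltW// !mulr_gt0// invr_gt0. Qed.

Lemma kern_const_gt0 : 0 < kern_const.
Proof. by have /andP[h _] := k01; rewrite /kern_const /Ck !mulr_gt0// invr_gt0. Qed.

Let min_dec1 (z1 z2 : P) : modulus alpha z1 <= modulus alpha z2 ->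
  Num.min (modulus alpha z1) (modulus alpha z2) `^ (- 1 - (kap - 2 * eps)) <= dec k (z1.2 - z1.1 ^+ 3).
Proof.
move=> h; rewrite (min_l h); apply: modulus_dec; first exact: ltW.
  by have /andP[/ltW] := k01.
by move: eps4; rewrite /k; lra.
Qed.

Let min_dec2 (z1 z2 : P) : modulus alpha z2 <= modulus alpha z1 ->
  Num.min (modulus alpha z1) (modulus alpha z2) `^ (- 1 - (kap - 2 * eps)) <= dec k (z2.2 - z2.1 ^+ 3).
Proof. by move=> h; rewrite minC; exact: min_dec1. Qed.

Let cube_measurable : measurable_fun [set: R] (fun x : R => x ^+ 3).
Proof. exact: measurable_funX. Qed.

Let dec_dup (C0 A : \bar R) (x : R) : (0 <= C0 -> 0 <= A -> C0 * A * (dec k x)%:E <= C0 * A * (dec k x + dec k x)%:E)%E.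
Proof.
move=> h1 h2; apply: lee_wpmul2l; first exact: mule_ge0.
by rewrite lee_fin lerDl dec_ge0.
Qed.

(** The inequality defining [near_diag] supplies the hypothesis |y| <= X of [gsing_pair], with X
    equal to the threshold. *)
Let near_case (z1 z2 : P) (x y dd : R) : near_diag alpha z1 z2 ->
  `|y| <= `|japan z1.1 - japan z2.1| -> 1 + `|x| <= jmax z1 z2 ->
  Num.min (modulus alpha z1) (modulus alpha z2) `^ (- 1 - (kap - 2 * eps)) <= dd ->
  ((kern alpha s eps (z1, z2) ^+ 2)%:E <= Ck%:E * (gsing k x + gsing k y) * dd%:E)%E.
Proof.
move=> hn hy hx hd.
have kk0 : 0 < k by case/andP: k01.
apply: (combine_bounds _ _ _ _ hd _ (gsing_pair (X := 6 * jmax z1 z2 `^ ((alpha - 1) / 2)) kk0 k_le kap1 _ _ hx)).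
- exact: mulr_gt0.
- by rewrite mulr_ge0 ?powR_ge0.
- exact: powR_ge0.
- rewrite -mulrA -mulrA; apply: (le_trans (kernL _)); rewrite ler_pM2l// mulrA CnE.
  exact: bkernel_near alpha0 alpha3 kap0 kap4 sgE sg_sign eps0 eps4 hn.
- by rewrite adde_ge0 ?gsing_ge0.
- exact: le_trans hn.
- by rewrite mulr_gt0// powR_gt0// (lt_le_trans _ (jmax_ge1 _ _)).
Qed.

Let japanB (x y : R) : `| `|x| - `|y| | <= `|japan x - japan y|.
Proof. by rewrite /japan opprD addrACA subrr add0r. Qed.

Let kern_on_sqr_ge0 b z : 0 <= kern_on alpha s eps b z ^+ 2.
Proof. exact: sqr_ge0. Qed.

Lemma sup_region1 (y : P) :
  (\int[leb2]_x (kern_on alpha s eps (region1 alpha) (x, y) ^+ 2)%:E <= kern_const%:E)%E.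
Proof.
have [mr _ _] := measurable_regions alpha.
(* For fixed [y] the singularity lies at |x.1| = |y.1|. Both curves are the cubic, since in this
   region [x] has the smaller modulus. *)
apply: (@sup_bound _ k Ck 0 `|y.1| (fun x => x ^+ 3) (fun x => x ^+ 3)) => //.
  by apply: measurable_funX; exact: (measurableT_comp (measurable_kern_on _ _ _ mr) (pair2_measurable y)).
move=> x; rewrite subr0 /kern_on; case: ifPn => [/andP[/= hn hm]|_]; last first.
  rewrite expr0n mule_ge0 ?mule_ge0 ?adde_ge0 ?gsing_ge0 ?lee_fin ?addr_ge0 ?dec_ge0//.
apply: le_trans (dec_dup _ _ _); rewrite ?adde_ge0 ?gsing_ge0 ?lee_fin//.
apply: (near_case hn (japanB _ _) _ (min_dec1 hm)).
by rewrite /jmax le_max lexx.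
Qed.

Lemma sup_region2 (x : P) :
  (\int[leb2]_y (kern_on alpha s eps (region2 alpha) (x, y) ^+ 2)%:E <= kern_const%:E)%E.
Proof.
have [_ mr _] := measurable_regions alpha.
apply: (@sup_bound _ k Ck 0 `|x.1| (fun x => x ^+ 3) (fun x => x ^+ 3)) => //.
  by apply: measurable_funX; exact: (measurableT_comp (measurable_kern_on _ _ _ mr) (pair1_measurable x)).
move=> y; rewrite subr0 /kern_on; case: ifPn => [/andP[/= hn hm]|_]; last first.
  rewrite expr0n mule_ge0 ?mule_ge0 ?adde_ge0 ?gsing_ge0 ?lee_fin ?addr_ge0 ?dec_ge0//.
apply: le_trans (dec_dup _ _ _); rewrite ?adde_ge0 ?gsing_ge0 ?lee_fin//.
have hm' : modulus alpha y <= modulus alpha x by rewrite ltW// ltNge.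
apply: (near_case hn _ _ (min_dec2 hm')).
  by rewrite [leRHS]distrC; exact: japanB.
by rewrite /jmax le_max lexx orbT.
Qed.

Lemma sup_region3 (z : P) :
  (\int[leb2]_x (kern_on alpha s eps (region3 alpha) (x, z - x) ^+ 2)%:E <= kern_const%:E)%E.
Proof.
have [_ _ mr] := measurable_regions alpha.
have kk0 : 0 < k by case/andP: k01.
(* Either of the points [x] and [z - x] may have the smaller modulus, so the second curve is the one
   along which [z - x] lies on the cubic. *)
apply: (@sup_bound _ k Ck (z.1 / 2) (critical z.1 z.2) (fun x => x ^+ 3)
  (fun x => z.2 - (z.1 - x) ^+ 3)) => //.
- by apply: measurable_funB => //; apply: measurable_funX; exact: measurable_funB.
- apply: measurable_funX; apply: (measurableT_comp (measurable_kern_on _ _ _ mr)).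
  exact: (measurableT_comp measurable_plane_shear (pair2_measurable z)).
move=> x; rewrite /kern_on; case: ifPn => [hn|_]; last first.
  rewrite expr0n mule_ge0 ?mule_ge0 ?adde_ge0 ?gsing_ge0 ?lee_fin ?addr_ge0 ?dec_ge0//.
have [X] := bkernel_off alpha0 alpha3 kap0 kap4 sgE sg_sign eps0 eps4 hn.
rewrite /= !(addrC _ (_ - _)) !subrK => -[X0 yX hX].
apply: (combine_bounds (dmin := Num.min (modulus alpha x) (modulus alpha (z - x)) `^ (- 1 - (kap - 2 * eps)))
  _ _ _ _ _ _ (gsing_pair (X := X) (M := jmax x (z - x)) kk0 k_le kap1 yX X0 _)).
- exact: mulr_gt0.
- by rewrite mulr_ge0 ?powR_ge0.
- exact: powR_ge0.
- by rewrite -mulrA -mulrA; apply: (le_trans (kernL _)); rewrite ler_pM2l// mulrA CnE.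
- have [h|h] := leP (modulus alpha x) (modulus alpha (z - x)).
    apply: (@le_trans _ _ (dec k (x.2 - x.1 ^+ 3))); last by rewrite lerDl dec_ge0.
    by have := min_dec1 h; rewrite min_l.
  apply: (@le_trans _ _ (dec k ((z - x).2 - (z - x).1 ^+ 3))).
    by have := min_dec2 (ltW h); rewrite min_r// ltW.
  rewrite -[dec k (_ - _)]decN (_ : - _ = x.2 - (z.2 - (z.1 - x.1) ^+ 3)); last by rewrite /=; ring.
  by rewrite lerDr dec_ge0.
- by rewrite adde_ge0 ?gsing_ge0.
- by rewrite /jmax le_max lexx.
Qed.

End constants.
End BilinearEstimate.

(** * The bilinear estimate *)

Section Bilinear.
Context {R : realType}.
Local Notation TR := (measurableTypeR R).
Local Notation P := (TR * TR)%type.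
Local Notation leb4 := (@leb2 R \x @leb2 R)%E.
Implicit Types f g h : P -> R.

Lemma sqint_eq0 (w : P -> R) f : measurable_fun setT w -> measurable_fun setT f ->
  (forall z, 0 < w z) -> sqint (fun z => w z * f z) = 0%E ->
  {ae @leb2 R, forall z, f z = 0}.
Proof.
move=> mw mf w0 h0.
have mw2 := measurable_sqr (measurable_funM mw mf).
have /(proj1 (ae_eq_integral_abs _ measurableT mw2)) : (\int[leb2]_z `|((w z * f z) ^+ 2)%:E| = 0)%E.
  by rewrite -h0; apply: eq_integral => z _; rewrite gee0_abs// lee_fin sqr_ge0.
apply: filterS => z /(_ I)/= [] /eqP.
by rewrite sqrf_eq0 mulf_eq0 gt_eqF//= => /eqP.
Qed.

Lemma measurable_plane_sub2 (z : P) : measurable_fun setT (fun x : P => z - x : P).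
Proof. by apply/measurable_fun_pair => /=; apply: measurable_funB => //. Qed.

(** Degenerate case of the main estimate, in which the AM-GM parameters would be inverses of a
    vanishing norm. *)
Lemma bilinear_null f g h (w : P -> R) : measurable_fun setT w ->
  (forall z, 0 < w z) -> measurable_fun setT f -> measurable_fun setT g ->
  (forall z, 0 <= f z) -> (forall z, 0 <= g z) ->
  (forall z, (h z)%:E = \int[leb2]_x (f x * g (z - x))%:E)%E ->
  sqint (fun z => w z * f z) = 0%E -> sqint h = 0%E.
Proof.
move=> mw w0 mf mg f0 g0 hE /(sqint_eq0 mw mf w0) fae.
apply: integral0_eq => z _; suff -> : h z = 0 by rewrite expr0n.
apply/EFin_inj; rewrite hE.
transitivity (\int[@leb2 R]_x (cst 0%E x))%E; last exact: integral0.
apply: ae_eq_integral => //.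
  apply/measurable_EFinP; apply: measurable_funM => //.
  exact: (measurableT_comp mg (measurable_plane_sub2 z)).
by apply: filterS fae => x -> _; rewrite mul0r.
Qed.

(** Each of the three pieces returns n / 8, so 5/8 of [n] is left against 24 c a b. *)
Lemma absorb_le (n a b c : R) : 0 < a -> 0 < b -> 0 < c ->
  n <= (8 * a)^-1 * (a * n) + 8 * a * (c * b) +
    ((8 * b)^-1 * (b * n) + 8 * b * (c * a)) +
    (8 * c * (a * b) + (8 * c)^-1 * (c * n)) ->
  n <= 40 * c * (a * b).
Proof.
move=> a0 b0 c0.
have e (x : R) : 0 < x -> (8 * x)^-1 * (x * n) = n / 8.
  by move=> x0; field; rewrite gt_eqF.
rewrite !e// => h.
have : 0 <= c * (a * b) by rewrite !mulr_ge0// ltW.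
have -> : 40 * c * (a * b) = 40 * (c * (a * b)) by ring.
have : n <= n / 8 + n / 8 + n / 8 + 24 * (c * (a * b)).
  by apply: le_trans h _; rewrite le_eqVlt; apply/orP; left; apply/eqP; ring.
move: (c * (a * b)) => p; lra.
Qed.

(** Tonelli and a translation. The test function [k] is extended-real valued because one of those
    used later is itself an integral. *)
Lemma convolution_pairing f g h (k : P -> \bar R) :
  measurable_fun setT f -> measurable_fun setT g -> measurable_fun setT k ->
  (forall z, 0 <= f z) -> (forall z, 0 <= g z) -> (forall z, 0 <= k z)%E ->
  (forall z, (h z)%:E = \int[leb2]_x (f x * g (z - x))%:E)%E ->
  (\int[leb2]_z ((h z)%:E * k z) = \int[leb4]_z ((f z.1 * g z.2)%:E * k (z.1 + z.2)%R))%E.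
Proof.
move=> mf mg mk f0 g0 k0 hE.
have fg0 x y : (0 <= (f x * g y)%:E)%E by rewrite lee_fin mulr_ge0.
have m1 : measurable_fun setT (fun z : P * P => (f z.2 * g (z.1 - z.2)%R)%:E * k z.1)%E.
  apply: emeasurable_funM; last exact: (measurableT_comp mk).
  apply/measurable_EFinP; apply: measurable_funM; first exact: measurableT_comp.
  apply: (measurableT_comp mg); apply/measurable_fun_pair => /=; apply: measurable_funB => //;
  exact: measurableT_comp.
have m2 : measurable_fun setT (fun z : P * P => (f z.1 * g z.2)%:E * k (z.1 + z.2)%R)%E.
  apply: emeasurable_funM; last exact: (measurableT_comp mk measurable_plane_add).
  by apply/measurable_EFinP; apply: measurable_funM; exact: measurableT_comp.
transitivity (\int[leb2]_z \int[leb2]_x ((f x * g (z - x)%R)%:E * k z))%E.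
  apply: eq_integral => z _; rewrite hE -ge0_integralZr//.
  apply/measurable_EFinP; apply: measurable_funM => //.
  exact: (measurableT_comp mg (measurable_plane_sub2 z)).
rewrite (plane2_tonelli m1); last by move=> z; rewrite mule_ge0.
rewrite [RHS](leb4_tonelli1 m2); last by move=> z; rewrite mule_ge0.
apply: eq_integral => x _ /=.
rewrite -(plane_shift (f := fun z => (f x * g (z - x)%R)%:E * k z)%E x); first last.
- by move=> z; rewrite mule_ge0.
- exact: (measurableT_comp m1 (pair2_measurable x)).
by apply: eq_integral => z _; rewrite addrK [(z + x)%R]addrC.
Qed.

Lemma sqint_fin f : (sqint f < +oo)%E -> sqint f = (fine (sqint f))%:E.
Proof. by move=> h; rewrite fineK// ge0_fin_numE// sqint_ge0. Qed.

Section estimate.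
Variables (alpha s kap eps sg Cw : R).
Hypotheses (alpha0 : 0 < alpha) (alpha3 : alpha <= 3).
Hypotheses (kap0 : 0 < kap) (kap4 : kap <= 1 / 4).
Hypothesis sgE : sg = (alpha - 1) / 2 - 4 * kap.
Hypothesis sg_sign : alpha <= 1 \/ 0 <= sg.
Hypotheses (eps0 : 0 <= eps) (eps4 : eps <= kap / 4).
Hypothesis Cw0 : 0 < Cw.
Hypothesis kernL : forall z, kern alpha s eps z ^+ 2 <= Cw * bkernel alpha sg eps z.1 z.2.
Let w1 (z : P) : R := weight alpha (- (1 / 2)) (1 / 2 - eps) z.
Let w2 (z : P) : R := weight alpha s (1 / 2) z.
Let C := kern_const kap Cw 294.

(** Vanishing and infinite weighted norms are settled separately. In the remaining case all three
    square norms are real numbers, and [sqint h] can be absorbed. *)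
Lemma bilinear_main f g h : measurable_fun setT f -> measurable_fun setT g ->
  measurable_fun setT h ->
  (forall z, 0 <= f z) -> (forall z, 0 <= g z) -> (forall z, 0 <= h z) ->
  (forall z, (h z)%:E = \int[leb2]_x (f x * g (z - x))%:E)%E ->
  (sqint h < +oo)%E ->
  (sqint h <= (40 * C)%:E * (sqint (fun z => w1 z * f z)%R * sqint (fun z => w2 z * g z)%R))%E.
Proof.
move=> mf mg mh f0 g0 h0 hE hfin.
have mw1 : measurable_fun setT w1 by exact: measurable_weightP.
have mw2 : measurable_fun setT w2 by exact: measurable_weightP.
have w10 z : 0 < w1 z by exact: weight_gt0.
have w20 z : 0 < w2 z by exact: weight_gt0.
have C0 : 0 < C by exact: (kern_const_gt0 kap0 kap4 Cw0 (erefl _)).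
have hE' z : (h z)%:E = (\int[leb2]_x (g x * f (z - x))%:E)%E.
  rewrite hE -(plane_sub (f := fun x => (f x * g (z - x))%:E) z).
  - by apply: eq_integral => x _; rewrite subKr mulrC.
  - apply/measurable_EFinP; apply: measurable_funM => //.
    exact: (measurableT_comp mg (measurable_plane_sub2 z)).
  - by move=> x; rewrite lee_fin mulr_ge0.
pose F z := w1 z * f z; pose G z := w2 z * g z.
have mF : measurable_fun setT F by exact: measurable_funM.
have mG : measurable_fun setT G by exact: measurable_funM.
have F0 z : 0 <= F z by rewrite mulr_ge0// ltW.
have G0 z : 0 <= G z by rewrite mulr_ge0// ltW.
rewrite -[X in (_ * (X * _))%E]/(sqint F) -[X in (_ * (_ * X))%E]/(sqint G).
have [F00|Fpos] := eqVneq (sqint F) 0%E.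
  by rewrite (bilinear_null mw1 w10 mf mg f0 g0 hE F00) F00 mul0e mule0.
have [G00|Gpos] := eqVneq (sqint G) 0%E.
  by rewrite (bilinear_null mw2 w20 mg mf g0 f0 hE' G00) G00 !mule0.
have {}Fpos : (0 < sqint F)%E by rewrite lt0e Fpos sqint_ge0.
have {}Gpos : (0 < sqint G)%E by rewrite lt0e Gpos sqint_ge0.
have C40 : 0 < 40 * C by rewrite mulr_gt0.
have [Foo|Fn] := eqVneq (sqint F) +oo%E.
  by rewrite Foo gt0_mulye// gt0_muley ?lte_fin// leey.
have {Fn}Ffin : (sqint F < +oo)%E by rewrite ltey.
have [Goo|Gn] := eqVneq (sqint G) +oo%E.
  by rewrite Goo gt0_muley// gt0_muley ?lte_fin// leey.
have {Gn}Gfin : (sqint G < +oo)%E by rewrite ltey.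
move: (sqint_fin hfin) (sqint_fin Ffin) (sqint_fin Gfin) Fpos Gpos.
set n := fine (sqint h); set a := fine (sqint F); set b := fine (sqint G).
move=> nE aE bE; rewrite aE bE !lte_fin => a0 b0.
rewrite [sqint h]nE -!EFinM lee_fin.
apply: absorb_le => //.
have [mr1 mr2 mr3] := measurable_regions alpha.
pose K b z := kern_on alpha s eps b z.
have mK b0' : measurable_fun setT b0' -> measurable_fun setT (K b0').
  by move=> mb; exact: measurable_kern_on.
have K0 b0' z : 0 <= K b0' z by exact: kern_on_ge0.
have l0 (x : R) : 0 < x -> 0 < (8 * x)^-1 by move=> x0; rewrite invr_gt0 mulr_gt0.
(* The parameters (8 a)^-1, (8 b)^-1 and 8 C are chosen so that each piece returns n / 8, as in
   [absorb_le]. *)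
have T1 := trilinear1 mF mG mh F0 G0 h0 (ltW C0) (mK _ mr1) (K0 _) (l0 _ a0)
  (fun y => sup_region1 alpha0 alpha3 kap0 kap4 sgE sg_sign eps0 eps4 Cw0 (erefl _) kernL y).
have T2 := trilinear2 mF mG mh F0 G0 h0 (ltW C0) (mK _ mr2) (K0 _) (l0 _ b0)
  (fun y => sup_region2 alpha0 alpha3 kap0 kap4 sgE sg_sign eps0 eps4 Cw0 (erefl _) kernL y).
have l1 : 0 < 8 * C by rewrite mulr_gt0.
have T3 := trilinear3 mF mG mh F0 G0 h0 (ltW C0) (mK _ mr3) (K0 _) l1
  (fun y => sup_region3 alpha0 alpha3 kap0 kap4 sgE sg_sign eps0 eps4 Cw0 (erefl _) kernL y).
pose Q (z : P * P) := F z.1 * G z.2 * h (z.1 + z.2).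
have Q0 z : 0 <= Q z by exact: (mulr_ge0 (mulr_ge0 (F0 _) (G0 _)) (h0 _)).
have mQ : measurable_fun setT Q.
  apply: measurable_funM; last exact: (measurableT_comp mh measurable_plane_add).
  by apply: measurable_funM; exact: measurableT_comp.
have mQK b0' : measurable_fun setT b0' -> measurable_fun setT (fun z => (Q z * K b0' z)%:E).
  by move=> mb; apply/measurable_EFinP/measurable_funM => //; exact: mK.
(* The weights in F and G cancel against [kern], which is then split according to the regions. *)
have pE : sqint h = (\int[leb4]_z ((Q z * K (region1 alpha) z)%:E + (Q z * K (region2 alpha) z)%:E
    + (Q z * K (region3 alpha) z)%:E))%E.
  rewrite (_ : sqint h = \int[leb2]_z ((h z)%:E * (EFin \o h) z))%E; last first.
    by apply: eq_integral => z _; rewrite expr2 EFinM.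
  rewrite (convolution_pairing mf mg _ f0 g0 _ hE); last 2 first.
  - exact/measurable_EFinP.
  - by move=> z; rewrite lee_fin.
  apply: eq_integral => z _; rewrite /= -EFinM.
  rewrite -!EFinD -!mulrDr -kern_split /Q /F /G; congr (_%:E).
  have e : w1 z.1 * w2 z.2 * kern alpha s eps z = 1.
    by rewrite divff// gt_eqF// mulr_gt0.
  have -> : w1 z.1 * f z.1 * (w2 z.2 * g z.2) * h (z.1 + z.2) * kern alpha s eps z =
    (w1 z.1 * w2 z.2 * kern alpha s eps z) * (f z.1 * g z.2 * h (z.1 + z.2)) by ring.
  by rewrite e mul1r.
move: pE; rewrite ge0_integralD//; first last.
- exact: mQK.
- by move=> z _; rewrite lee_fin (mulr_ge0 (Q0 _) (K0 _ _)).
- by apply: emeasurable_funD; exact: mQK.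
- by move=> z _; rewrite -EFinD lee_fin addr_ge0 ?(mulr_ge0 (Q0 _) (K0 _ _)).
rewrite ge0_integralD//; first last.
- exact: mQK.
- by move=> z _; rewrite lee_fin (mulr_ge0 (Q0 _) (K0 _ _)).
- exact: mQK.
- by move=> z _; rewrite lee_fin (mulr_ge0 (Q0 _) (K0 _ _)).
move=> pE; rewrite -lee_fin -nE pE.
rewrite !EFinD; apply: leeD; first apply: leeD.
- by apply: le_trans T1 _; rewrite aE bE nE -!EFinM -!EFinD invrK.
- by apply: le_trans T2 _; rewrite aE bE nE -!EFinM -!EFinD invrK.
- by apply: le_trans T3 _; rewrite aE bE nE -!EFinM -!EFinD.
Qed.

End estimate.

(** 4 kap <= 2 r, where r is the distance of [s] from the critical exponent, keeps sg above -2 s.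
    For [alpha > 1] the bound (alpha - 1) / 8 makes sg nonnegative; for [alpha <= 1] its sign is
    left free. *)
Lemma choose_kap (alpha s : R) : 0 < alpha -> 1 / 4 - alpha / 4 < s ->
  exists2 kap : R, 0 < kap & [/\ kap <= 1 / 4,
    - (2 * s) <= (alpha - 1) / 2 - 4 * kap &
    alpha <= 1 \/ 0 <= (alpha - 1) / 2 - 4 * kap].
Proof.
move=> a0 hs; set r := s - (1 / 4 - alpha / 4).
have r0 : 0 < r by rewrite /r; lra.
have [a1|a1] := leP alpha 1.
  exists (Num.min (1 / 4) (r / 2)); first by rewrite lt_min; apply/andP; split; lra.
  have h1 : Num.min (1 / 4) (r / 2) <= 1 / 4 by rewrite ge_min lexx.
  have h2 : Num.min (1 / 4) (r / 2) <= r / 2 by rewrite ge_min lexx orbT.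
  by split => //; [move: h2; rewrite /r; lra|left].
set k := Num.min (1 / 4) (Num.min (r / 2) ((alpha - 1) / 8)).
have k0 : 0 < k by rewrite !lt_min; apply/andP; split; [lra|apply/andP; split; lra].
have h1 : k <= 1 / 4 by rewrite ge_min lexx.
have h2 : k <= r / 2 by rewrite !ge_min lexx orbT.
have h3 : k <= (alpha - 1) / 8 by rewrite !ge_min lexx !orbT.
by exists k => //; split => //; [move: h2; rewrite /r; lra|right; lra].
Qed.

(** Interface between the frequency side and the physical side. Finiteness of [sqint h] is a premise
    because the proof absorbs this quantity; the cutoff will supply it. *)
Definition bilinear_bound (w1 w2 : P -> R) (C : R) : Prop := forall f g h : P -> R,
  measurable_fun setT f -> measurable_fun setT g -> measurable_fun setT h ->
  (forall z, 0 <= f z) -> (forall z, 0 <= g z) -> (forall z, 0 <= h z) ->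
  (forall z, (h z)%:E = \int[leb2]_x (f x * g (z - x))%:E)%E ->
  (sqint h < +oo)%E ->
  (sqint h <= C%:E * (sqint (fun z => w1 z * f z)%R * sqint (fun z => w2 z * g z)%R))%E.

Theorem bilinear_estimate (alpha s : R) : 0 < alpha -> alpha <= 3 -> 1 / 4 - alpha / 4 < s ->
  exists2 eps0 : R, 0 < eps0 & forall eps, 0 < eps -> eps < eps0 ->
  exists2 C : R, 0 < C &
  bilinear_bound (weight alpha (- (1 / 2)) (1 / 2 - eps)) (weight alpha s (1 / 2)) C.
Proof.
move=> a0 a3 hs; have [kap k0 [k4 hsg hsign]] := choose_kap a0 hs.
exists (kap / 4); first by rewrite divr_gt0.
move=> eps e0 ek.
have sg2 : - 2 <= (alpha - 1) / 2 - 4 * kap by lra.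
have e1 : eps <= 1 / 2 by lra.
have [Cw Cw0 hC] := kern_sqr_le a0 a3 sg2 hsg (ltW e0) e1.
exists (40 * kern_const kap Cw 294).
  rewrite mulr_gt0//; exact: (kern_const_gt0 k0 k4 Cw0 (erefl _)).
by move=> f g h; apply: (bilinear_main a0 a3 k0 k4 (erefl _) hsign (ltW e0) (ltW ek) Cw0 hC).
Qed.

End Bilinear.

(** * Regularised Fourier inversion *)

Section DominatedFubini.
Context {R : realType} d1 d2 (T1 : measurableType d1) (T2 : measurableType d2).
Variables (m1 : {sigma_finite_measure set T1 -> \bar R}) (m2 : {sigma_finite_measure set T2 -> \bar R}).

Lemma integrable_le d (T : measurableType d) (m : {measure set T -> \bar R}) (f g : T -> R) :
  measurable_fun setT f -> (forall x, `|f x| <= g x) ->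
  m.-integrable setT (EFin \o g) -> m.-integrable setT (EFin \o f).
Proof.
move=> mf fg ig; apply: (le_integrable _ _ _ ig) => //; first exact/measurable_EFinP.
by move=> x _ /=; rewrite lee_fin (le_trans (fg x))// ler_norm.
Qed.

Lemma measurable_Rintegral_param (F : T1 * T2 -> R) : measurable_fun setT F ->
  measurable_fun setT (fun x => \int[m2]_y F (x, y)).
Proof.
move=> mF; have mE : measurable_fun setT (EFin \o F) by exact/measurable_EFinP.
apply: (measurableT_comp (fine_measurable measurableT)).
rewrite (_ : (fun x => _) = (fun x => (\int[m2]_y ((EFin \o F)^\+ (x, y))%E) -
   (\int[m2]_y ((EFin \o F)^\- (x, y)))%E)%E); last first.
  apply/funext => x; rewrite [LHS]integralE; congr (_ - _)%E; apply: eq_integral => y _.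
    by rewrite !funeposE.
  by rewrite !funenegE.
apply: emeasurable_funB; apply: (measurable_fun_fubini_tonelli_F _).
- exact: measurable_funepos.
- by move=> z; exact: funepos_ge0.
- exact: measurable_funeneg.
- by move=> z; exact: funeneg_ge0.
Qed.

Variables (F : T1 * T2 -> R) (a : T1 -> R) (b : T2 -> R).
Hypotheses (mF : measurable_fun setT F) (Fab : forall x y, `|F (x, y)| <= a x * b y).
Hypotheses (ia : m1.-integrable setT (EFin \o a)) (ib : m2.-integrable setT (EFin \o b)).

Lemma dominated_section1 x : m2.-integrable setT (fun y => (F (x, y))%:E).
Proof.
apply: (@integrable_le _ _ m2 (fun y => F (x, y)) (fun y => a x * b y)).
- exact: (measurableT_comp mF (pair1_measurable x)).
- exact: Fab.
- exact: (integrableZl measurableT (a x) ib).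
Qed.

Lemma dominated_section2 y : m1.-integrable setT (fun x => (F (x, y))%:E).
Proof.
apply: (@integrable_le _ _ m1 (fun x => F (x, y)) (fun x => a x * b y)).
- exact: (measurableT_comp mF (pair2_measurable y)).
- by move=> x; exact: Fab.
- exact: (integrableZr measurableT (b y) ia).
Qed.

(** The exchanges of signed integrals below all have an integrand dominated by a product of two
    integrable functions, so this criterion serves each of them. *)
Lemma dominated_integrable : (m1 \x m2)%E.-integrable setT (EFin \o F).
Proof.
apply/integrable12ltyP; first exact/measurable_EFinP.
apply: (@le_lt_trans _ _ (\int[m1]_x (`|a x|%:E * \int[m2]_y `|b y|%:E))%E).
  apply: ge0_le_integralT.
  - by move=> x; exact: integral_ge0.
  - apply: (measurable_fun_fubini_tonelli_F (fun z => `|(F z)%:E|%E)) => //.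
    by apply: measurableT_comp => //; exact/measurable_EFinP.
  - apply: emeasurable_funM => //; apply/measurable_EFinP.
    apply: measurableT_comp => //; exact/measurable_EFinP/(measurable_int _ ia).
  move=> x; rewrite -ge0_integralZl//; last first.
  - apply/measurable_EFinP; apply: measurableT_comp => //; exact/measurable_EFinP/(measurable_int _ ib).
  apply: ge0_le_integralT => //.
  - apply: measurableT_comp => //; exact: (measurable_int _ (dominated_section1 x)).
  - apply: emeasurable_funM => //; apply/measurable_EFinP.
    apply: measurableT_comp => //; exact/measurable_EFinP/(measurable_int _ ib).
  by move=> y; rewrite /= -EFinM lee_fin -normrM (le_trans (Fab x y))// ler_norm.
have fb : (\int[m2]_y `|b y|%:E \is a fin_num)%E.
  by rewrite ge0_fin_numE ?integral_ge0//; have /integrableP[_] := ib.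
rewrite ge0_integralZr//; first last.
- by rewrite integral_ge0.
- apply/measurable_EFinP; apply: measurableT_comp => //; exact/measurable_EFinP/(measurable_int _ ia).
by rewrite lte_mul_pinfty ?integral_ge0//;
  [rewrite ge0_fin_numE ?integral_ge0//|rewrite -ge0_fin_numE ?integral_ge0//]; have /integrableP[_] := ia.
Qed.

Lemma Rintegral_swap :
  \int[m1]_x (\int[m2]_y F (x, y)) = \int[m2]_y (\int[m1]_x F (x, y)).
Proof.
rewrite /Rintegral; congr fine.
rewrite (eq_integral (fun x => \int[m2]_y (F (x, y))%:E)%E); last first.
  by move=> x _; rewrite fineK//; apply: integrable_fin_num => //; exact: dominated_section1.
rewrite [RHS](eq_integral (fun y => \int[m1]_x (F (x, y))%:E)%E); last first.
  by move=> y _; rewrite fineK//; apply: integrable_fin_num => //; exact: dominated_section2.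
exact: (Fubini dominated_integrable).
Qed.

Lemma Rintegral_prod : \int[(m1 \x m2)%E]_z F z = \int[m1]_x (\int[m2]_y F (x, y)).
Proof.
rewrite /Rintegral; congr fine.
rewrite [RHS](eq_integral (fun x => \int[m2]_y (F (x, y))%:E)%E); last first.
  by move=> x _; rewrite fineK//; apply: integrable_fin_num => //; exact: dominated_section1.
exact/esym/(integral12_prod_meas1 dominated_integrable).
Qed.

End DominatedFubini.

(** * Cutoff and Poisson kernel on the plane *)

Section PlaneKernels.
Context {R : realType}.
Local Notation TR := (measurableTypeR R).
Local Notation P := (TR * TR)%type.
Local Notation mu := (@lebesgue_measure R).
Implicit Types (d : R) (y z : P).

Definition dot y z : R := y.1 * z.1 + y.2 * z.2.
Definition expk2 d z : R := expk d z.1 * expk d z.2.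
Definition poisson2 d z : R := poisson d z.1 * poisson d z.2.

Lemma expk2_ge0 d z : 0 <= expk2 d z.
Proof. by rewrite mulr_ge0 ?expk_ge0. Qed.

Lemma expk2_le1 d z : 0 <= d -> expk2 d z <= 1.
Proof. by move=> d0; rewrite mulr_ile1 ?expk_ge0 ?expk_le1. Qed.

Lemma poisson2_ge0 d z : 0 < d -> 0 <= poisson2 d z.
Proof. by move=> d0; rewrite mulr_ge0 ?poisson_ge0. Qed.

Lemma measurable_expk2 d : measurable_fun setT (expk2 d).
Proof. by apply: measurable_funM; apply: (measurableT_comp (measurable_expk d)). Qed.

Lemma measurable_poisson2 d : 0 < d -> measurable_fun setT (poisson2 d).
Proof. by move=> d0; apply: measurable_funM; apply: (measurableT_comp (measurable_poisson d0)). Qed.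

Lemma measurable_dot disp (T : measurableType disp) (f g : T -> P) :
  measurable_fun setT f -> measurable_fun setT g -> measurable_fun setT (fun t => dot (f t) (g t)).
Proof.
move=> mf mg; apply: measurable_funD; apply: measurable_funM.
- exact: (measurableT_comp measurable_fst).
- exact: (measurableT_comp measurable_fst).
- exact: (measurableT_comp measurable_snd).
- exact: (measurableT_comp measurable_snd).
Qed.

Lemma measurable_cosT disp (T : measurableType disp) (f : T -> R) :
  measurable_fun setT f -> measurable_fun setT (fun t => cos (f t)).
Proof.
by move=> mf; apply: measurableT_comp mf; apply: continuous_measurable_fun; exact: continuous_cos.
Qed.

Lemma measurable_sinT disp (T : measurableType disp) (f : T -> R) :
  measurable_fun setT f -> measurable_fun setT (fun t => sin (f t)).
Proof.
by move=> mf; apply: measurableT_comp mf; apply: continuous_measurable_fun; exact: continuous_sin.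
Qed.

Lemma integral_tensor (f g : R -> R) (a b : R) :
  measurable_fun setT f -> measurable_fun setT g ->
  (forall x, 0 <= f x) -> (forall x, 0 <= g x) ->
  (\int[mu]_x (f x)%:E = a%:E)%E -> (\int[mu]_x (g x)%:E = b%:E)%E ->
  (\int[leb2]_z (f z.1 * g z.2)%:E = (a * b)%:E)%E.
Proof.
move=> mf mg f0 g0 fa gb; rewrite plane_tonelli; first last.
- by move=> z; rewrite lee_fin mulr_ge0.
- by apply/measurable_EFinP; apply: measurable_funM; exact: measurableT_comp.
rewrite (eq_integral (fun x : TR => (f x)%:E * b%:E)%E); last first.
  move=> x _ /=; rewrite -gb -ge0_integralZl//.
  - exact/measurable_EFinP.
  - by move=> y _; rewrite lee_fin.
  - by rewrite lee_fin.
rewrite ge0_integralZr ?fa//.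
- exact/measurable_EFinP.
- by move=> x _; rewrite lee_fin.
- by rewrite -gb; apply: integral_ge0 => y _; rewrite lee_fin.
Qed.

Lemma integral_expk2 d : 0 < d -> (\int[leb2]_z (expk2 d z)%:E = ((2 / d) * (2 / d))%:E)%E.
Proof.
move=> d0; have h := integral_expk d0.
by apply: integral_tensor => //; try exact: measurable_expk; move=> x; exact: expk_ge0.
Qed.

Lemma integral_poisson2 d : 0 < d ->
  (\int[leb2]_z (poisson2 d z)%:E = ((2 * pi) * (2 * pi))%:E)%E.
Proof.
move=> d0; have h := integral_poisson d0.
by apply: integral_tensor => //; try exact: measurable_poisson; move=> x; exact: poisson_ge0.
Qed.

Lemma integrable_expk2 d : 0 < d -> (@leb2 R).-integrable setT (EFin \o expk2 d).
Proof.
move=> d0; apply/integrableP; split; first by apply/measurable_EFinP; exact: measurable_expk2.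
under eq_integral do rewrite /= ger0_norm ?expk2_ge0//.
by rewrite integral_expk2// ltry.
Qed.

Lemma integrable_poisson2 d : 0 < d -> (@leb2 R).-integrable setT (EFin \o poisson2 d).
Proof.
move=> d0; apply/integrableP; split; first by apply/measurable_EFinP; exact: measurable_poisson2.
under eq_integral do rewrite /= ger0_norm ?poisson2_ge0//.
by rewrite integral_poisson2// ltry.
Qed.

Lemma Rintegral_expk_lin d y (a b : R) : 0 < d ->
  \int[mu]_x (expk d x * (a * cos (x * y.2) + b * sin (x * y.2))) = a * poisson d y.2.
Proof.
move=> d0.
have ic := integrable_expk_bounded d0 (measurable_cosM y.2) (fun x => cos_max _).
have iss := integrable_expk_bounded d0 (measurable_sinM y.2) (fun x => sin_max _).
rewrite (eq_Rintegral _ _ (g := fun x : TR => a * (expk d x * cos (x * y.2)) + b * (expk d x * sin (x * y.2)))); last first.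
  by move=> x _; ring.
rewrite RintegralD//; [|exact: (integrableZl measurableT a ic)|exact: (integrableZl measurableT b iss)].
rewrite RintegralZl// RintegralZl//.
by rewrite Rintegral_expk_cos// Rintegral_expk_sin// mulr0 addr0.
Qed.

Lemma expk2_cos_bound d (f : R -> R) (x y t : R) : (forall t, `|f t| <= 1) ->
  `|expk2 d (x, y) * f t| <= expk d x * expk d y.
Proof.
by move=> f1; rewrite normrM (ger0_norm (expk2_ge0 _ _)) ler_piMr// expk2_ge0.
Qed.

(** The addition formula splits the plane integral into line integrals, in which the sine terms
    vanish by oddness. *)
Lemma Rintegral_expk2_cos d y : 0 < d ->
  \int[leb2]_z (expk2 d z * cos (dot y z)) = poisson2 d y.
Proof.
move=> d0.
rewrite (Rintegral_prod (m1 := mu) (m2 := mu) (a := expk d) (b := expk d) _ _ (integrable_expk d0) (integrable_expk d0)); first last.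
- by move=> x t; apply: expk2_cos_bound => s; exact: cos_max.
- apply: measurable_funM; first exact: measurable_expk2.
  by apply: measurable_cosT; exact: measurable_dot.
rewrite (eq_Rintegral _ _ (g := fun x : TR => expk d x * (poisson d y.2 * cos (x * y.1) + 0 * sin (x * y.1)))).
  (* [Rintegral_expk_lin] reads the second coordinate of its pair, hence the swap. *)
  have := @Rintegral_expk_lin d (y.2, y.1) (poisson d y.2) 0 d0; rewrite /= => ->.
  by rewrite /poisson2 mulrC.
move=> x _.
rewrite (eq_Rintegral _ _ (g := fun t : TR => expk d t * ((expk d x * cos (x * y.1)) * cos (t * y.2) + (- (expk d x * sin (x * y.1))) * sin (t * y.2)))).
  by rewrite Rintegral_expk_lin//; ring.
move=> t _; rewrite /expk2 /dot /= (mulrC y.1) (mulrC y.2) cosD; ring.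
Qed.

Lemma Rintegral_expk2_sin d y : 0 < d ->
  \int[leb2]_z (expk2 d z * sin (dot y z)) = 0.
Proof.
move=> d0.
rewrite (Rintegral_prod (m1 := mu) (m2 := mu) (a := expk d) (b := expk d) _ _ (integrable_expk d0) (integrable_expk d0)); first last.
- by move=> x t; apply: expk2_cos_bound => s; exact: sin_max.
- apply: measurable_funM; first exact: measurable_expk2.
  by apply: measurable_sinT; exact: measurable_dot.
rewrite (eq_Rintegral _ _ (g := fun x : TR => expk d x * (0 * cos (x * y.1) + poisson d y.2 * sin (x * y.1)))).
  have := @Rintegral_expk_lin d (y.2, y.1) 0 (poisson d y.2) d0; rewrite /= => ->.
  by rewrite mul0r.
move=> x _.
rewrite (eq_Rintegral _ _ (g := fun t : TR => expk d t * ((expk d x * sin (x * y.1)) * cos (t * y.2) + ((expk d x * cos (x * y.1))) * sin (t * y.2)))).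
  by rewrite Rintegral_expk_lin//; ring.
move=> t _; rewrite /expk2 /dot /= (mulrC y.1) (mulrC y.2) sinD; ring.
Qed.

End PlaneKernels.

Lemma abs_Rintegral_le d (T : measurableType d) (R : realType) (m : {measure set T -> \bar R})
    (f : T -> R) : measurable_fun setT f ->
  (`|\int[m]_x f x|%:E <= \int[m]_x `|f x|%:E)%E.
Proof.
move=> mf; have [foo|] := ltP (\int[m]_x `|f x|%:E)%E +oo%E; last first.
  by rewrite leye_eq => /eqP ->; rewrite leey.
have fi : m.-integrable setT (EFin \o f).
  by apply/integrableP; split; [exact/measurable_EFinP|exact: foo].
rewrite EFin_normr_Rintegral//; apply: (le_trans (le_abse_integral _ _ _)) => //.
exact/measurable_EFinP.
Qed.

(** * A weighted Plancherel identity *)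

Section EnergyIdentity.
Context {R : realType} d (T : measurableType d) (m : {sigma_finite_measure set T -> \bar R}).
Local Notation TR := (measurableTypeR R).
Local Notation P := (TR * TR)%type.
Variables (phi : T -> R) (Th : T -> P).
Hypotheses (iphi : m.-integrable setT (EFin \o phi)) (mTh : measurable_fun setT Th).

(** Together with [sinint], these are up to sign the real and imaginary parts of the Fourier
    transform of the image under [Th] of the measure [phi] dm. A general [T] covers both a function
    on the plane, with the identity, and a tensor product, with addition. *)
Definition cosint (z : P) : R := \int[m]_t (phi t * cos (dot z (Th t))).
Definition sinint (z : P) : R := \int[m]_t (phi t * sin (dot z (Th t))).

Let mphi : measurable_fun setT phi.
Proof. exact/measurable_EFinP/(measurable_int _ iphi). Qed.

Let iaphi : m.-integrable setT (EFin \o (fun t => `|phi t|)).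
Proof. exact: (integrable_abse iphi). Qed.

Lemma measurable_phi_trig (f : R -> R) : continuous f ->
  measurable_fun setT (fun zt : P * T => phi zt.2 * f (dot zt.1 (Th zt.2))).
Proof.
move=> cf; apply: measurable_funM; first exact: measurableT_comp.
apply: (measurableT_comp (continuous_measurable_fun cf)).
by apply: measurable_dot => //; exact: measurableT_comp.
Qed.

Let phi_bound (f : R -> R) (t : T) (x : R) : (forall x, `|f x| <= 1) -> `|phi t * f x| <= `|phi t|.
Proof. by move=> f1; rewrite normrM ler_piMr. Qed.

Lemma integrable_phi_trig (f : R -> R) (z : P) : continuous f -> (forall x, `|f x| <= 1) ->
  m.-integrable setT (EFin \o (fun t => phi t * f (dot z (Th t)))).
Proof.
move=> cf f1; apply: (integrable_le _ _ iaphi); last by move=> t; exact: phi_bound.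
exact: (measurableT_comp (measurable_phi_trig cf) (pair1_measurable z)).
Qed.

Let K : R := \int[m]_t `|phi t|.

Let phi_trig_le (f : R -> R) (z : P) : continuous f -> (forall x, `|f x| <= 1) ->
  `|\int[m]_t (phi t * f (dot z (Th t)))| <= K.
Proof.
move=> cf f1; apply: le_trans (le_normr_Rintegral _ _) _ => //.
  exact: integrable_phi_trig.
apply: le_Rintegral => //.
  exact: (integrable_abse (integrable_phi_trig z cf f1)).
by move=> t _; exact: phi_bound.
Qed.

Let K0 : 0 <= K. Proof. by apply: Rintegral_ge0. Qed.

Lemma cosint_le z : `|cosint z| <= K.
Proof. by apply: phi_trig_le; [exact: continuous_cos|exact: cos_max]. Qed.

Lemma sinint_le z : `|sinint z| <= K.
Proof. by apply: phi_trig_le; [exact: continuous_sin|exact: sin_max]. Qed.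

Lemma measurable_cosint : measurable_fun setT cosint.
Proof. exact: (measurable_Rintegral_param _ (measurable_phi_trig (@continuous_cos R))). Qed.

Lemma measurable_sinint : measurable_fun setT sinint.
Proof. exact: (measurable_Rintegral_param _ (measurable_phi_trig (@continuous_sin R))). Qed.

Variable eta : R.
Hypothesis eta0 : 0 < eta.

Let F2 (t : T) (zt : P * T) : R :=
  expk2 eta zt.1 * (phi t * (phi zt.2 * cos (dot zt.1 (Th t) - dot zt.1 (Th zt.2)))).

(** cos A cos A' + sin A sin A' = cos (A - A') gathers the terms into one cosine of z against Th t -
    Th t', whose integral against the cutoff is a Poisson kernel. *)
Lemma energy_inner t :
  \int[leb2]_z (expk2 eta z * (phi t * (cos (dot z (Th t)) * cosint z + sin (dot z (Th t)) * sinint z))) =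
  \int[m]_t' (phi t * phi t' * poisson2 eta (Th t - Th t')).
Proof.
have mF : measurable_fun setT (F2 t).
  apply: measurable_funM; first exact: (measurableT_comp (measurable_expk2 eta)).
  apply: measurable_funM => //; apply: measurable_funM; first exact: measurableT_comp.
  apply: measurable_cosT; apply: measurable_funB; apply: measurable_dot => //.
  exact: measurableT_comp.
rewrite (eq_Rintegral _ _ (g := fun z : P => \int[m]_t' F2 t (z, t'))); last first.
  move=> z _; rewrite /cosint /sinint /F2 /=.
  have ic := integrable_phi_trig z (@continuous_cos R) (@cos_max R).
  have iss := integrable_phi_trig z (@continuous_sin R) (@sin_max R).
  rewrite [RHS](eq_Rintegral _ _ (g := fun x =>
    (expk2 eta z * phi t * cos (dot z (Th t))) * (phi x * cos (dot z (Th x))) +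
    (expk2 eta z * phi t * sin (dot z (Th t))) * (phi x * sin (dot z (Th x))))); last first.
    by move=> x _; rewrite cosB; ring.
  rewrite RintegralD//; [|exact: (integrableZl measurableT _ ic)|exact: (integrableZl measurableT _ iss)].
  by rewrite RintegralZl// RintegralZl//; ring.
rewrite (Rintegral_swap (m1 := leb2) (m2 := m) (a := fun z => `|phi t| * expk2 eta z) (b := fun t => `|phi t|) mF).
- apply: eq_Rintegral => t' _; rewrite /F2 /=.
  rewrite (eq_Rintegral _ _ (g := fun z : P => (phi t * phi t') * (expk2 eta z * cos (dot (Th t - Th t') z)))).
    rewrite RintegralZl ?Rintegral_expk2_cos//.
    apply: (integrable_le _ _ (integrable_expk2 eta0)).
      apply: measurable_funM; first exact: measurable_expk2.
      by apply: measurable_cosT; exact: measurable_dot.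
    by move=> z; rewrite normrM (ger0_norm (expk2_ge0 _ _)) ler_piMr ?expk2_ge0 ?cos_max.
  move=> z _; rewrite mulrCA !mulrA; congr (_ * cos _); first by ring.
  by rewrite /dot /=; ring.
- move=> z t'; rewrite /F2 /= normrM (ger0_norm (expk2_ge0 _ _)) !normrM.
  rewrite mulrA (mulrC (expk2 _ _)) ler_wpM2l//; first by apply: mulr_ge0 => //; exact: expk2_ge0.
  by rewrite ler_piMr ?cos_max.
- exact: (integrableZl measurableT _ (integrable_expk2 eta0)).
- exact: iaphi.
Qed.

(* A Plancherel formula against the positive weight [expk2 eta], whose Fourier
   transform is the nonnegative kernel [poisson2 eta]. *)
Lemma energy_identity :
  \int[leb2]_z (expk2 eta z * (cosint z ^+ 2 + sinint z ^+ 2)) =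
  \int[m]_t (\int[m]_t' (phi t * phi t' * poisson2 eta (Th t - Th t'))).
Proof.
pose F1 (zt : P * T) := expk2 eta zt.1 *
  (phi zt.2 * (cos (dot zt.1 (Th zt.2)) * cosint zt.1 + sin (dot zt.1 (Th zt.2)) * sinint zt.1)).
have mF : measurable_fun setT F1.
  apply: measurable_funM; first exact: (measurableT_comp (measurable_expk2 eta)).
  apply: measurable_funM; first exact: measurableT_comp.
  have md : measurable_fun setT (fun zt : P * T => dot zt.1 (Th zt.2)).
    by apply: measurable_dot => //; exact: measurableT_comp.
  apply: measurable_funD; apply: measurable_funM.
  - exact: measurable_cosT.
  - exact: (measurableT_comp measurable_cosint).
  - exact: measurable_sinT.
  - exact: (measurableT_comp measurable_sinint).
rewrite (eq_Rintegral _ _ (g := fun z : P => \int[m]_t F1 (z, t))); last first.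
  move=> z _; rewrite /F1 /=.
  have ic := integrable_phi_trig z (@continuous_cos R) (@cos_max R).
  have iss := integrable_phi_trig z (@continuous_sin R) (@sin_max R).
  rewrite (eq_Rintegral _ _ (g := fun t => (expk2 eta z * cosint z) * (phi t * cos (dot z (Th t))) +
    (expk2 eta z * sinint z) * (phi t * sin (dot z (Th t))))); last by move=> t _; ring.
  rewrite RintegralD//; [|exact: (integrableZl measurableT _ ic)|exact: (integrableZl measurableT _ iss)].
  by rewrite RintegralZl// RintegralZl// -/(cosint z) -/(sinint z); ring.
rewrite (Rintegral_swap (m1 := leb2) (m2 := m) (a := fun z => (K + K) * expk2 eta z) (b := fun t => `|phi t|) mF).
- by apply: eq_Rintegral => t _; rewrite energy_inner.
- move=> z t; rewrite /F1 /= normrM (ger0_norm (expk2_ge0 _ _)) normrM.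
  rewrite mulrCA mulrC (mulrC (K + K)) ler_wpM2r// ler_wpM2l ?expk2_ge0//.
  apply: (le_trans (ler_normD _ _)); rewrite !normrM.
  apply: lerD; rewrite -[leRHS]mul1r; apply: ler_pM => //.
  - exact: cos_max.
  - exact: cosint_le.
  - exact: sin_max.
  - exact: sinint_le.
- exact: (integrableZl measurableT _ (integrable_expk2 eta0)).
- exact: iaphi.
Qed.

(** Since the Poisson kernel is nonnegative, the triangle inequality replaces [phi] by its absolute
    value and leaves the kernel untouched. *)
Lemma energy_le :
  (\int[leb2]_z (expk2 eta z * (cosint z ^+ 2 + sinint z ^+ 2))%:E <=
   \int[m]_t (\int[m]_t' (`|phi t| * `|phi t'| * poisson2 eta (Th t - Th t'))%:E))%E.
Proof.
pose G (z : P) := expk2 eta z * (cosint z ^+ 2 + sinint z ^+ 2).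
have mG : measurable_fun setT G.
  apply: measurable_funM; first exact: measurable_expk2.
  by apply: measurable_funD; apply: measurable_funX; [exact: measurable_cosint|exact: measurable_sinint].
have iG : (@leb2 R).-integrable setT (EFin \o G).
  apply: (@integrable_le _ _ _ _ G (fun z => (K ^+ 2 + K ^+ 2) * expk2 eta z)) => //.
    move=> z; rewrite normrM (ger0_norm (expk2_ge0 _ _)) mulrC ler_wpM2r ?expk2_ge0//.
    rewrite ger0_norm ?addr_ge0 ?sqr_ge0//.
    by apply: lerD; rewrite -(real_normK (num_real _)) lerXn2r ?nnegrE ?cosint_le ?sinint_le.
  exact: (integrableZl measurableT _ (integrable_expk2 eta0)).
have -> : (\int[leb2]_z (G z)%:E)%E = (\int[leb2]_z G z)%:E.
  by rewrite fineK//; apply: integrable_fin_num.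
rewrite energy_identity.
have mp : measurable_fun setT (fun z : T * T => phi z.1 * phi z.2 * poisson2 eta (Th z.1 - Th z.2)).
  have mT : measurable_fun setT (fun z : T * T => (Th z.1 - Th z.2 : P)).
    by apply: measurable_planeB; exact: measurableT_comp.
  apply: measurable_funM; last exact: (measurableT_comp (measurable_poisson2 eta0)).
  by apply: measurable_funM; exact: measurableT_comp.
have mabs : measurable_fun setT (fun z : T * T => `|phi z.1 * phi z.2 * poisson2 eta (Th z.1 - Th z.2)|%:E).
  by apply/measurable_EFinP; exact: measurableT_comp.
have le_norm (x : R) (y : \bar R) : (`|x|%:E <= y -> x%:E <= y)%E.
  by apply: le_trans; rewrite lee_fin ler_norm.
apply: le_norm.
apply: (le_trans (abs_Rintegral_le _ (measurable_Rintegral_param _ mp))).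
have mI := measurable_fun_fubini_tonelli_F _ mabs.
rewrite (eq_integral (fun t => \int[m]_t' (`|phi t * phi t' * poisson2 eta (Th t - Th t')|)%:E)%E (fun t => \int[m]_t' (`|phi t| * `|phi t'| * poisson2 eta (Th t - Th t'))%:E)%E).
apply: ge0_le_integralT.
- by move=> t; rewrite lee_fin.
- by apply/measurable_EFinP; apply: measurableT_comp => //; exact: (measurable_Rintegral_param _ mp).
- by apply: mI => z; rewrite lee_fin.
- move=> t; apply: abs_Rintegral_le.
  exact: (measurableT_comp mp (pair1_measurable t)).
move=> t _; apply: eq_integral => t' _.
by rewrite normrM (ger0_norm (poisson2_ge0 _ eta0)) normrM.
Qed.

End EnergyIdentity.

(** * Tensor products and convolutions *)

Section PlaneSquare.
Context {R : realType}.
Local Notation TR := (measurableTypeR R).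
Local Notation P := (TR * TR)%type.

(** A name for the product measure, to carry the sigma-finite structure under which the energy
    identity is applied to it. *)
Definition leb2x2 : set (P * P) -> \bar R := (@leb2 R \x @leb2 R)%E.

HB.instance Definition _ := Measure.on leb2x2.

Let leb2x2_sigma_finite : sigma_finite setT leb2x2.
Proof.
have /sigma_finiteP[F [TF ndF Foo]] := sigma_finiteT (@leb2 R).
exists (fun n => F n `*` F n).
  apply/esym; rewrite -subTset => -[x y] _.
  have [n _ Fx] : (\bigcup_n F n) x by rewrite -TF.
  have [m _ Fy] : (\bigcup_n F n) y by rewrite -TF.
  exists (maxn n m) => //; split => /=.
  - by have /subsetPset := ndF _ _ (leq_maxl n m); exact.
  - by have /subsetPset := ndF _ _ (leq_maxr n m); exact.
move=> n; have [mF Fn] := Foo n; split; first exact: measurableX.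
by rewrite /leb2x2 product_measure1E// lte_mul_pinfty// ge0_fin_numE.
Qed.

HB.instance Definition _ := Measure_isSigmaFinite.Build _ _ _ leb2x2 leb2x2_sigma_finite.

End PlaneSquare.

Section TensorEnergy.
Context {R : realType}.
Local Notation TR := (measurableTypeR R).
Local Notation P := (TR * TR)%type.
Local Notation leb4 := (@leb2x2 R).
Implicit Types phi psi h : P -> R.

Definition fcos phi : P -> R := cosint (@leb2 R) phi (@idfun P).
Definition fsin phi : P -> R := sinint (@leb2 R) phi (@idfun P).
(** The squared modulus of the Fourier transform of a real function. *)
Definition fenergy phi (z : P) : R := fcos phi z ^+ 2 + fsin phi z ^+ 2.

Variables phi psi h : P -> R.
Hypotheses (iphi : (@leb2 R).-integrable setT (EFin \o phi)).
Hypotheses (ipsi : (@leb2 R).-integrable setT (EFin \o psi)).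
Hypothesis hE : forall z, (h z)%:E = (\int[leb2]_x (`|phi x| * `|psi (z - x)|)%:E)%E.

Let mphi : measurable_fun setT phi.
Proof. by have mE := measurable_int _ iphi; apply/measurable_EFinP; exact: mE. Qed.
Let mpsi : measurable_fun setT psi.
Proof. by have mE := measurable_int _ ipsi; apply/measurable_EFinP; exact: mE. Qed.

Let Phi (t : P * P) : R := phi t.1 * psi t.2.
Let Th (t : P * P) : P := t.1 + t.2.

Let mPhi : measurable_fun setT Phi.
Proof.
apply: measurable_funM; first exact: (measurableT_comp mphi measurable_fst).
exact: (measurableT_comp mpsi measurable_snd).
Qed.

Let mTh : measurable_fun setT Th. Proof. exact: measurable_plane_add. Qed.

Let Phi_le x y : `|Phi (x, y)| <= `|phi x| * `|psi y|.
Proof. by rewrite normrM. Qed.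

Let iPhi : leb4.-integrable setT (EFin \o Phi).
Proof.
exact: (dominated_integrable mPhi Phi_le (integrable_abse iphi) (integrable_abse ipsi)).
Qed.

Let trig_integrable (f : R -> R) (xi : P -> R) z : (@leb2 R).-integrable setT (EFin \o xi) ->
  continuous f -> (forall x, `|f x| <= 1) ->
  (@leb2 R).-integrable setT (EFin \o (fun t => xi t * f (dot z t))).
Proof. by move=> ixi; apply: integrable_phi_trig => //; exact: measurable_id. Qed.

Let prod_int (f : R -> R) z : continuous f -> (forall x, `|f x| <= 1) ->
  \int[leb4]_t (Phi t * f (dot z (Th t))) =
  \int[leb2]_x (\int[leb2]_y (phi x * psi y * f (dot z x + dot z y))).
Proof.
move=> cf f1.
rewrite (Rintegral_prod (m1 := leb2) (m2 := leb2) (a := fun x => `|phi x|) (b := fun x => `|psi x|)).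
- apply: eq_Rintegral => x _; apply: eq_Rintegral => y _; rewrite /Phi /Th /dot /=.
  by congr (_ * f _); ring.
- apply: (measurable_funM mPhi); apply: (measurableT_comp (continuous_measurable_fun cf)).
  by apply: measurable_dot => //; exact: measurable_cst.
- by move=> x y; rewrite normrM (le_trans (ler_piMr _ (f1 _)))// normrM.
- exact: (integrable_abse iphi).
- exact: (integrable_abse ipsi).
Qed.

Let sep_int (f1 f2 g1 g2 : R -> R) z :
  continuous f1 -> continuous f2 -> continuous g1 -> continuous g2 ->
  (forall x, `|f1 x| <= 1) -> (forall x, `|f2 x| <= 1) ->
  (forall x, `|g1 x| <= 1) -> (forall x, `|g2 x| <= 1) ->
  \int[leb2]_x (\int[leb2]_y (phi x * psi y * (f1 (dot z x) * g1 (dot z y) + f2 (dot z x) * g2 (dot z y)))) =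
  (\int[leb2]_x (phi x * f1 (dot z x))) * (\int[leb2]_x (psi x * g1 (dot z x))) +
  (\int[leb2]_x (phi x * f2 (dot z x))) * (\int[leb2]_x (psi x * g2 (dot z x))).
Proof.
move=> cf1 cf2 cg1 cg2 bf1 bf2 bg1 bg2.
have i1 := trig_integrable z iphi cf1 bf1; have i2 := trig_integrable z iphi cf2 bf2.
have j1 := trig_integrable z ipsi cg1 bg1; have j2 := trig_integrable z ipsi cg2 bg2.
rewrite -RintegralZr// -RintegralZr// -RintegralD//; last 2 first.
- exact: (integrableZr measurableT _ i1).
- exact: (integrableZr measurableT _ i2).
apply: eq_Rintegral => x _; rewrite -RintegralZl// -RintegralZl// -RintegralD//; last 2 first.
- exact: (integrableZl measurableT _ j1).
- exact: (integrableZl measurableT _ j2).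
by apply: eq_Rintegral => y _; ring.
Qed.

Lemma cosint_tensor z : cosint leb4 Phi Th z = fcos phi z * fcos psi z - fsin phi z * fsin psi z.
Proof.
rewrite /cosint (prod_int z (@continuous_cos R) (@cos_max R)).
have sN x : `|- sin x| <= 1 :> R by rewrite normrN sin_max.
have csN : continuous (fun x : R => - sin x).
  by move=> x; apply: (@continuousN R R^o _ sin); exact: continuous_sin.
rewrite (eq_Rintegral _ _ (g := fun x : P => \int[leb2]_y (phi x * psi y *
  (cos (dot z x) * cos (dot z y) + (- sin (dot z x)) * sin (dot z y))))); last first.
  by move=> x _; apply: eq_Rintegral => y _; rewrite cosD mulNr.
rewrite (sep_int z (@continuous_cos R) csN (@continuous_cos R) (@continuous_sin R) (@cos_max R) sN (@cos_max R) (@sin_max R)).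
rewrite [X in _ + X * _](_ : _ = - fsin phi z) ?mulNr//.
rewrite -[RHS]mulN1r -RintegralZl//.
  by apply: eq_Rintegral => x _; rewrite mulN1r mulrN.
exact: (trig_integrable z iphi (@continuous_sin R) (@sin_max R)).
Qed.

Lemma sinint_tensor z : sinint leb4 Phi Th z = fsin phi z * fcos psi z + fcos phi z * fsin psi z.
Proof.
rewrite /sinint (prod_int z (@continuous_sin R) (@sin_max R)).
rewrite (eq_Rintegral _ _ (g := fun x : P => \int[leb2]_y (phi x * psi y *
  (sin (dot z x) * cos (dot z y) + cos (dot z x) * sin (dot z y))))); last first.
  by move=> x _; apply: eq_Rintegral => y _; rewrite sinD.
exact: (sep_int z (@continuous_sin R) (@continuous_cos R) (@continuous_cos R) (@continuous_sin R) (@sin_max R) (@cos_max R) (@cos_max R) (@sin_max R)).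
Qed.

(** The image of the tensor product under addition is the convolution, so its transform is the
    product of the two transforms. The angle addition formulas express this, and squared moduli
    multiply. *)
Lemma fenergy_tensor z :
  cosint leb4 Phi Th z ^+ 2 + sinint leb4 Phi Th z ^+ 2 = fenergy phi z * fenergy psi z.
Proof. by rewrite cosint_tensor sinint_tensor /fenergy; ring. Qed.

Lemma measurable_poisson_shear (eta : R) : 0 < eta ->
  measurable_fun setT (fun z : P * P => poisson2 eta (z.1 - z.2)).
Proof.
move=> eta0.
have mS : measurable_fun setT (fun z : P * P => z.1 - z.2 : P) by exact: measurable_planeB.
exact: (measurableT_comp (measurable_poisson2 eta0) mS).
Qed.

Let measurable_poisson_conv (eta : R) : 0 < eta -> measurable_fun setT h -> (forall z, 0 <= h z) ->
  measurable_fun setT (fun y : P => \int[leb2]_s ((h s)%:E * (poisson2 eta (y - s)%R)%:E))%E.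
Proof.
move=> eta0 mh h0.
pose f3 (z : P * P) := ((h z.2)%:E * (poisson2 eta (z.1 - z.2))%:E)%E.
have mf3 : measurable_fun setT f3.
  apply: emeasurable_funM; apply/measurable_EFinP; last exact: measurable_poisson_shear.
  exact: measurableT_comp.
have f30 z : (0 <= f3 z)%E by rewrite mule_ge0// lee_fin// poisson2_ge0.
exact: (measurable_fun_fubini_tonelli_F (m2 := leb2) _ mf3 f30).
Qed.

(** Young's inequality for a kernel of mass (2 pi)^2 in either variable. AM-GM in the form h(y) h(s)
    <= h(y)^2 + h(s)^2 reduces it to two integrals of the kernel, hence the factor 2. *)
Lemma poisson_young (eta : R) : 0 < eta -> measurable_fun setT h -> (forall z, 0 <= h z) ->
  (\int[leb2]_y ((h y)%:E * \int[leb2]_s ((h s)%:E * (poisson2 eta (y - s))%:E)) <=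
   (2 * ((2 * pi) * (2 * pi)))%:E * sqint h)%E.
Proof.
move=> eta0 mh h0; have p0 z := poisson2_ge0 z eta0; have mp := measurable_poisson2 eta0.
have mp2 := measurable_poisson_shear eta0.
have mh1 : measurable_fun setT (fun z : P * P => h z.1) by exact: measurableT_comp.
have mh2 : measurable_fun setT (fun z : P * P => h z.2) by exact: measurableT_comp.
pose c : R := (2 * pi) * (2 * pi).
have c0 : (0 <= c%:E)%E by rewrite lee_fin mulr_ge0// mulr_ge0// pi_ge0.
have intp y : (\int[leb2]_s (poisson2 eta (y - s))%:E = c%:E)%E.
  rewrite (plane_sub (f := fun z => (poisson2 eta z)%:E)) ?integral_poisson2//.
  exact/measurable_EFinP.
have intp' s : (\int[leb2]_y (poisson2 eta (y - s))%:E = c%:E)%E.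
  rewrite (plane_shift (f := fun z => (poisson2 eta z)%:E)) ?integral_poisson2//.
  exact/measurable_EFinP.
pose f1 (z : P * P) := ((h z.1 ^+ 2)%:E * (poisson2 eta (z.1 - z.2))%:E)%E.
pose f2 (z : P * P) := ((h z.2 ^+ 2)%:E * (poisson2 eta (z.1 - z.2))%:E)%E.
have mf1 : measurable_fun setT f1.
  by apply: emeasurable_funM; apply/measurable_EFinP => //; exact: measurable_funX.
have mf2 : measurable_fun setT f2.
  by apply: emeasurable_funM; apply/measurable_EFinP => //; exact: measurable_funX.
have f10 z : (0 <= f1 z)%E by rewrite mule_ge0// lee_fin ?sqr_ge0.
have f20 z : (0 <= f2 z)%E by rewrite mule_ge0// lee_fin ?sqr_ge0.
have s1 : (\int[leb2]_y \int[leb2]_s f1 (y, s) = c%:E * sqint h)%E.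
  rewrite /sqint -ge0_integralZl//; last 2 first.
  - exact: measurable_sqr.
  - by move=> x _; rewrite lee_fin sqr_ge0.
  apply: eq_integral => y _; rewrite /f1 /= ge0_integralZl//.
  - by rewrite intp muleC.
  - apply/measurable_EFinP; exact: (measurableT_comp mp2 (pair1_measurable y)).
  - by move=> x _; rewrite lee_fin.
  - by rewrite lee_fin sqr_ge0.
have s2 : (\int[leb2]_y \int[leb2]_s f2 (y, s) = c%:E * sqint h)%E.
  rewrite (plane2_tonelli mf2 f20) /sqint -ge0_integralZl//; last 2 first.
  - exact: measurable_sqr.
  - by move=> x _; rewrite lee_fin sqr_ge0.
  apply: eq_integral => y _; rewrite /f2 /= ge0_integralZl//.
  - by rewrite intp' muleC.
  - apply/measurable_EFinP; exact: (measurableT_comp mp2 (pair2_measurable y)).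
  - by move=> x _; rewrite lee_fin.
  - by rewrite lee_fin sqr_ge0.
have mF1 := measurable_fun_fubini_tonelli_F (m2 := leb2) _ mf1 f10.
have mF2 := measurable_fun_fubini_tonelli_F (m2 := leb2) _ mf2 f20.
pose f3 (z : P * P) := ((h z.2)%:E * (poisson2 eta (z.1 - z.2))%:E)%E.
have mf3 : measurable_fun setT f3 by apply: emeasurable_funM; exact/measurable_EFinP.
have f30 z : (0 <= f3 z)%E by rewrite mule_ge0// lee_fin.
apply: (@le_trans _ _ (\int[leb2]_y (\int[leb2]_s f1 (y, s) + \int[leb2]_s f2 (y, s)))%E).
  apply: ge0_le_integralT.
  - by move=> y; apply: mule_ge0; [rewrite lee_fin|apply: integral_ge0 => x _; exact: (f30 (y, x))].
  - by apply: emeasurable_funM; [exact/measurable_EFinP|exact: measurable_poisson_conv].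
  - exact: emeasurable_funD.
  move=> y; rewrite -ge0_integralD//; last 2 first.
  - exact: (measurableT_comp mf1 (pair1_measurable y)).
  - exact: (measurableT_comp mf2 (pair1_measurable y)).
  rewrite -ge0_integralZl//; last 3 first.
  - exact: (measurableT_comp mf3 (pair1_measurable y)).
  - by move=> x _; exact: (f30 (y, x)).
  - by rewrite lee_fin.
  apply: ge0_le_integralT.
  - by move=> s; rewrite mule_ge0 ?lee_fin//; exact: (f30 (y, s)).
  - apply: emeasurable_funM => //; exact: (measurableT_comp mf3 (pair1_measurable y)).
  - apply: emeasurable_funD.
      exact: (measurableT_comp mf1 (pair1_measurable y)).
    exact: (measurableT_comp mf2 (pair1_measurable y)).
  move=> s; rewrite /f1 /f2 /= -!EFinM -EFinD lee_fin mulrA -mulrDl ler_wpM2r//.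
  by have := @amgm _ 1 _ _ ltr01 (h0 y) (h0 s); rewrite invr1 !mul1r.
rewrite ge0_integralD//; last 2 first.
- by move=> y _; exact: integral_ge0.
- by move=> y _; exact: integral_ge0.
by rewrite s1 s2 -ge0_muleDl// -EFinD (_ : c + c = 2 * c)//; ring.
Qed.

(** [energy_le] for the tensor product gives a double integral over pairs of points.
    [convolution_pairing], applied to each pair, rewrites it as [h] against its own Poisson average,
    which [poisson_young] bounds uniformly in [eta]. *)
Lemma tensor_energy_le (eta : R) : 0 < eta -> measurable_fun setT h -> (forall z, 0 <= h z) ->
  (\int[leb2]_z (expk2 eta z * (fenergy phi z * fenergy psi z))%:E <=
   (2 * ((2 * pi) * (2 * pi)))%:E * sqint h)%E.
Proof.
move=> eta0 mh h0; under eq_integral do rewrite -fenergy_tensor.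
apply: (le_trans (energy_le iPhi mTh eta0)).
have p0 z := poisson2_ge0 z eta0; have mp := measurable_poisson2 eta0.
have map : measurable_fun setT (fun z => `|phi z|) by exact: measurableT_comp.
have maq : measurable_fun setT (fun z => `|psi z|) by exact: measurableT_comp.
have absP t : `|Phi t| = `|phi t.1| * `|psi t.2| by exact: normrM.
have pair (k : P -> \bar R) : measurable_fun setT k -> (forall z, 0 <= k z)%E ->
    (\int[leb4]_t (`|Phi t|%:E * k (Th t)) = \int[leb2]_z ((h z)%:E * k z))%E.
  move=> mk k0; symmetry.
  have a0 z : 0 <= `|phi z| by [].
  have b0 z : 0 <= `|psi z| by [].
  apply: etrans (convolution_pairing map maq mk a0 b0 k0 hE) _.
  by apply: eq_integral => t _; rewrite absP.
pose kappa (y : P) := (\int[leb2]_s ((h s)%:E * (poisson2 eta (y - s))%:E))%E.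
apply: le_trans (poisson_young eta0 mh h0).
rewrite -/(kappa) -(pair kappa); last 2 first.
- exact: measurable_poisson_conv.
- by move=> z; apply: integral_ge0 => s _; rewrite mule_ge0 ?lee_fin.
rewrite le_eqVlt; apply/orP; left; apply/eqP; apply: eq_integral => t _.
have mk : measurable_fun setT (fun s : P => (poisson2 eta (Th t - s))%:E).
  apply/measurable_EFinP; exact: (measurableT_comp mp (measurable_plane_sub2 _)).
rewrite /kappa -(pair _ mk); last by move=> z; rewrite lee_fin.
rewrite -ge0_integralZl//.
- by apply: eq_integral => t' _; rewrite -!EFinM mulrA.
- apply: emeasurable_funM; first by apply/measurable_EFinP; exact: measurableT_comp.
  exact: (measurableT_comp mk mTh).
- by move=> t' _; rewrite mule_ge0 ?lee_fin.
Qed.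

End TensorEnergy.

(** * Measurability of continuous functions of two variables *)

Section ContinuousPlane.
Context {R : realType}.
Local Notation TR := (measurableTypeR R).
Local Notation P := (TR * TR)%type.

Lemma cvg_plane (T : Type) (F : set_system T) (FF : Filter F) (f : R * R -> R)
    (g h : T -> R) (a b : R) : {for (a, b), continuous f} ->
  g @ F --> a -> h @ F --> b -> (fun t => f (g t, h t)) @ F --> f (a, b).
Proof.
move=> cf ga hb; apply: (@continuous2_cvg _ _ _ _ F FF g h (fun x y => f (x, y)) a b) => //.
by rewrite (_ : (fun z => f (z.1, z.2)) = f)//; apply/funext => -[].
Qed.

Lemma continuous_snd_section (f : R * R -> R) (c : R) : continuous f ->
  continuous (fun y : R => f (c, y)).
Proof. by move=> cf y; apply: cvg_plane; [exact: cf|exact: cvg_cst|exact: cvg_id]. Qed.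

(** Freezing the first coordinate on cells of width 1 / (n + 1) leaves countably many continuous
    functions of one variable, each of them measurable. Continuity recovers [f] as the grid is
    refined. *)
Lemma measurable_grid (f : R * R -> R) (n : nat) : continuous f ->
  measurable_fun setT (fun z : P => f ((Num.floor (z.1 * n.+1%:R))%:~R / n.+1%:R, z.2)).
Proof.
move=> cf _ B mB; rewrite setTI.
pose A (k : int) := [set z : P | (k%:~R <= z.1 * n.+1%:R) && (z.1 * n.+1%:R < (k + 1)%:~R)] `&`
  [set z : P | B (f (k%:~R / n.+1%:R, z.2))].
rewrite (_ : _ @^-1` _ = \bigcup_i (if unpickle i is Some k then A k else set0)); last first.
  apply/seteqP; split => z /=.
    move=> Bz; exists (pickle (Num.floor (z.1 * n.+1%:R))); first exact: I.
    rewrite pickleK; split; last exact: Bz.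
    by apply/andP; split; [exact: floor_le|exact: floorD1_gt].
  move=> [i _]; case: (unpickle i) => // k [/= /andP[h1 h2] Bz].
  by rewrite (floor_def (m := k)) ?h1.
apply: bigcupT_measurable => i; case: (unpickle i) => // k.
have mz : measurable_fun setT (fun z : P => z.1 * n.+1%:R).
  by apply: measurable_funM.
apply: measurableI.
  have mb : measurable_fun setT (fun z : P => (k%:~R <= z.1 * n.+1%:R) && (z.1 * n.+1%:R < (k + 1)%:~R)).
    by apply: measurable_and; [exact: measurable_fun_ler|exact: measurable_fun_ltr].
  by rewrite -[X in measurable X]setTI; apply: (mb measurableT [set true]).
have mf : measurable_fun setT (fun z : P => f (k%:~R / n.+1%:R, z.2)).
  have mg := continuous_measurable_fun (@continuous_snd_section f (k%:~R / n.+1%:R) cf).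
  exact: (measurableT_comp (f := fun y : TR => f (k%:~R / n.+1%:R, y)) mg measurable_snd).
by rewrite -[X in measurable X]setTI; apply: mf.
Qed.

Lemma cvg_grid (x : R) : (Num.floor (x * n.+1%:R))%:~R / n.+1%:R @[n --> \oo] --> x.
Proof.
apply/cvgrPdist_le => e e0.
have h : (n.+1%:R^-1 : R) @[n --> \oo] --> (0 : R) by exact: cvg_harmonic.
move/cvgr0Pnorm_le : h => /(_ e e0); apply: filterS => n.
rewrite ger0_norm ?invr_ge0//; apply: le_trans.
have n0 : 0 < n.+1%:R :> R by rewrite ltr0n.
rewrite -[X in `|X - _|](mulfK (lt0r_neq0 n0)) -mulrBl normrM [X in _ * X]gtr0_norm ?invr_gt0//.
rewrite ler_piMl ?invr_ge0//.
have h1 := floor_le (x * n.+1%:R); have h2 := floorD1_gt (x * n.+1%:R).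
rewrite ger0_norm ?subr_ge0// lerBlDr addrC.
by move: h2; rewrite intrD => /ltW.
Qed.

Lemma measurable_continuous_plane (f : R * R -> R) : continuous f ->
  measurable_fun setT (f : P -> R).
Proof.
move=> cf; apply: (measurable_fun_cvg (h := fun n (z : P) =>
  f ((Num.floor (z.1 * n.+1%:R))%:~R / n.+1%:R, z.2))).
  by move=> n; exact: measurable_grid.
move=> [x y] _; apply: cvg_plane; [exact: cf|exact: cvg_grid|exact: cvg_cst].
Qed.

End ContinuousPlane.

(** * Decaying functions and their Poisson averages *)

Section TameFunctions.
Context {R : realType}.
Local Notation TR := (measurableTypeR R).
Local Notation P := (TR * TR)%type.

(** What the argument retains of a Schwartz function: continuity, for the pointwise convergence of
    Poisson averages, and decay, for integrability. The class is stable under differences. *)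
Definition tame (f : R * R -> R) : Prop := continuous f /\
  exists M, forall z, `|f z| * ((1 + z.1 ^+ 2) * (1 + z.2 ^+ 2)) <= M.

Lemma schwartz_tame f : schwartz_real f -> tame f.
Proof.
move=> [df bf]; split; first by move=> z; exact: (differentiable_continuous (df 0 0 z)).
have [M0 h0] := bf 0 0 0 0; have [M1 h1] := bf 0 0 2 0.
have [M2 h2] := bf 0 0 0 2; have [M3 h3] := bf 0 0 2 2.
exists (M0 + M1 + M2 + M3) => z.
have e3 : `|z.1 ^+ 2 * z.2 ^+ 2 * f z| = z.1 ^+ 2 * z.2 ^+ 2 * `|f z|.
  by rewrite normrM (ger0_norm (mulr_ge0 (sqr_ge0 _) (sqr_ge0 _))).
have e1 : `|z.1 ^+ 2 * f z| = z.1 ^+ 2 * `|f z| by rewrite normrM (ger0_norm (sqr_ge0 _)).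
have e2 : `|z.2 ^+ 2 * f z| = z.2 ^+ 2 * `|f z| by rewrite normrM (ger0_norm (sqr_ge0 _)).
have := h0 z; have := h1 z; have := h2 z; have := h3 z.
rewrite /partial /= !expr0 !mul1r !mulr1 e1 e2 e3.
move: `|f z| (z.1 ^+ 2) (z.2 ^+ 2) => a x y l3 l2 l1 l0.
have -> : a * ((1 + x) * (1 + y)) = a + x * a + y * a + x * y * a by ring.
by apply: lerD => //; apply: lerD => //; exact: lerD.
Qed.

Lemma tame_measurable f : tame f -> measurable_fun setT (f : P -> R).
Proof. by case=> cf _; exact: measurable_continuous_plane. Qed.

Lemma tameB f g : tame f -> tame g -> tame (fun z => f z - g z).
Proof.
case=> cf [M hM] [cg [N hN]]; split.
  by move=> z; apply: (@continuousB R R^o _ f g); [exact: cf|exact: cg].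
exists (M + N) => z; apply: le_trans (lerD (hM z) (hN z)).
rewrite -mulrDl ler_wpM2r ?mulr_ge0 ?addr_ge0 ?sqr_ge0//.
exact: ler_normB.
Qed.

Lemma tame_le f : tame f -> exists2 M, 0 <= M &
  (forall z, `|f z| <= M) /\ (forall z : P, `|f z| <= M * poisson2 1 z).
Proof.
case=> _ [M hM].
have w1 z : 1 <= (1 + z.1 ^+ 2) * (1 + z.2 ^+ 2) :> R.
  by rewrite -[leLHS]mulr1 ler_pM// lerDl sqr_ge0.
have fM z : `|f z| <= M by apply: le_trans (hM z); rewrite ler_peMr.
have M0 : 0 <= M by rewrite (le_trans _ (fM (0, 0))).
exists M => //; split => // z.
rewrite /poisson2 /poisson expr1n !mulr1.
set a := 1 + z.1 ^+ 2; set b := 1 + z.2 ^+ 2.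
have a0 : 0 < a by rewrite ltr_pwDl// sqr_ge0.
have b0 : 0 < b by rewrite ltr_pwDl// sqr_ge0.
have ab0 : 0 < a * b by rewrite mulr_gt0.
have -> : M * (2 / a * (2 / b)) = 4 * M / (a * b).
  by field; rewrite !gt_eqF.
rewrite ler_pdivlMr//; apply: (le_trans (hM z)).
by rewrite ler_peMl// ler1n.
Qed.

Lemma tame_integrable f : tame f -> (@leb2 R).-integrable setT (EFin \o (f : P -> R)).
Proof.
move=> tf; have [M M0 [_ hM]] := tame_le tf.
apply: (integrable_le (tame_measurable tf) hM).
exact: (integrableZl measurableT _ (integrable_poisson2 ltr01)).
Qed.

(** Poisson average with the kernel left unnormalized, hence the factor (2 pi)^2 in its limit. *)
Definition smooth (d : R) (f : P -> R) (z : P) : R := \int[leb2]_y (f y * poisson2 d (z - y)).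

Lemma poisson_tail (d r y : R) : 0 < d -> 0 < r -> r <= `|y| ->
  poisson d y <= d * (1 + r ^- 2) * poisson 1 y.
Proof.
move=> d0 r0 ry; rewrite /poisson expr1n mulr1.
have ry2 : r ^+ 2 <= y ^+ 2.
  by rewrite -(real_normK (num_real y)) lerXn2r ?nnegrE// ltW.
have r20 : 0 < r ^+ 2 by rewrite exprn_gt0.
have y20 : 0 < y ^+ 2 by exact: lt_le_trans ry2.
have d20 : 0 < d ^+ 2 by rewrite exprn_gt0.
have p0 : 0 < d ^+ 2 + y ^+ 2 by rewrite addr_gt0.
have q0 : 0 < 1 + y ^+ 2 by rewrite addr_gt0.
have -> : d * (1 + r ^- 2) * (2 / (1 + y ^+ 2)) = 2 * d * ((1 + r ^- 2) / (1 + y ^+ 2)).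
  by field; rewrite !gt_eqF.
rewrite ler_pM2l ?mulr_gt0// ler_pdivlMr// mulrC ler_pdivrMr//.
have h : 1 <= r ^- 2 * y ^+ 2.
  by rewrite -(@mulVf _ (r ^+ 2)) ?gt_eqF// ler_wpM2l// invr_ge0 ltW.
have : 0 <= r ^- 2 * d ^+ 2 by rewrite mulr_ge0 ?sqr_ge0// invr_ge0 ltW.
rewrite mulrDl mul1r mulrDr.
move: (r ^- 2 * y ^+ 2) (r ^- 2 * d ^+ 2) h => A B; lra.
Qed.

(** Dominates [poisson2 d] outside a square about the origin, up to a factor of order [d]: the
    kernel in the large coordinate is replaced by the one of width 1. Its integral is the same for
    every [d]. *)
Definition poisson_far (d : R) (y : P) : R :=
  poisson 1 y.1 * poisson d y.2 + poisson d y.1 * poisson 1 y.2.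

Lemma poisson_far_ge0 d y : 0 < d -> 0 <= poisson_far d y.
Proof. by move=> d0; rewrite addr_ge0// mulr_ge0// poisson_ge0. Qed.

Lemma measurable_poissonM (c d : R) : 0 < c -> 0 < d ->
  measurable_fun setT (fun y : P => poisson c y.1 * poisson d y.2).
Proof.
move=> c0 d0; apply: measurable_funM.
  exact: (measurableT_comp (measurable_poisson c0)).
exact: (measurableT_comp (measurable_poisson d0)).
Qed.

Lemma measurable_poisson_far d : 0 < d -> measurable_fun setT (poisson_far d).
Proof. by move=> d0; apply: measurable_funD; exact: measurable_poissonM. Qed.

Let c4 : R := (2 * pi) * (2 * pi).

Lemma integral_poissonM (c d : R) : 0 < c -> 0 < d ->
  (\int[leb2]_y (poisson c y.1 * poisson d y.2)%:E = c4%:E)%E.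
Proof.
move=> c0 d0; have h1 := integral_poisson c0; have h2 := integral_poisson d0.
apply: (integral_tensor (measurable_poisson c0) (measurable_poisson d0)) => //;
by move=> x; exact: poisson_ge0.
Qed.

Lemma integral_poisson_far d : 0 < d -> (\int[leb2]_y (poisson_far d y)%:E = (2 * c4)%:E)%E.
Proof.
move=> d0; under eq_integral do rewrite EFinD.
rewrite ge0_integralD//; first last.
- by apply/measurable_EFinP; exact: measurable_poissonM.
- by move=> x _; rewrite lee_fin mulr_ge0// poisson_ge0.
- by apply/measurable_EFinP; exact: measurable_poissonM.
- by move=> x _; rewrite lee_fin mulr_ge0// poisson_ge0.
by rewrite !integral_poissonM// -EFinD mulr2n mulrDl mul1r.
Qed.

(** Within the square of half-side [r] the oscillation of [f] is at most [e]; outside it is at most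
    2 M, and [poisson_far] shows that the kernel has mass of order [d] there. *)
Lemma smooth_dist (f : R * R -> R) (M e r d : R) (z : P) : tame f -> 0 <= M -> 0 <= e -> 0 < r -> 0 < d ->
  (forall y, `|f y| <= M) ->
  (forall y : P, `|(z - y).1| < r -> `|(z - y).2| < r -> `|f z - f y| <= e) ->
  `|smooth d f z - c4 * f z| <= c4 * e + 4 * c4 * M * (1 + r ^- 2) * d.
Proof.
move=> tf M0 e0 r0 d0 hM near.
have mP : measurable_fun setT (fun y : P => poisson2 d (z - y)).
  exact: (measurableT_comp (measurable_poisson2 d0) (measurable_plane_sub2 z)).
have iP : (@leb2 R).-integrable setT (EFin \o (fun y : P => poisson2 d (z - y))).
  apply/integrableP; split; first exact/measurable_EFinP.
  under eq_integral do rewrite /= ger0_norm ?poisson2_ge0//.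
  rewrite (plane_sub (f := fun z => (poisson2 d z)%:E)) ?integral_poisson2 ?ltry//.
    by apply/measurable_EFinP; exact: measurable_poisson2.
  by move=> y; rewrite lee_fin poisson2_ge0.
have mf := tame_measurable tf.
have iPf : (@leb2 R).-integrable setT (EFin \o (fun y : P => f y * poisson2 d (z - y))).
  apply: (@integrable_le _ _ _ _ _ (fun y : P => M * poisson2 d (z - y))).
  - exact: measurable_funM.
  - by move=> y; rewrite normrM (ger0_norm (poisson2_ge0 _ d0)) ler_wpM2r ?poisson2_ge0.
  - exact: (integrableZl measurableT _ iP).
have c4E : c4 = \int[leb2]_y poisson2 d (z - y).
  rewrite /Rintegral (plane_sub (f := fun z => (poisson2 d z)%:E)) ?integral_poisson2//.
    by apply/measurable_EFinP; exact: measurable_poisson2.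
  by move=> y; rewrite lee_fin poisson2_ge0.
rewrite [X in _ - X * _]c4E -RintegralZr// -RintegralB//; last first.
  exact: (integrableZr measurableT _ iP).
pose g (y : P) := e * poisson2 d y + 2 * M * (1 + r ^- 2) * d * poisson_far d y.
have k0 : 0 <= 2 * M * (1 + r ^- 2) * d.
  by rewrite !mulr_ge0 ?(ltW d0)// addr_ge0// invr_ge0 sqr_ge0.
have g1 (y : P) : 0 <= e * poisson2 d y by rewrite mulr_ge0 ?poisson2_ge0.
have g2 (y : P) : 0 <= 2 * M * (1 + r ^- 2) * d * poisson_far d y.
  by rewrite mulr_ge0 ?poisson_far_ge0.
have m1 : measurable_fun setT (fun y : P => (e * poisson2 d y)%:E).
  by apply/measurable_EFinP; apply: measurable_funM => //; exact: measurable_poisson2.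
have m2 : measurable_fun setT (fun y : P => (2 * M * (1 + r ^- 2) * d * poisson_far d y)%:E).
  by apply/measurable_EFinP; apply: measurable_funM => //; exact: measurable_poisson_far.
have mg : measurable_fun setT (fun y => (g y)%:E).
  by rewrite (_ : (fun y => (g y)%:E) = (fun y => ((e * poisson2 d y)%:E + (2 * M * (1 + r ^- 2) * d * poisson_far d y)%:E)%E)) //; exact: emeasurable_funD.
rewrite -lee_fin; apply: (le_trans (abs_Rintegral_le _ _)).
  by apply: measurable_funB; apply: measurable_funM.
apply: (@le_trans _ _ (\int[leb2]_y (g (z - y))%:E)%E).
  apply: ge0_le_integralT.
  - by move=> y; rewrite lee_fin.
  - apply/measurable_EFinP; apply: measurableT_comp => //.
    by apply: measurable_funB; apply: measurable_funM.
  - exact: (measurableT_comp mg (measurable_plane_sub2 z)).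
  move=> y; rewrite lee_fin mulrC -mulrBr normrM (ger0_norm (poisson2_ge0 _ d0)).
  have P0 := poisson2_ge0 (z - y) d0.
  have far : `|f y - f z| <= 2 * M.
    by rewrite (le_trans (ler_normB _ _))// mulr_natl mulr2n lerD.
  have bound : poisson2 d (z - y) <= (1 + r ^- 2) * d * poisson_far d (z - y) ->
      poisson2 d (z - y) * `|f y - f z| <= g (z - y).
    move=> hp; apply: (@le_trans _ _ (2 * M * (1 + r ^- 2) * d * poisson_far d (z - y))); last by rewrite lerDr.
    apply: (le_trans (ler_pM _ _ hp far)) => //.
    by rewrite le_eqVlt; apply/orP; left; apply/eqP; ring.
  have pf0 (x : R) (h : R) : 0 < h -> 0 <= poisson h x by exact: poisson_ge0.
  have rr : 0 <= (1 + r ^- 2) * d by rewrite mulr_ge0 ?(ltW d0)// addr_ge0// invr_ge0 sqr_ge0.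
  have [h1|h1] := ltP `|(z - y).1| r; last first.
    apply: bound; rewrite /poisson_far mulrDr; apply: ler_wpDr.
      by rewrite mulr_ge0// mulr_ge0// pf0.
    by rewrite /poisson2 [leRHS]mulrA ler_wpM2r ?pf0// [X in X * _]mulrC poisson_tail.
  have [h2|h2] := ltP `|(z - y).2| r; last first.
    apply: bound; rewrite /poisson_far mulrDr; apply: ler_wpDl.
      by rewrite mulr_ge0// mulr_ge0// pf0.
    by rewrite /poisson2 [leRHS]mulrCA ler_wpM2l ?pf0// [X in X * _]mulrC poisson_tail.
  apply: (@le_trans _ _ (e * poisson2 d (z - y))); last by rewrite lerDl.
  by rewrite mulrC ler_wpM2r// distrC near.
rewrite (plane_sub (f := fun y => (g y)%:E))//; last by move=> y; rewrite lee_fin addr_ge0.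
under eq_integral do rewrite EFinD.
rewrite ge0_integralD//; last 2 first.
- by move=> y _; rewrite lee_fin.
- by move=> y _; rewrite lee_fin.
under eq_integral do rewrite EFinM.
rewrite ge0_integralZl//; last 2 first.
- by apply/measurable_EFinP; exact: measurable_poisson2.
- by move=> y _; rewrite lee_fin poisson2_ge0.
under [X in (_ + X)%E]eq_integral do rewrite EFinM.
rewrite ge0_integralZl//; last 2 first.
- by apply/measurable_EFinP; exact: measurable_poisson_far.
- by move=> y _; rewrite lee_fin poisson_far_ge0.
rewrite integral_poisson2// integral_poisson_far// -!EFinM -EFinD lee_fin -/c4.
by rewrite le_eqVlt; apply/orP; left; apply/eqP; ring.
Qed.

Lemma smooth_cvg (f : R * R -> R) (z : P) : tame f ->
  smooth (n.+1%:R^-1) f z @[n --> \oo] --> c4 * f z.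
Proof.
move=> tf; have [M M0 [hM _]] := tame_le tf.
have c40 : 0 < c4 by rewrite !mulr_gt0// pi_gt0.
apply/cvgrPdist_le => e e0.
pose e1 := e / (2 * c4).
have e10 : 0 < e1 by rewrite divr_gt0// mulr_gt0.
have [cf _] := tf.
have /cvgrPdist_le /(_ e1 e10) /nbhs_ballP [r /= r0 hr] := cf z.
have k0 : 0 <= 4 * c4 * M * (1 + r ^- 2).
  have rp : 0 <= 1 + r ^- 2 by rewrite addr_ge0// invr_ge0 sqr_ge0.
  exact: (mulr_ge0 (mulr_ge0 (mulr_ge0 (ler0n R 4) (ltW c40)) M0) rp).
(* The added 1 keeps the denominator positive when [M = 0]. *)
pose e2 := e / (2 * (4 * c4 * M * (1 + r ^- 2) + 1)).
have k1 : 0 < 4 * c4 * M * (1 + r ^- 2) + 1 by rewrite ltr_wpDl.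
have e20 : 0 < e2 by rewrite divr_gt0// mulr_gt0.
have h : (n.+1%:R^-1 : R) @[n --> \oo] --> (0 : R) by exact: cvg_harmonic.
move/cvgr0Pnorm_le : h => /(_ e2 e20); apply: filterS => n.
rewrite ger0_norm ?invr_ge0// => hn; rewrite distrC.
have nr (y : P) : `|(z - y).1| < r -> `|(z - y).2| < r -> `|f z - f y| <= e1.
  by move=> a1 a2; apply: (hr y); split.
have n0 : 0 < n.+1%:R^-1 :> R by rewrite invr_gt0 ltr0n.
apply: (le_trans (smooth_dist tf M0 (ltW e10) r0 n0 hM nr)).
have -> : c4 * e1 = e / 2 by rewrite /e1; field; rewrite gt_eqF.
apply: (@le_trans _ _ (e / 2 + (4 * c4 * M * (1 + r ^- 2) + 1) * e2)).
  rewrite lerD2l; apply: ler_pM => //; last by rewrite lerDl.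
rewrite (_ : (_ + 1) * e2 = e / 2); last first.
  rewrite /e2; move: (4 * c4 * M * (1 + r ^- 2) + 1) k1 => k k1.
  by field; rewrite gt_eqF.
by rewrite -splitr.
Qed.

End TameFunctions.

(** * Inversion of the cut-off Fourier transform *)

Section Inversion.
Context {R : realType}.
Local Notation TR := (measurableTypeR R).
Local Notation P := (TR * TR)%type.
Implicit Types phi psi a b : P -> R.

Lemma dotC (y z : P) : dot y z = dot z y.
Proof. by rewrite /dot mulrC [X in _ + X]mulrC. Qed.

Lemma fcosN phi z : (@leb2 R).-integrable setT (EFin \o phi) ->
  fcos (fun y => - phi y) z = - fcos phi z.
Proof.
move=> iphi; rewrite /fcos /cosint -mulN1r -RintegralZl//.
  by apply: eq_Rintegral => y _; rewrite mulN1r mulNr.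
by apply: (integrable_phi_trig iphi (@measurable_id _ _ _)); [exact: continuous_cos|exact: cos_max].
Qed.

Lemma fsinN phi z : (@leb2 R).-integrable setT (EFin \o phi) ->
  fsin (fun y => - phi y) z = - fsin phi z.
Proof.
move=> iphi; rewrite /fsin /sinint -mulN1r -RintegralZl//.
  by apply: eq_Rintegral => y _; rewrite mulN1r mulNr.
by apply: (integrable_phi_trig iphi (@measurable_id _ _ _)); [exact: continuous_sin|exact: sin_max].
Qed.

Definition bounded_measurable phi : Prop :=
  measurable_fun setT phi /\ exists2 K, 0 <= K & forall z, `|phi z| <= K.

Definition cutoff (d : R) phi (z : P) : R := expk2 d z * phi z.

Lemma cutoff_integrable d phi : 0 < d -> bounded_measurable phi ->
  (@leb2 R).-integrable setT (EFin \o cutoff d phi).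
Proof.
move=> d0 [mphi [K K0 hK]].
apply: (@integrable_le _ _ _ _ _ (fun z => K * expk2 d z)).
- by apply: measurable_funM => //; exact: measurable_expk2.
- by move=> z; rewrite normrM (ger0_norm (expk2_ge0 _ _)) mulrC ler_wpM2r// expk2_ge0.
- exact: (integrableZl measurableT _ (integrable_expk2 d0)).
Qed.

Lemma bounded_fcos phi : (@leb2 R).-integrable setT (EFin \o phi) -> bounded_measurable (fcos phi).
Proof.
move=> iphi; split; first exact: (measurable_cosint iphi (@measurable_id _ _ _)).
exists (\int[leb2]_z `|phi z|); first by apply: Rintegral_ge0.
by move=> z; apply: cosint_le => //; exact: measurable_id.
Qed.

Lemma bounded_fsin phi : (@leb2 R).-integrable setT (EFin \o phi) -> bounded_measurable (fsin phi).
Proof.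
move=> iphi; split; first exact: (measurable_sinint iphi (@measurable_id _ _ _)).
exists (\int[leb2]_z `|phi z|); first by apply: Rintegral_ge0.
by move=> z; apply: sinint_le => //; exact: measurable_id.
Qed.

Lemma bounded_measurableD phi psi : bounded_measurable phi -> bounded_measurable psi ->
  bounded_measurable (fun z => phi z + psi z).
Proof.
move=> [m1 [K K0 h1]] [m2 [L L0 h2]]; split; first exact: measurable_funD.
by exists (K + L) => [|z]; [exact: addr_ge0|rewrite (le_trans (ler_normD _ _))// lerD].
Qed.

Lemma bounded_measurableN phi : bounded_measurable phi -> bounded_measurable (fun z => - phi z).
Proof.
move=> [m1 [K K0 h1]]; split; first exact: measurableT_comp.
by exists K => // z; rewrite normrN.
Qed.

(* Real and imaginary parts of the Fourier transform of [a + i b]. *)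
Definition hatRe a b (z : P) : R := fcos a z + fsin b z.
Definition hatIm a b (z : P) : R := fcos b z - fsin a z.

Section integrable_pair.
Variables (a b : P -> R).
Hypotheses (ia : (@leb2 R).-integrable setT (EFin \o a)).
Hypotheses (ib : (@leb2 R).-integrable setT (EFin \o b)).

Lemma bounded_hatRe : bounded_measurable (hatRe a b).
Proof. by apply: bounded_measurableD; [exact: bounded_fcos|exact: bounded_fsin]. Qed.

Lemma bounded_hatIm : bounded_measurable (hatIm a b).
Proof.
by apply: bounded_measurableD; [exact: bounded_fcos|apply: bounded_measurableN; exact: bounded_fsin].
Qed.

Let ma : measurable_fun setT a.
Proof. by have mE := measurable_int _ ia; apply/measurable_EFinP; exact: mE. Qed.
Let mb : measurable_fun setT b.
Proof. by have mE := measurable_int _ ib; apply/measurable_EFinP; exact: mE. Qed.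

Let trigi phi (f : R -> R) z : (@leb2 R).-integrable setT (EFin \o phi) ->
  continuous f -> (forall x, `|f x| <= 1) ->
  (@leb2 R).-integrable setT (EFin \o (fun t => phi t * f (dot z t))).
Proof. by move=> iphi; apply: integrable_phi_trig => //; exact: measurable_id. Qed.

Variable d : R.
Hypothesis d0 : 0 < d.

(** The left side is the real part of the inverse transform of the cut-off transform of a + i b.
    After the exchange of integrals the cutoff meets the cosine and the sine of (z - y) . x: the
    cosine gives the Poisson kernel and the sine integrates to 0. *)
Lemma fourier_inversion z :
  fcos (cutoff d (hatRe a b)) z - fsin (cutoff d (hatIm a b)) z = smooth d a z.
Proof.
have ip := cutoff_integrable d0 bounded_hatRe.
have iq := cutoff_integrable d0 bounded_hatIm.
have cc := @continuous_cos R; have cs := @continuous_sin R.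
have bc := @cos_max R; have bs := @sin_max R.
rewrite /fcos /cosint /fsin /sinint -RintegralB//; last 2 first.
- exact: trigi.
- exact: trigi.
pose F (zy : P * P) := expk2 d zy.1 * (a zy.2 * cos (dot z zy.1 - dot zy.1 zy.2) -
  b zy.2 * sin (dot z zy.1 - dot zy.1 zy.2)).
have md : measurable_fun setT (fun zy : P * P => dot z zy.1 - dot zy.1 zy.2).
  apply: measurable_funB; apply: measurable_dot => //; exact: measurable_cst.
have mF : measurable_fun setT F.
  apply: measurable_funM; first exact: (measurableT_comp (measurable_expk2 d)).
  apply: measurable_funB; apply: measurable_funM.
  - exact: (measurableT_comp ma measurable_snd).
  - exact: measurable_cosT.
  - exact: (measurableT_comp mb measurable_snd).
  - exact: measurable_sinT.
rewrite (eq_Rintegral _ _ (g := fun x : P => \int[leb2]_y F (x, y))); last first.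
  move=> x _; rewrite /F /cutoff /hatRe /hatIm /fcos /fsin /cosint /sinint /=.
  set Ca := \int[_]_t (a t * cos _); set Sb := \int[_]_t (b t * sin _).
  set Cb := \int[_]_t (b t * cos _); set Sa := \int[_]_t (a t * sin _).
  transitivity (\int[leb2]_y
    (((expk2 d x * cos (dot z x)) * (a y * cos (dot x y)) +
      (expk2 d x * cos (dot z x)) * (b y * sin (dot x y))) +
    ((- (expk2 d x * sin (dot z x))) * (b y * cos (dot x y)) +
      (expk2 d x * sin (dot z x)) * (a y * sin (dot x y))))).
    have j1 := integrableZl measurableT (expk2 d x * cos (dot z x)) (trigi x ia cc bc).
    have j2 := integrableZl measurableT (expk2 d x * cos (dot z x)) (trigi x ib cs bs).
    have j3 := integrableZl measurableT (- (expk2 d x * sin (dot z x))) (trigi x ib cc bc).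
    have j4 := integrableZl measurableT (expk2 d x * sin (dot z x)) (trigi x ia cs bs).
    rewrite RintegralD//; last 2 first.
    - exact: (integrableD measurableT j1 j2).
    - exact: (integrableD measurableT j3 j4).
    rewrite RintegralD// RintegralD//.
    rewrite (RintegralZl _ measurableT (trigi x ia cc bc)).
    rewrite (RintegralZl _ measurableT (trigi x ib cs bs)).
    rewrite (RintegralZl _ measurableT (trigi x ib cc bc)).
    rewrite (RintegralZl _ measurableT (trigi x ia cs bs)).
    by rewrite -/Ca -/Sb -/Cb -/Sa; ring.
  by apply: eq_Rintegral => y _; rewrite cosB sinB; ring.
rewrite (Rintegral_swap (m1 := leb2) (m2 := leb2) (a := fun x => expk2 d x) (b := fun y => `|a y| + `|b y|) mF).
- apply: eq_Rintegral => y _; rewrite /F /=.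
  have im (f : R -> R) : continuous f -> (forall x, `|f x| <= 1) ->
    (@leb2 R).-integrable setT (EFin \o (fun t => expk2 d t * f (dot (z - y) t))).
    by move=> cf f1; exact: (trigi (z - y) (integrable_expk2 d0) cf f1).
  rewrite (eq_Rintegral _ _ (g := fun x : P => a y * (expk2 d x * cos (dot (z - y) x)) -
     b y * (expk2 d x * sin (dot (z - y) x)))); last first.
    move=> x _; rewrite (_ : dot z x - dot x y = dot (z - y) x); first by ring.
    by rewrite (dotC x y) /dot /=; ring.
  rewrite RintegralB//; last 2 first.
  - exact: (integrableZl measurableT _ (im _ cc bc)).
  - exact: (integrableZl measurableT _ (im _ cs bs)).
  rewrite RintegralZl ?(im _ cc bc)// RintegralZl ?(im _ cs bs)//.
  by rewrite Rintegral_expk2_cos// Rintegral_expk2_sin// mulr0 subr0.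
- move=> x y; rewrite /F /= normrM (ger0_norm (expk2_ge0 _ _)).
  rewrite ler_wpM2l ?expk2_ge0// (le_trans (ler_normB _ _))// !normrM.
  by apply: lerD; rewrite ler_piMr.
- exact: integrable_expk2.
- exact: (integrableD measurableT (integrable_abse ia) (integrable_abse ib)).
Qed.

End integrable_pair.

Lemma hatReN a b : (@leb2 R).-integrable setT (EFin \o a) ->
  hatRe b (fun z => - a z) = hatIm a b.
Proof. by move=> ia; apply/funext => z; rewrite /hatRe /hatIm fsinN. Qed.

Lemma hatImN a b : (@leb2 R).-integrable setT (EFin \o a) ->
  hatIm b (fun z => - a z) = (fun z => - hatRe a b z).
Proof. by move=> ia; apply/funext => z; rewrite /hatRe /hatIm fcosN// opprD. Qed.

(** The identity for the real part, applied to b - i a, which is -i times a + i b. *)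
Lemma fourier_inversion_im a b d z : 0 < d -> (@leb2 R).-integrable setT (EFin \o a) ->
  (@leb2 R).-integrable setT (EFin \o b) ->
  fcos (cutoff d (hatIm a b)) z + fsin (cutoff d (hatRe a b)) z = smooth d b z.
Proof.
move=> d0 ia ib; have iNa : (@leb2 R).-integrable setT (EFin \o (fun z => - a z)).
  exact: (integrableN ia).
rewrite -(fourier_inversion ib iNa d0) hatReN// hatImN//.
rewrite (_ : cutoff d (fun z => - hatRe a b z) = fun z => - cutoff d (hatRe a b) z); last first.
  by apply/funext => y; rewrite /cutoff mulrN.
by rewrite fsinN ?opprK//; apply: cutoff_integrable => //; exact: bounded_hatRe.
Qed.

(** The complex transform is separated into its real and imaginary parts, to which the energy
    estimate for real functions applies; this costs a factor 2. *)
Lemma smooth_sqr_le a b d z : 0 < d -> (@leb2 R).-integrable setT (EFin \o a) ->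
  (@leb2 R).-integrable setT (EFin \o b) ->
  smooth d a z ^+ 2 + smooth d b z ^+ 2 <=
  2 * (fenergy (cutoff d (hatRe a b)) z + fenergy (cutoff d (hatIm a b)) z).
Proof.
move=> d0 ia ib.
rewrite -(fourier_inversion ia ib d0) -(fourier_inversion_im z d0 ia ib) /fenergy.
move: (fcos _ z) (fsin _ z) (fcos _ z) (fsin _ z) => c s c' s'.
by have := sqr_ge0 (c' + s'); have := sqr_ge0 (c - s); nra.
Qed.

End Inversion.

(** * The product estimate at a fixed cutoff *)

Section TamePair.
Context {R : realType}.
Local Notation TR := (measurableTypeR R).
Local Notation P := (TR * TR)%type.
Local Notation c4 := ((2 * pi) * (2 * pi) : R).

Lemma le_sqint (f g : P -> R) : measurable_fun setT f -> measurable_fun setT g ->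
  (forall z, `|f z| <= `|g z|) -> (sqint f <= sqint g)%E.
Proof.
move=> mf mg fg; apply: ge0_le_integralT.
- by move=> z; rewrite lee_fin sqr_ge0.
- exact: measurable_sqr.
- exact: measurable_sqr.
- move=> z; rewrite lee_fin -(real_normK (num_real (f z))) -(real_normK (num_real (g z))).
  by rewrite lerXn2r ?nnegrE.
Qed.

Lemma measurable_conv_kernel (f g : P -> R) : measurable_fun setT f -> measurable_fun setT g ->
  measurable_fun setT (fun z : P * P => f z.2 * g (z.1 - z.2)).
Proof.
move=> mf mg; apply: measurable_funM; first exact: (measurableT_comp mf measurable_snd).
apply: (measurableT_comp mg); apply/measurable_fun_pair => /=; apply: measurable_funB => //;
exact: measurableT_comp.
Qed.

Lemma integral_convolution (f g h : P -> R) :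
  measurable_fun setT f -> measurable_fun setT g ->
  (forall z, 0 <= f z) -> (forall z, 0 <= g z) ->
  (forall z, (h z)%:E = \int[leb2]_x (f x * g (z - x))%:E)%E ->
  (\int[leb2]_z (h z)%:E = \int[leb2]_x (f x)%:E * \int[leb2]_x (g x)%:E)%E.
Proof.
move=> mf mg f0 g0 hE.
have mk : measurable_fun setT (fun z : P * P => (f z.2 * g (z.1 - z.2))%:E).
  by apply/measurable_EFinP; exact: measurable_conv_kernel.
have k0 (z : P * P) : (0 <= (f z.2 * g (z.1 - z.2))%:E)%E by rewrite lee_fin mulr_ge0.
have mfE : measurable_fun setT (fun x => (f x)%:E) by exact/measurable_EFinP.
have mgE : measurable_fun setT (fun x => (g x)%:E) by exact/measurable_EFinP.
have ig0 : (0 <= \int[leb2]_x (g x)%:E)%E by apply: integral_ge0 => x _; rewrite lee_fin.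
transitivity (\int[leb2]_z \int[leb2]_x (f x * g (z - x))%:E)%E.
  by apply: eq_integral => z _; rewrite hE.
transitivity (\int[leb2]_x \int[leb2]_z (f x * g (z - x))%:E)%E.
  exact: (plane2_tonelli mk k0).
transitivity (\int[leb2]_x ((f x)%:E * \int[leb2]_z (g z)%:E))%E; last first.
  by apply: ge0_integralZr => // x _; rewrite lee_fin.
apply: eq_integral => x _.
transitivity (\int[leb2]_z ((f x)%:E * (g (z - x)%R)%:E))%E.
  by apply: eq_integral => z _; rewrite EFinM.
rewrite ge0_integralZl ?lee_fin//.
- congr (_ * _)%E; apply: (plane_shift (f := fun z => (g z)%:E)) => //.
- apply/measurable_EFinP; apply: (measurableT_comp mg).
  by apply/measurable_fun_pair => /=; exact: measurable_funB.
- by move=> z _; rewrite lee_fin.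
Qed.

Variables (w1 w2 : P -> R) (C : R).
Hypotheses (mw1 : measurable_fun setT w1) (mw2 : measurable_fun setT w2).
Hypothesis C0 : 0 <= C.
Hypothesis bil : bilinear_bound w1 w2 C.

Let le_weighted (w phi : P -> R) (d : R) : 0 < d -> measurable_fun setT w -> measurable_fun setT phi ->
  (sqint (fun z => w z * `|cutoff d phi z|)%R <= sqint (fun z => w z * phi z)%R)%E.
Proof.
move=> d0 mw mphi; apply: le_sqint.
- apply: measurable_funM => //; apply: measurableT_comp => //.
  by apply: measurable_funM => //; exact: measurable_expk2.
- exact: measurable_funM.
- move=> z; rewrite normrM normr_id [leRHS]normrM ler_wpM2l// /cutoff normrM.
  by rewrite ler_piMl// ger0_norm ?expk2_ge0// expk2_le1// ltW.
Qed.

Section cutoff_pair.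
Variables (phi psi : P -> R) (d : R).
Hypotheses (bphi : bounded_measurable phi) (bpsi : bounded_measurable psi) (d0 : 0 < d).

Let A (z : P) := `|cutoff d phi z|.
Let B (z : P) := `|cutoff d psi z|.
Let h (z : P) : R := \int[leb2]_x (A x * B (z - x)).

Let A0 z : 0 <= A z. Proof. exact: normr_ge0. Qed.
Let B0 z : 0 <= B z. Proof. exact: normr_ge0. Qed.

Let mA : measurable_fun setT A.
Proof.
have [m _] := bphi; apply: measurableT_comp => //.
by apply: measurable_funM => //; exact: measurable_expk2.
Qed.
Let mB : measurable_fun setT B.
Proof.
have [m _] := bpsi; apply: measurableT_comp => //.
by apply: measurable_funM => //; exact: measurable_expk2.
Qed.

Let mAB : measurable_fun setT (fun z : P * P => A z.2 * B (z.1 - z.2)).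
Proof. exact: measurable_conv_kernel. Qed.

Let mh : measurable_fun setT h.
Proof. exact: (measurable_Rintegral_param leb2 mAB). Qed.

Let cutoff_le (xi : P -> R) (K : R) (z : P) : (forall z, `|xi z| <= K) ->
  `|cutoff d xi z| <= K * expk2 d z.
Proof.
by move=> hK; rewrite normrM (ger0_norm (expk2_ge0 _ _)) mulrC ler_wpM2r// expk2_ge0.
Qed.

Let iA : (@leb2 R).-integrable setT (EFin \o A).
Proof. exact: (integrable_abse (cutoff_integrable d0 bphi)). Qed.
Let iB : (@leb2 R).-integrable setT (EFin \o B).
Proof. exact: (integrable_abse (cutoff_integrable d0 bpsi)). Qed.

Let iAB z : (@leb2 R).-integrable setT (EFin \o (fun x => A x * B (z - x))).
Proof.
have [_ [K K0 hK]] := bpsi.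
apply: (@integrable_le _ _ _ _ _ (fun x => K * A x)).
- exact: (measurableT_comp mAB (pair1_measurable z)).
- move=> x; rewrite normrM !normr_id mulrC ler_wpM2r//.
  apply: (le_trans (cutoff_le _ hK)); rewrite ler_piMr//.
  by apply: expk2_le1; exact: ltW.
- exact: (integrableZl measurableT _ iA).
Qed.

Let hE z : (h z)%:E = (\int[leb2]_x (A x * B (z - x))%:E)%E.
Proof. by rewrite /h /Rintegral fineK//; apply: integrable_fin_num => //; exact: iAB. Qed.

Let h0 z : 0 <= h z.
Proof. by apply: Rintegral_ge0 => x _; exact: mulr_ge0. Qed.

Let finA : (\int[leb2]_x (A x)%:E < +oo)%E.
Proof. by have /integrableP[_] := iA; under eq_integral do rewrite /= normr_id. Qed.
Let finB : (\int[leb2]_x (B x)%:E < +oo)%E.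
Proof. by have /integrableP[_] := iB; under eq_integral do rewrite /= normr_id. Qed.

(** [h] is bounded, since one factor is bounded and the other integrable, and it is integrable as a
    convolution of integrable functions; so h^2 <= M h has a finite integral. *)
Let hfin : (sqint h < +oo)%E.
Proof.
have [_ [K K0 hK]] := bpsi.
pose M := K * \int[leb2]_x A x.
have M0 : 0 <= M by apply: mulr_ge0 => //; apply: Rintegral_ge0.
have hM z : h z <= M.
  rewrite /M -(RintegralZl _ measurableT iA).
  apply: (le_Rintegral measurableT (iAB z) (integrableZl measurableT K iA)).
  move=> x _; rewrite mulrC ler_wpM2r//.
  apply: (le_trans (cutoff_le _ hK)); rewrite ler_piMr//.
  by apply: expk2_le1; exact: ltW.
have hint := integral_convolution mA mB A0 B0 hE.
apply: (@le_lt_trans _ _ (\int[leb2]_z (M%:E * (h z)%:E))%E).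
  apply: ge0_le_integralT.
  - by move=> z; rewrite lee_fin sqr_ge0.
  - exact: measurable_sqr.
  - by apply: emeasurable_funM => //; exact/measurable_EFinP.
  - by move=> z; rewrite -EFinM lee_fin expr2 ler_wpM2r.
rewrite ge0_integralZl//; last 2 first.
- exact/measurable_EFinP.
- by move=> z _; rewrite lee_fin.
rewrite hint lte_mul_pinfty//; rewrite ?lee_fin//.
rewrite lte_mul_pinfty//; first by apply: integral_ge0 => x _; rewrite lee_fin.
by rewrite ge0_fin_numE//; apply: integral_ge0 => x _; rewrite lee_fin.
Qed.

(** [tensor_energy_le] with [eta = d], then the bilinear bound. The cutoff is at most 1 and
    disappears from the weighted norms. *)
Lemma cutoff_pair_le :
  (\int[leb2]_z (expk2 d z * (fenergy (cutoff d phi) z * fenergy (cutoff d psi) z))%:E <=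
   (2 * c4 * C)%:E * (sqint (fun z => w1 z * phi z)%R * sqint (fun z => w2 z * psi z)%R))%E.
Proof.
have [mphi _] := bphi; have [mpsi _] := bpsi.
apply: (le_trans (tensor_energy_le (cutoff_integrable d0 bphi) (cutoff_integrable d0 bpsi) hE d0 mh h0)).
rewrite [X in (_ <= X * _)%E]EFinM -muleA; apply: lee_wpmul2l.
  by rewrite lee_fin !mulr_ge0// pi_ge0.
apply: (le_trans (bil mA mB mh A0 B0 h0 hE hfin)).
apply: lee_wpmul2l; first by rewrite lee_fin.
by apply: lee_pmul; rewrite ?sqint_ge0//; exact: le_weighted.
Qed.

End cutoff_pair.

Section smooth_pair.
Variables (a b a' b' : P -> R) (d : R).
Hypotheses (ia : (@leb2 R).-integrable setT (EFin \o a)) (ib : (@leb2 R).-integrable setT (EFin \o b)).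
Hypotheses (ia' : (@leb2 R).-integrable setT (EFin \o a')) (ib' : (@leb2 R).-integrable setT (EFin \o b')).
Hypothesis d0 : 0 < d.

Definition whatsq (w a b : P -> R) : \bar R :=
  (sqint (fun z => w z * hatRe a b z)%R + sqint (fun z => w z * hatIm a b z)%R)%E.

Lemma measurable_fenergy phi : bounded_measurable phi -> measurable_fun setT (fenergy (cutoff d phi)).
Proof.
move=> /(cutoff_integrable d0) iphi.
by apply: measurable_funD; apply: measurable_funX; [exact: (bounded_fcos iphi).1|exact: (bounded_fsin iphi).1].
Qed.

Lemma fenergy_ge0 (phi : P -> R) z : 0 <= fenergy phi z.
Proof. by rewrite addr_ge0 ?sqr_ge0. Qed.

Definition smooth_sq (a b : P -> R) (z : P) : R := smooth d a z ^+ 2 + smooth d b z ^+ 2.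

Lemma measurable_smooth f : (@leb2 R).-integrable setT (EFin \o f) -> measurable_fun setT (smooth d f).
Proof.
move=> fi; have mE := measurable_int _ fi.
have mf : measurable_fun setT f by apply/measurable_EFinP; exact: mE.
apply: (measurable_Rintegral_param leb2 (F := fun z : P * P => f z.2 * poisson2 d (z.1 - z.2))).
apply: measurable_funM; first exact: (measurableT_comp mf measurable_snd).
exact: measurable_poisson_shear.
Qed.

(** Each factor splits into two real energies at the cost of 2, which leaves four products and the
    constant 8 c4 C = 4 (2 c4 C). *)
Lemma smooth_pair_le :
  (\int[leb2]_z (expk2 d z * (smooth_sq a b z * smooth_sq a' b' z))%:E <=
   (8 * c4 * C)%:E * (whatsq w1 a b * whatsq w2 a' b'))%E.
Proof.
have [bp bq] := (bounded_hatRe ia ib, bounded_hatIm ia ib).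
have [bp' bq'] := (bounded_hatRe ia' ib', bounded_hatIm ia' ib').
pose G (phi psi : P -> R) (z : P) : R := expk2 d z * (fenergy (cutoff d phi) z * fenergy (cutoff d psi) z).
have mG phi psi : bounded_measurable phi -> bounded_measurable psi -> measurable_fun setT (fun z => (G phi psi z)%:E).
  move=> h1 h2; apply/measurable_EFinP; apply: measurable_funM; first exact: measurable_expk2.
  by apply: measurable_funM; exact: measurable_fenergy.
have G0 phi psi z : (0 <= (G phi psi z)%:E)%E.
  by rewrite lee_fin mulr_ge0 ?expk2_ge0// mulr_ge0 ?fenergy_ge0.
have mS f g : (@leb2 R).-integrable setT (EFin \o f) -> (@leb2 R).-integrable setT (EFin \o g) ->
    measurable_fun setT (smooth_sq f g).
  by move=> h1 h2; apply: measurable_funD; apply: measurable_funX; exact: measurable_smooth.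
have S0 f g z : 0 <= smooth_sq f g z by rewrite addr_ge0 ?sqr_ge0.
set p := hatRe a b; set q := hatIm a b; set p' := hatRe a' b'; set q' := hatIm a' b'.
apply: (@le_trans _ _ (\int[leb2]_z (4%:E * (((G p p' z)%:E + (G p q' z)%:E) + ((G q p' z)%:E + (G q q' z)%:E))))%E).
  apply: ge0_le_integralT.
  - by move=> z; rewrite lee_fin mulr_ge0 ?expk2_ge0// mulr_ge0.
  - apply/measurable_EFinP; apply: measurable_funM; first exact: measurable_expk2.
    by apply: measurable_funM; exact: mS.
  - apply: emeasurable_funM => //; apply: emeasurable_funD; apply: emeasurable_funD; exact: mG.
  move=> z; rewrite -!EFinD -EFinM lee_fin /G.
  have := smooth_sqr_le z d0 ia ib; have := smooth_sqr_le z d0 ia' ib'.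
  rewrite -/(smooth_sq a b z) -/(smooth_sq a' b' z) -/p -/q -/p' -/q' => h2 h1.
  have h3 := ler_pM (S0 _ _ _) (S0 _ _ _) h1 h2.
  apply: (le_trans (ler_wpM2l (expk2_ge0 d z) h3)).
  move: (expk2 _ _) (fenergy _ _) (fenergy _ _) (fenergy _ _) (fenergy _ _) => E p1 q1 p2 q2.
  by rewrite le_eqVlt; apply/orP; left; apply/eqP; ring.
have mG2 phi : bounded_measurable phi ->
    measurable_fun setT (fun z => (G phi p' z)%:E + (G phi q' z)%:E)%E.
  by move=> h; apply: emeasurable_funD; exact: mG.
rewrite ge0_integralZl//; last 2 first.
- by apply: emeasurable_funD; exact: mG2.
- by move=> z _; rewrite !adde_ge0.
rewrite ge0_integralD//; [|by move=> z _; rewrite adde_ge0|exact: mG2|by move=> z _; rewrite adde_ge0|exact: mG2].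
rewrite ge0_integralD//; [|exact: mG|exact: mG].
rewrite ge0_integralD//; [|exact: mG|exact: mG].
have := cutoff_pair_le bp bp' d0; have := cutoff_pair_le bp bq' d0.
have := cutoff_pair_le bq bp' d0; have := cutoff_pair_le bq bq' d0.
rewrite /whatsq -/p -/q -/p' -/q'.
have := sqint_ge0 (fun z => w1 z * p z); have := sqint_ge0 (fun z => w1 z * q z).
have := sqint_ge0 (fun z => w2 z * p' z); have := sqint_ge0 (fun z => w2 z * q' z).
move: (sqint _) (sqint _) (sqint _) (sqint _) => Y Y' X X' Y0 Y'0 X0 X'0 h1 h2 h3 h4.
have -> : (8 * c4 * C) = 4 * (2 * c4 * C) by ring.
rewrite EFinM -muleA; apply: lee_wpmul2l; first by rewrite lee_fin.
have k0 : (0 <= (2 * c4 * C)%:E)%E by rewrite lee_fin !mulr_ge0// pi_ge0.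
rewrite ge0_muleDl// !ge0_muleDr ?adde_ge0 ?mule_ge0//.
by apply: leeD; apply: leeD.
Qed.

End smooth_pair.
End TamePair.

(** Fatou's lemma for a limit almost everywhere and a bound that holds eventually. It serves both
    the removal of the cutoff and the completeness of L^2. *)
Lemma fatou_bound d (T : measurableType d) (R : realType) (m : {measure set T -> \bar R})
    (f : nat -> T -> \bar R) (g : T -> \bar R) (l : \bar R) :
  (forall n, measurable_fun setT (f n)) -> (forall n x, 0 <= f n x)%E ->
  measurable_fun setT g -> (forall x, 0 <= g x)%E ->
  {ae m, forall x, f ^~ x @ \oo --> g x} ->
  (\forall n \near \oo, \int[m]_x f n x <= l)%E ->
  (\int[m]_x g x <= l)%E.
Proof.
move=> mf f0 mg g0 fg fl.
apply: (@le_trans _ _ (\int[m]_x limn_einf (f ^~ x))%E).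
  apply: ae_ge0_le_integral => //.
  - move=> x _; rewrite limn_einf_lim; apply: lime_ge; first exact: is_cvg_einfs.
    by apply: nearW => n; apply: le_ereal_inf_tmp => _ [k _ <-].
  - apply: (measurableT_comp (f := -%E)) => //.
    by apply: measurable_fun_limn_esup => n; exact: measurableT_comp.
  - by apply: filterS fg => x fgx _; rewrite (cvg_limn_einf_sup fgx).1.
apply: (le_trans (fatou _ measurableT mf (fun n x _ => f0 n x))).
rewrite limn_einf_lim; apply: lime_le; first exact: is_cvg_einfs.
apply: filterS fl => n; apply: le_trans; apply: ereal_inf_lbound.
by exists n => //=.
Qed.

(** * Removal of the cutoff *)

Section TamePairLimit.
Context {R : realType}.
Local Notation TR := (measurableTypeR R).
Local Notation P := (TR * TR)%type.
Local Notation c4 := ((2 * pi) * (2 * pi) : R).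
Variables (w1 w2 : P -> R) (C : R).
Hypotheses (mw1 : measurable_fun setT w1) (mw2 : measurable_fun setT w2).
Hypothesis C0 : 0 <= C.
Hypothesis bil : bilinear_bound w1 w2 C.

Lemma expk2_cvg (z : P) : expk2 (n.+1%:R^-1) z @[n --> \oo] --> (1 : R).
Proof.
have h : (n.+1%:R^-1 : R) @[n --> \oo] --> (0 : R) by exact: cvg_harmonic.
have hk (x : R) : expk (n.+1%:R^-1) x @[n --> \oo] --> (1 : R).
  have : expR (- (n.+1%:R^-1 * `|x|)) @[n --> \oo] --> expR (- (0 * `|x|)).
    apply: continuous_cvg; first exact: continuous_expR.
    by apply: cvgN; apply: cvgM => //; exact: cvg_cst.
  by rewrite mul0r oppr0 expR0.
have h2 : expk n.+1%:R^-1 z.1 * expk n.+1%:R^-1 z.2 @[n --> \oo] --> (1 * 1 : R).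
  by apply: cvgM; exact: hk.
by rewrite mulr1 in h2; exact: h2.
Qed.

(** Each Poisson average tends to c4 times its function, so the product of the two squared moduli
    acquires the factor c4^4. *)
Lemma tame_pair_le (a b a' b' : R * R -> R) : tame a -> tame b -> tame a' -> tame b' ->
  ((c4 ^+ 4)%:E * \int[leb2]_z (((a z ^+ 2 + b z ^+ 2) * (a' z ^+ 2 + b' z ^+ 2))%:E : \bar R) <=
   (8 * c4 * C)%:E * (whatsq w1 a b * whatsq w2 a' b'))%E.
Proof.
move=> ta tb ta' tb'.
have [ia ib] := (tame_integrable ta, tame_integrable tb).
have [ia' ib'] := (tame_integrable ta', tame_integrable tb').
have mts f : tame f -> measurable_fun setT (fun z : P => f z ^+ 2).
  by move=> tf; apply: measurable_funX; exact: tame_measurable.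
have mG : measurable_fun setT (fun z : P => ((a z ^+ 2 + b z ^+ 2) * (a' z ^+ 2 + b' z ^+ 2))%:E).
  by apply/measurable_EFinP; apply: measurable_funM; apply: measurable_funD; exact: mts.
rewrite -ge0_integralZl//; last 2 first.
- by move=> z _; rewrite lee_fin mulr_ge0// addr_ge0 ?sqr_ge0.
- by rewrite lee_fin exprn_ge0// mulr_ge0// mulr_ge0// pi_ge0.
have n0 n : 0 < n.+1%:R^-1 :> R by rewrite invr_gt0 ltr0n.
pose f n (z : P) := (expk2 n.+1%:R^-1 z * (smooth_sq n.+1%:R^-1 a b z * smooth_sq n.+1%:R^-1 a' b' z))%:E.
apply: (fatou_bound (f := f)).
- move=> n; apply/measurable_EFinP; apply: measurable_funM; first exact: measurable_expk2.
  by apply: measurable_funM; apply: measurable_funD; apply: measurable_funX; exact: measurable_smooth.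
- move=> n z; rewrite lee_fin mulr_ge0 ?expk2_ge0// mulr_ge0//;
  by rewrite addr_ge0 ?sqr_ge0.
- by apply: emeasurable_funM.
- move=> z; rewrite -EFinM lee_fin mulr_ge0//.
    by rewrite exprn_ge0// mulr_ge0// mulr_ge0// pi_ge0.
  by rewrite mulr_ge0// addr_ge0 ?sqr_ge0.
- apply: aeW => z; rewrite -EFinM; apply/cvg_EFin; first exact: nearW.
  rewrite (_ : _ * ((a z ^+ 2 + _) * _) = 1 * (((c4 * a z) ^+ 2 + (c4 * b z) ^+ 2) * ((c4 * a' z) ^+ 2 + (c4 * b' z) ^+ 2))); last by ring.
  have sq g : tame g -> smooth n.+1%:R^-1 g z ^+ 2 @[n --> \oo] --> (c4 * g z) ^+ 2.
    by move=> tg; apply: cvgM; exact: smooth_cvg.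
  apply: cvgM; first exact: expk2_cvg.
  by apply: cvgM; apply: cvgD; exact: sq.
- by apply: nearW => n; apply: smooth_pair_le.
Qed.

End TamePairLimit.

(** * Squared norms and extension by density *)

Section ComplexSquareNorms.
Context {R : realType}.
Local Notation TR := (measurableTypeR R).
Local Notation P := (TR * TR)%type.
Implicit Types (u v w F G : R * R -> R[i]) (W : R * R -> R).

Definition normsq (c : R[i]) : R := complex.Re c ^+ 2 + complex.Im c ^+ 2.

Lemma normsq_ge0 c : 0 <= normsq c.
Proof. by rewrite addr_ge0 ?sqr_ge0. Qed.

Lemma normc_sqr c : Normc.normc c ^+ 2 = normsq c.
Proof. by case: c => a b /=; rewrite sqr_sqrtr// addr_ge0 ?sqr_ge0. Qed.

Lemma normsqM c c' : normsq (c * c')%R = normsq c * normsq c'.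
Proof. by case: c => a b; case: c' => a' b'; rewrite /normsq /=; ring. Qed.

Lemma normsqN c : normsq (- c)%R = normsq c.
Proof. by case: c => a b; rewrite /normsq /= !sqrrN. Qed.

Lemma normsqD_le c c' : normsq (c + c')%R <= 2 * normsq c + 2 * normsq c'.
Proof.
case: c => a b; case: c' => a' b'; rewrite /normsq /=.
by have := sqr_ge0 (a - a'); have := sqr_ge0 (b - b'); nra.
Qed.

Lemma normsq_real (r : R) (c : R[i]) : normsq (r%:C%C * c)%R = r ^+ 2 * normsq c.
Proof. by rewrite normsqM /normsq /= expr0n addr0. Qed.

Definition sqn (w : P -> R[i]) : \bar R := (\int[leb2]_z (normsq (w z))%:E)%E.

Lemma sqn_ge0 w : (0 <= sqn w)%E.
Proof. by apply: integral_ge0 => z _; rewrite lee_fin normsq_ge0. Qed.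

Lemma L2norm_sqn w : L2norm w = (sqn w `^ 2^-1)%E.
Proof.
rewrite /L2norm unlock; congr (_ `^ _)%E; apply: eq_integral => z _.
rewrite gee0_abs; last by rewrite lee_fin; case: (w z) => a b; exact: sqrtr_ge0.
rewrite poweR_EFin powR_mulrn; first by rewrite normc_sqr.
by case: (w z) => a b; exact: sqrtr_ge0.
Qed.

Lemma cmeasurable_normsq w : cmeasurable w -> measurable_fun setT (fun z : P => (normsq (w z))%:E).
Proof.
by case=> m1 m2; apply/measurable_EFinP; apply: measurable_funD; apply: measurable_funX.
Qed.

Lemma cmeasurableD u v : cmeasurable u -> cmeasurable v -> cmeasurable (fun z => u z + v z)%R.
Proof.
move=> [m1 m2] [m1' m2']; split.
  rewrite (_ : (fun z => _) = fun z => complex.Re (u z) + complex.Re (v z)); first exact: measurable_funD.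
  by apply/funext => z; case: (u z) => a b; case: (v z).
rewrite (_ : (fun z => _) = fun z => complex.Im (u z) + complex.Im (v z)); first exact: measurable_funD.
by apply/funext => z; case: (u z) => a b; case: (v z).
Qed.

Lemma cmeasurableN u : cmeasurable u -> cmeasurable (fun z => - u z)%R.
Proof.
move=> [m1 m2]; split.
  rewrite (_ : (fun z => _) = fun z => - complex.Re (u z)); first exact: measurableT_comp.
  by apply/funext => z; case: (u z).
rewrite (_ : (fun z => _) = fun z => - complex.Im (u z)); first exact: measurableT_comp.
by apply/funext => z; case: (u z).
Qed.

Lemma cmeasurableM u v : cmeasurable u -> cmeasurable v -> cmeasurable (fun z => u z * v z)%R.
Proof.
move=> [m1 m2] [m1' m2']; split.
  rewrite (_ : (fun z => _) = fun z => complex.Re (u z) * complex.Re (v z) - complex.Im (u z) * complex.Im (v z)).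
    by apply: measurable_funB; apply: measurable_funM.
  by apply/funext => z; case: (u z) => a b; case: (v z).
rewrite (_ : (fun z => _) = fun z => complex.Re (u z) * complex.Im (v z) + complex.Im (u z) * complex.Re (v z)).
  by apply: measurable_funD; apply: measurable_funM.
by apply/funext => z; case: (u z) => a b; case: (v z).
Qed.

(** The square of [Xhat_norm] when [W] is the weight; with squares the limit arguments avoid roots
    of extended reals. *)
Definition wsqn W F : \bar R := (\int[leb2]_z (W z ^+ 2 * normsq (F z))%:E)%E.

Lemma wsqn_ge0 W F : (0 <= wsqn W F)%E.
Proof. by apply: integral_ge0 => z _; rewrite lee_fin mulr_ge0 ?sqr_ge0 ?normsq_ge0. Qed.

Lemma Xhat_norm_wsqn alpha s b F : Xhat_norm alpha s b F = (wsqn (weight alpha s b) F `^ 2^-1)%E.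
Proof.
rewrite /Xhat_norm L2norm_sqn; congr (_ `^ _)%E.
by apply: eq_integral => z _; rewrite normsq_real.
Qed.

Lemma wsqn1 F : wsqn (fun=> 1) F = sqn F.
Proof. by apply: eq_integral => z _; rewrite expr1n mul1r. Qed.

(** Triangle inequality for squared norms; the factors 2 only affect constants. *)
Lemma wsqnB_le W F G H : measurable_fun setT (W : P -> R) ->
  cmeasurable F -> cmeasurable G -> cmeasurable H ->
  (wsqn W (fun z => F z - H z)%R <=
   2%:E * wsqn W (fun z => F z - G z)%R + 2%:E * wsqn W (fun z => G z - H z)%R)%E.
Proof.
move=> mW mF mG mH.
have mw F' : cmeasurable F' -> measurable_fun setT (fun z : P => (W z ^+ 2 * normsq (F' z))%:E).
  move=> m; apply/measurable_EFinP; apply: measurable_funM; first exact: measurable_funX.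
  by apply/measurable_EFinP; exact: cmeasurable_normsq.
have mB F1 F2 : cmeasurable F1 -> cmeasurable F2 -> cmeasurable (fun z => F1 z - F2 z)%R.
  by move=> m1 m2; apply: cmeasurableD => //; exact: cmeasurableN.
have w0 F' z : (0 <= (W z ^+ 2 * normsq (F' z))%:E)%E.
  by rewrite lee_fin mulr_ge0 ?sqr_ge0 ?normsq_ge0.
have mFG := mw _ (mB _ _ mF mG); have mGH := mw _ (mB _ _ mG mH).
have mFH := mw _ (mB _ _ mF mH).
have e F' : measurable_fun setT (fun z : P => (W z ^+ 2 * normsq (F' z))%:E) ->
    (2%:E * wsqn W F' = \int[leb2]_z (2%:E * (W z ^+ 2 * normsq (F' z))%:E))%E.
  by move=> m; rewrite ge0_integralZl.
rewrite e// e// -ge0_integralD//; last 4 first.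
- by move=> z _; apply: mule_ge0; rewrite lee_fin ?ler0n// mulr_ge0 ?sqr_ge0 ?normsq_ge0.
- exact: emeasurable_funM.
- by move=> z _; apply: mule_ge0; rewrite lee_fin ?ler0n// mulr_ge0 ?sqr_ge0 ?normsq_ge0.
- exact: emeasurable_funM.
apply: ge0_le_integralT => //.
- by move=> z; rewrite lee_fin mulr_ge0 ?sqr_ge0 ?normsq_ge0.
- by apply: emeasurable_funD; exact: emeasurable_funM.
move=> z; rewrite -!EFinM -EFinD lee_fin.
have -> : (F z - H z = (F z - G z) + (G z - H z))%R by rewrite addrA subrK.
apply: (le_trans (ler_wpM2l (sqr_ge0 _) (normsqD_le _ _))).
by rewrite mulrDr mulrCA [X in _ + X <= _]mulrCA.
Qed.

End ComplexSquareNorms.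

(** * Products of complex-valued functions *)

Section TameProducts.
Context {R : realType}.
Local Notation TR := (measurableTypeR R).
Local Notation P := (TR * TR)%type.
Local Notation c4 := ((2 * pi) * (2 * pi) : R).
Implicit Types (u v : R * R -> R[i]).

Definition ctame u : Prop :=
  tame (fun z => complex.Re (u z)) /\ tame (fun z => complex.Im (u z)).

Lemma schwartz_ctame u : schwartz u -> ctame u.
Proof. by case=> h1 h2; split; exact: schwartz_tame. Qed.

Lemma ctame_measurable u : ctame u -> cmeasurable u.
Proof. by case=> h1 h2; split; exact: tame_measurable. Qed.

Lemma ctameB u v : ctame u -> ctame v -> ctame (fun z => u z - v z).
Proof.
move=> [h1 h2] [k1 k2]; split.
  rewrite (_ : (fun z => _) = fun z => complex.Re (u z) - complex.Re (v z)); first exact: tameB.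
  by apply/funext => z; case: (u z) => a b; case: (v z).
rewrite (_ : (fun z => _) = fun z => complex.Im (u z) - complex.Im (v z)); first exact: tameB.
by apply/funext => z; case: (u z) => a b; case: (v z).
Qed.

Local Notation Reu u := (fun z : P => complex.Re (u z)).
Local Notation Imu u := (fun z : P => complex.Im (u z)).

Lemma trig_integrable (f : P -> R) (g : R -> R) z : (@leb2 R).-integrable setT (EFin \o f) ->
  continuous g -> (forall x, `|g x| <= 1) ->
  (@leb2 R).-integrable setT (EFin \o (fun t => f t * g (dot z t))).
Proof. by move=> fi; apply: (integrable_phi_trig fi); exact: measurable_id. Qed.

Lemma fourierE u : ctame u ->
  fourier u = fun z => (hatRe (Reu u) (Imu u) z +i* hatIm (Reu u) (Imu u) z)%C.
Proof.
move=> [/tame_integrable ia /tame_integrable ib]; apply/funext => z.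
have cc := @continuous_cos R; have cs := @continuous_sin R.
have bc := @cos_max R; have bs := @sin_max R.
rewrite /fourier /cintegral /hatRe /hatIm /fcos /fsin /cosint /sinint; congr (_ +i* _)%C.
  rewrite -RintegralD//; last 2 first.
  - exact: (trig_integrable z ia cc bc).
  - exact: (trig_integrable z ib cs bs).
  apply: eq_Rintegral => t _ /=; rewrite (_ : t.1 * z.1 + t.2 * z.2 = dot z t); last by rewrite dotC.
  by case: (u t) => a b /=; ring.
rewrite -RintegralB//; last 2 first.
- exact: (trig_integrable z ib cc bc).
- exact: (trig_integrable z ia cs bs).
apply: eq_Rintegral => t _ /=; rewrite (_ : t.1 * z.1 + t.2 * z.2 = dot z t); last by rewrite dotC.
by case: (u t) => a b /=; ring.
Qed.

Lemma cmeasurable_fourier u : ctame u -> cmeasurable (fourier u).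
Proof.
move=> tu; rewrite fourierE//; move: tu => [/tame_integrable ia /tame_integrable ib].
by split; [exact: (bounded_hatRe ia ib).1|exact: (bounded_hatIm ia ib).1].
Qed.

Lemma fourierB u v : ctame u -> ctame v ->
  fourier (fun z => u z - v z) = fun z => fourier u z - fourier v z.
Proof.
move=> tu tv; rewrite !fourierE//; last exact: ctameB.
move: tu tv => [/tame_integrable ia /tame_integrable ib] [/tame_integrable ia' /tame_integrable ib'].
have cc := @continuous_cos R; have cs := @continuous_sin R.
have bc := @cos_max R; have bs := @sin_max R.
apply/funext => z; rewrite /hatRe /hatIm.
have lin (g : R -> R) (f h k : P -> R) : continuous g -> (forall x, `|g x| <= 1) ->
    (@leb2 R).-integrable setT (EFin \o f) -> (@leb2 R).-integrable setT (EFin \o h) ->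
    (forall t, k t = f t - h t) ->
    \int[leb2]_t (k t * g (dot z t)) = \int[leb2]_t (f t * g (dot z t)) - \int[leb2]_t (h t * g (dot z t)).
  move=> cg bg fi hi kE; rewrite -RintegralB//; last 2 first.
  - exact: trig_integrable.
  - exact: trig_integrable.
  by apply: eq_Rintegral => t _; rewrite kE mulrBl.
have ReB t : complex.Re (u t - v t) = complex.Re (u t) - complex.Re (v t).
  by case: (u t) => a b; case: (v t).
have ImB t : complex.Im (u t - v t) = complex.Im (u t) - complex.Im (v t).
  by case: (u t) => a b; case: (v t).
rewrite /fcos /fsin /cosint /sinint.
rewrite (lin _ _ _ _ cc bc ia ia' ReB) (lin _ _ _ _ cs bs ib ib' ImB).
rewrite (lin _ _ _ _ cc bc ib ib' ImB) (lin _ _ _ _ cs bs ia ia' ReB).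
apply/eqP; rewrite eq_complex /=; apply/andP; split; apply/eqP; ring.
Qed.

Variables (w1 w2 : R * R -> R) (C : R).
Hypotheses (mw1 : measurable_fun setT (w1 : P -> R)) (mw2 : measurable_fun setT (w2 : P -> R)).
Hypothesis C0 : 0 <= C.
Hypothesis bil : bilinear_bound w1 w2 C.

Lemma wsqn_fourier (w : R * R -> R) u : measurable_fun setT (w : P -> R) -> ctame u ->
  wsqn w (fourier u) = whatsq w (Reu u) (Imu u).
Proof.
move=> mw tu; rewrite fourierE//; move: tu => [/tame_integrable ia /tame_integrable ib].
have [mp _] := bounded_hatRe ia ib; have [mq _] := bounded_hatIm ia ib.
rewrite /whatsq /sqint -ge0_integralD//; last 4 first.
- by move=> z _; rewrite lee_fin sqr_ge0.
- by apply: measurable_sqr; exact: measurable_funM.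
- by move=> z _; rewrite lee_fin sqr_ge0.
- by apply: measurable_sqr; exact: measurable_funM.
by apply: eq_integral => z _; rewrite -EFinD /normsq /= mulrDr !exprMn.
Qed.

(** Division by c4^4 removes the masses of the Poisson kernels. *)
Definition product_const : R := 8 * c4 * C / c4 ^+ 4.

Lemma product_const_ge0 : 0 <= product_const.
Proof.
have c0 : 0 <= c4 by rewrite !mulr_ge0// pi_ge0.
by rewrite divr_ge0 ?exprn_ge0// !mulr_ge0// pi_ge0.
Qed.

Lemma sqn_product_le u v : ctame u -> ctame v ->
  (sqn (fun z => u z * v z)%R <=
   product_const%:E * (wsqn w1 (fourier u) * wsqn w2 (fourier v)))%E.
Proof.
move=> tu tv; rewrite !wsqn_fourier//.
have c0 : 0 < c4 ^+ 4 by rewrite exprn_gt0// !mulr_gt0// pi_gt0.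
have := tame_pair_le mw1 mw2 C0 bil tu.1 tu.2 tv.1 tv.2.
have -> : (\int[leb2]_z (((complex.Re (u z) ^+ 2 + complex.Im (u z) ^+ 2) *
   (complex.Re (v z) ^+ 2 + complex.Im (v z) ^+ 2))%:E : \bar R) = sqn (fun z => u z * v z)%R)%E.
  by apply: eq_integral => z _; rewrite normsqM.
move: (whatsq _ _ _ * whatsq _ _ _)%E (sqn _) => X I h.
have ci : (0 <= ((c4 ^+ 4)^-1)%:E)%E by rewrite lee_fin invr_ge0 ltW.
have := lee_wpmul2l ci h.
by rewrite !muleA -!EFinM mulVf ?gt_eqF// mul1e mulrC.
Qed.

End TameProducts.

(** * Completeness of L^2 *)

Section FastConvergence.
Context {R : realType} d (T : measurableType d) (m : {measure set T -> \bar R}).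
Local Notation q := (2^-1 : R).

Lemma sum_half_le n : \sum_(0 <= k < n) q ^+ k <= 2.
Proof.
suff -> : \sum_(0 <= k < n) q ^+ k = 2 - 2 * q ^+ n.
  by rewrite gerDl oppr_le0 mulr_ge0// exprn_ge0.
elim: n => [|n ih]; first by rewrite big_nil expr0 mulr1 subrr.
by rewrite big_nat_recr//= ih exprS; field.
Qed.

Variable g : nat -> T -> R.
Hypothesis mg : forall n, measurable_fun setT (g n).
Hypothesis gfast : forall n, (\int[m]_x ((g n.+1 x - g n x) ^+ 2)%:E <= (q ^+ n ^+ 2)%:E)%E.

(** Even with the weight 2^n the integrals are summable, since 2^n 4^-n = 2^-n. *)
Let s (n : nat) (x : T) : \bar R := (2 ^+ n * (g n.+1 x - g n x) ^+ 2)%:E.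

Let s0 n x : (0 <= s n x)%E.
Proof. by rewrite lee_fin mulr_ge0 ?sqr_ge0 ?exprn_ge0. Qed.

Let ms n : measurable_fun setT (s n).
Proof.
apply/measurable_EFinP; apply: measurable_funM => //; apply: measurable_funX.
exact: measurable_funB.
Qed.

Let ints : (\int[m]_x (\sum_(n <oo) s n x) <= 2%:E)%E.
Proof.
rewrite integral_nneseries//; apply: lime_le.
  by apply: is_cvg_nneseries => n _ _; exact: integral_ge0.
apply: nearW => n; apply: (@le_trans _ _ (\sum_(0 <= k < n) (q ^+ k)%:E)%E); last first.
  by rewrite sumEFin lee_fin sum_half_le.
apply: lee_sum => k _.
rewrite /s; under eq_integral do rewrite EFinM.
rewrite ge0_integralZl//; last 2 first.
- by apply/measurable_EFinP; apply: measurable_funX; exact: measurable_funB.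
- by move=> x _; rewrite lee_fin sqr_ge0.
apply: (@le_trans _ _ ((2 ^+ k)%:E * (q ^+ k ^+ 2)%:E)%E).
  by apply: lee_wpmul2l; rewrite ?gfast// lee_fin exprn_ge0.
by rewrite -EFinM lee_fin expr2 mulrA -exprMn divff// expr1n mul1r.
Qed.

(** |y| <= 2^-n + 2^n y^2 bounds the increments by two series, the second of which is finite almost
    everywhere because its sum is integrable; the telescoping series then converges absolutely. *)
Lemma ae_cvg_fast : {ae m, forall x, cvgn (g ^~ x)}.
Proof.
have mS : measurable_fun setT (fun x => \sum_(n <oo) s n x)%E.
  exact: ge0_emeasurable_sum.
have iS : m.-integrable setT (fun x => \sum_(n <oo) s n x)%E.
  apply/integrableP; split => //.
  under eq_integral do rewrite gee0_abs ?nneseries_ge0//.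
  exact: le_lt_trans ints (ltry _).
have := integrable_ae measurableT iS; apply: filterS => x /(_ I) Sfin.
set S := fine (\sum_(n <oo) s n x)%E.
have pw (y : R) n : `|y| <= q ^+ n + 2 ^+ n * y ^+ 2.
  rewrite -(real_normK (num_real y)).
  have p0 : 0 < q ^+ n by rewrite exprn_gt0.
  have -> : 2 ^+ n = (q ^+ n)^-1 by rewrite exprVn invrK.
  move: (normr_ge0 y) => y0.
  have := sqr_ge0 (q ^+ n - `|y|) => h.
  rewrite -(ler_pM2l p0) mulrDr mulrA divff ?gt_eqF// mul1r -expr2.
  move: h; rewrite sqrrB; have : 0 <= q ^+ n * `|y| by rewrite mulr_ge0// ltW.
  move: (q ^+ n * `|y|) (q ^+ n ^+ 2) (`|y| ^+ 2) => *; lra.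
rewrite (_ : g ^~ x = fun n => g 0%N x + series (telescope (g ^~ x)) n); last first.
  by apply/funext => n; rewrite -eq_sum_telescope.
apply: is_cvgD; first exact: is_cvg_cst.
apply: (@normed_cvg R R^o); apply: nondecreasing_is_cvgn.
  by apply: nondecreasing_series => n _ _; exact: normr_ge0.
exists (2 + S) => _ [n _ <-]; rewrite /= /series /=.
apply: (@le_trans _ _ (\sum_(0 <= k < n) (q ^+ k + 2 ^+ k * (g k.+1 x - g k x) ^+ 2))).
  by apply: ler_sum => k _; rewrite /telescope /=.
rewrite big_split/= lerD ?sum_half_le//.
rewrite -lee_fin /S fineK// -sumEFin.
exact: (nneseries_lim_ge n (fun k _ _ => s0 k x)).
Qed.

End FastConvergence.

Section SquareLimit.
Context {R : realType}.
Local Notation TR := (measurableTypeR R).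
Local Notation P := (TR * TR)%type.
Local Notation q := (2^-1 : R).

Lemma subsequence_choice (N : nat -> nat) : exists n : nat -> nat,
  forall k, [/\ (N k <= n k)%N, (n k <= n k.+1)%N & (k <= n k)%N].
Proof.
exists (fun k => (k + \sum_(i < k.+1) N i)%N) => k; split.
- by rewrite big_ord_recr /= addnA leq_addl.
- by rewrite [in leqRHS]big_ord_recr /= addSn -addnS leq_add2l (leq_trans (leq_addr (N k.+1) _))// ltnW// ltnS.
- exact: leq_addr.
Qed.

Lemma sqn_part_le (f : P -> R[i]) : cmeasurable f ->
  (\int[leb2]_z (complex.Re (f z) ^+ 2)%:E <= sqn f)%E /\
  (\int[leb2]_z (complex.Im (f z) ^+ 2)%:E <= sqn f)%E.
Proof.
move=> mf; have mn := cmeasurable_normsq mf; case: mf => mr mi; split.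
- apply: ge0_le_integralT => //; first by move=> z; rewrite lee_fin sqr_ge0.
    exact: measurable_sqr.
  by move=> z; rewrite lee_fin lerDl sqr_ge0.
- apply: ge0_le_integralT => //; first by move=> z; rewrite lee_fin sqr_ge0.
    exact: measurable_sqr.
  by move=> z; rewrite lee_fin lerDr sqr_ge0.
Qed.

(** A fast subsequence converges almost everywhere, and Fatou's lemma transfers an eventual bound on
    the distance to [W n] to its limit [w]. This single property yields the convergence of [W] to
    [w], and that of any other sequence asymptotic to [W]. *)
Lemma sqn_complete (W : nat -> P -> R[i]) : (forall n, cmeasurable (W n)) ->
  (forall e, 0 < e -> exists N, forall n m, (N <= n)%N -> (N <= m)%N ->
     (sqn (fun z => W n z - W m z)%R <= e%:E)%E) ->
  exists2 w : P -> R[i], cmeasurable w & forall (f : P -> R[i]) (c : R), cmeasurable f ->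
    (\forall n \near \oo, sqn (fun z => f z - W n z)%R <= c%:E)%E ->
    (sqn (fun z => f z - w z)%R <= c%:E)%E.
Proof.
move=> mW cauchyW.
have /choice [N hN] k : exists N, forall n m, (N <= n)%N -> (N <= m)%N ->
    (sqn (fun z => W n z - W m z)%R <= (q ^+ k ^+ 2)%:E)%E.
  by apply: cauchyW; rewrite !exprn_gt0.
have [n hn] := subsequence_choice N.
have ninf : n @ \oo --> \oo.
  move=> A [k _ kA]; exists k => // j /= kj; apply: kA => /=.
  by apply: (leq_trans kj); have [] := hn j.
pose V k := W (n k).
have mV k : cmeasurable (V k) by exact: mW.
have mVd k : cmeasurable (fun z => V k.+1 z - V k z)%R.
  by apply: cmeasurableD => //; exact: cmeasurableN.
have fast k : (sqn (fun z => V k.+1 z - V k z)%R <= (q ^+ k ^+ 2)%:E)%E.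
  by have [h1 h2 _] := hn k; apply: hN => //; exact: leq_trans h2.
have ReB (c c' : R[i]) : complex.Re (c - c') = complex.Re c - complex.Re c'.
  by case: c => a b; case: c'.
have ImB (c c' : R[i]) : complex.Im (c - c') = complex.Im c - complex.Im c'.
  by case: c => a b; case: c'.
have aeRe : {ae @leb2 R, forall z, cvgn (fun k => complex.Re (V k z))}.
  apply: (@ae_cvg_fast _ _ _ leb2 (fun k z => complex.Re (V k z))); first by move=> k; have [] := mV k.
  move=> k; apply: le_trans (fast k); under eq_integral do rewrite -ReB.
  exact: (sqn_part_le (mVd k)).1.
have aeIm : {ae @leb2 R, forall z, cvgn (fun k => complex.Im (V k z))}.
  apply: (@ae_cvg_fast _ _ _ leb2 (fun k z => complex.Im (V k z))); first by move=> k; have [] := mV k.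
  move=> k; apply: le_trans (fast k); under eq_integral do rewrite -ImB.
  exact: (sqn_part_le (mVd k)).2.
(* The limit superior is measurable everywhere and is the limit off a null set; [fine] gives 0 where
   it is infinite. *)
pose lim_ (p : P -> nat -> R) (z : P) : R := fine (limn_esup (fun k => (p z k)%:E)).
have mlim p : (forall k, measurable_fun setT (fun z => p z k)) -> measurable_fun setT (lim_ p).
  move=> mp; apply: (measurableT_comp (fine_measurable measurableT)).
  apply: (@measurable_fun_limn_esup _ _ _ setT (fun k z => (p z k)%:E)) => k.
  exact/measurable_EFinP.
have limE p z : cvgn (p z) -> p z @ \oo --> lim_ p z.
  move=> cp; have h : (fun k => (p z k)%:E) @ \oo --> (limn (p z))%:E.
    by apply/cvg_EFin => //; exact: nearW.
  by rewrite /lim_ (cvg_limn_einf_sup h).2.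
pose w (z : P) : R[i] := (lim_ (fun z k => complex.Re (V k z)) z +i* lim_ (fun z k => complex.Im (V k z)) z)%C.
have mw : cmeasurable w by split; apply: mlim => k; have [] := mV k.
exists w => // f c mf hc.
have mfV g : cmeasurable g -> cmeasurable (fun z => f z - g z)%R.
  by move=> m; apply: cmeasurableD => //; exact: cmeasurableN.
apply: (fatou_bound (f := fun k z => (normsq (f z - V k z)%R)%:E)).
- by move=> k; exact: (cmeasurable_normsq (mfV _ (mV k))).
- by move=> k z; rewrite lee_fin normsq_ge0.
- exact: (cmeasurable_normsq (mfV _ mw)).
- by move=> z; rewrite lee_fin normsq_ge0.
- apply: filterS2 aeRe aeIm => z cR cI; apply/cvg_EFin; first exact: nearW.
  rewrite /normsq !ReB !ImB /=.
  rewrite (_ : fine \o _ = fun k => (complex.Re (f z) - complex.Re (V k z)) ^+ 2 +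
     (complex.Im (f z) - complex.Im (V k z)) ^+ 2); last first.
    by apply/funext => k; rewrite /= ReB ImB.
  have hR := limE (fun z k => complex.Re (V k z)) z cR.
  have hI := limE (fun z k => complex.Im (V k z)) z cI.
  by apply: cvgD; apply: cvgM; apply: cvgB => //; exact: cvg_cst.
- exact: (ninf _ hc).
Qed.

End SquareLimit.

(** * Extension of the product to limits *)

Section Extension.
Context {R : realType}.
Local Notation TR := (measurableTypeR R).
Local Notation P := (TR * TR)%type.
Implicit Types (u v F G : R * R -> R[i]) (W : R * R -> R).

Lemma cvge0P (x : nat -> \bar R) : (forall n, 0 <= x n)%E ->
  (x @ \oo --> 0%E) <-> (forall e : R, 0 < e -> \forall n \near \oo, (x n <= e%:E)%E).
Proof.
move=> x0; split.
  move=> /fine_cvgP [xfin /cvgr0Pnorm_le h] e e0.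
  move: (h e e0); apply: filterS2 xfin => n fn; rewrite /= ger0_norm ?fine_ge0//.
  by rewrite -lee_fin fineK.
move=> h; apply/fine_cvgP; split.
  apply: filterS (h 1 ltr01) => n xn; rewrite ge0_fin_numE//.
  exact: le_lt_trans xn (ltry _).
apply/cvgr0Pnorm_le => e e0; apply: filterS (h e e0) => n xn.
have fn : x n \is a fin_num by rewrite ge0_fin_numE// (le_lt_trans xn)// ltry.
by rewrite /= ger0_norm ?fine_ge0// -lee_fin fineK.
Qed.

Lemma le_sqrte (x : \bar R) (r : R) : (0 <= x)%E -> 0 <= r ->
  (x `^ 2^-1 <= r%:E)%E = (x <= (r ^+ 2)%:E)%E.
Proof.
move=> x0 r0; have i2 : 0 <= (2^-1 : R) by rewrite invr_ge0.
have e1 : x = ((x `^ 2^-1) `^ 2)%E by rewrite -poweRrM mulVf// poweRe1.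
have e2 : (r ^+ 2)%:E = (r%:E `^ 2)%E by rewrite poweR_EFin powR_mulrn.
have itv (y : \bar R) : (0 <= y)%E -> y \in `[0%E, +oo%E] by move=> y0; rewrite in_itv/= y0 leey.
apply/idP/idP => h.
  rewrite e1 e2; apply: gt0_ler_poweR => //; apply: itv; rewrite ?lee_fin//; exact: poweR_ge0.
have -> : r%:E = ((r ^+ 2)%:E `^ 2^-1)%E.
  by rewrite e2 -poweRrM mulfV// poweRe1// lee_fin.
by apply: gt0_ler_poweR => //; apply: itv; rewrite ?lee_fin ?sqr_ge0.
Qed.

(** [X_approx] with squared norms, real thresholds, and [ctame] in place of [schwartz]. *)
Definition approx W F (u_ : nat -> R * R -> R[i]) : Prop :=
  (forall n, ctame (u_ n)) /\
  (forall e : R, 0 < e -> \forall n \near \oo, (wsqn W (fun z => fourier (u_ n) z - F z)%R <= e%:E)%E).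

Lemma wsqnC W F G : wsqn W (fun z => F z - G z)%R = wsqn W (fun z => G z - F z)%R.
Proof. by apply: eq_integral => z _; rewrite -normsqN opprB. Qed.

Lemma lee_two (x y : \bar R) (a b : R) : (x <= a%:E)%E -> (y <= b%:E)%E ->
  (2%:E * x + 2%:E * y <= (2 * a + 2 * b)%:E)%E.
Proof.
have two (z : \bar R) (c : R) : (z <= c%:E -> 2%:E * z <= (2 * c)%:E)%E.
  by move=> h; rewrite EFinM; apply: lee_wpmul2l; rewrite ?lee_fin ?ler0n.
by move=> h1 h2; exact: (leeD (two _ _ h1) (two _ _ h2)).
Qed.

Variables (w1 w2 : R * R -> R) (K : R).
Hypotheses (mw1 : measurable_fun setT (w1 : P -> R)) (mw2 : measurable_fun setT (w2 : P -> R)).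
Hypothesis K0 : 0 <= K.
Hypothesis prod_le : forall u v, ctame u -> ctame v ->
  (sqn (fun z => u z * v z)%R <= K%:E * (wsqn w1 (fourier u) * wsqn w2 (fourier v)))%E.

Lemma wsqn_near_le W F u (A e : R) : measurable_fun setT (W : P -> R) -> cmeasurable F -> ctame u ->
  (wsqn W F <= A%:E)%E -> (wsqn W (fun z => fourier u z - F z)%R <= e%:E)%E ->
  (wsqn W (fourier u) <= (2 * e + 2 * A)%:E)%E.
Proof.
move=> mW mF tu hA he.
have z0 : cmeasurable (fun=> 0 : R[i]) by split; exact: measurable_cst.
have := wsqnB_le mW (cmeasurable_fourier tu) mF z0.
rewrite (_ : (fun z => fourier u z - 0) = fourier u); last by apply/funext => z; rewrite subr0.
rewrite (_ : (fun z => F z - 0) = F); last by apply/funext => z; rewrite subr0.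
by move=> /le_trans; apply; exact: lee_two.
Qed.

Lemma wsqn_fourierB_le W F u v (e : R) : measurable_fun setT (W : P -> R) -> cmeasurable F ->
  ctame u -> ctame v ->
  (wsqn W (fun z => fourier u z - F z)%R <= e%:E)%E ->
  (wsqn W (fun z => fourier v z - F z)%R <= e%:E)%E ->
  (wsqn W (fourier (fun z => u z - v z)%R) <= (4 * e)%:E)%E.
Proof.
move=> mW mF tu tv hu hv; rewrite fourierB//.
apply: (le_trans (wsqnB_le mW (cmeasurable_fourier tu) mF (cmeasurable_fourier tv))).
rewrite [X in (_ + _ * X)%E]wsqnC (_ : 4 * e = 2 * e + 2 * e); last by ring.
exact: lee_two.
Qed.

Variables (F G : R * R -> R[i]) (A B : R).
Hypotheses (mF : cmeasurable F) (mG : cmeasurable G) (A0 : 0 <= A) (B0 : 0 <= B).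
Hypotheses (FA : (wsqn w1 F <= A%:E)%E) (GB : (wsqn w2 G <= B%:E)%E).

Let prod_le_real u v (a b : R) : ctame u -> ctame v ->
  (wsqn w1 (fourier u) <= a%:E)%E -> (wsqn w2 (fourier v) <= b%:E)%E ->
  (sqn (fun z => u z * v z)%R <= (K * (a * b))%:E)%E.
Proof.
move=> tu tv ha hb; apply: (le_trans (prod_le tu tv)).
by rewrite !EFinM; apply: lee_wpmul2l; rewrite ?lee_fin// lee_pmul ?wsqn_ge0.
Qed.

Let L : R := 16 * K * (A + B + 2).

Let L0 : 0 <= L.
Proof. by rewrite mulr_ge0 ?mulr_ge0// !addr_ge0. Qed.

(** u v - u' v' = u (v - v') + (u - u') v'. The squared norms add up to 16 K (A + B + 2 e) e, and
    [e <= 1] makes this linear in [e]. *)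
Lemma product_dist (u v u' v' : R * R -> R[i]) (e : R) : 0 <= e -> e <= 1 ->
  ctame u -> ctame v -> ctame u' -> ctame v' ->
  (wsqn w1 (fun z => fourier u z - F z)%R <= e%:E)%E ->
  (wsqn w1 (fun z => fourier u' z - F z)%R <= e%:E)%E ->
  (wsqn w2 (fun z => fourier v z - G z)%R <= e%:E)%E ->
  (wsqn w2 (fun z => fourier v' z - G z)%R <= e%:E)%E ->
  (sqn (fun z => u z * v z - u' z * v' z)%R <= (L * e)%:E)%E.
Proof.
move=> e0 e1 tu tv tu' tv' hu hu' hv hv'.
have [mu mv mu' mv'] := And4 (ctame_measurable tu) (ctame_measurable tv) (ctame_measurable tu') (ctame_measurable tv').
have m1 : measurable_fun setT ((fun=> 1) : P -> R) by exact: measurable_cst.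
have := wsqnB_le m1 (cmeasurableM mu mv) (cmeasurableM mu mv') (cmeasurableM mu' mv').
rewrite !wsqn1 => /le_trans; apply.
have -> : (fun z => u z * v z - u z * v' z) = (fun z => u z * (v z - v' z)).
  by apply/funext => z; rewrite mulrBr.
have -> : (fun z => u z * v' z - u' z * v' z) = (fun z => (u z - u' z) * v' z).
  by apply/funext => z; rewrite mulrBl.
have h1 := prod_le_real tu (ctameB tv tv') (wsqn_near_le mw1 mF tu FA hu)
  (wsqn_fourierB_le mw2 mG tv tv' hv hv').
have h2 := prod_le_real (ctameB tu tu') tv' (wsqn_fourierB_le mw1 mF tu tu' hu hu')
  (wsqn_near_le mw2 mG tv' GB hv').
apply: (le_trans (lee_two h1 h2)); rewrite lee_fin /L.
have -> : 2 * (K * ((2 * e + 2 * A) * (4 * e))) + 2 * (K * (4 * e * (2 * e + 2 * B))) =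
  16 * K * ((A + B + 2 * e) * e) by ring.
rewrite -[leRHS]mulrA ler_wpM2l ?mulr_ge0// ler_wpM2r// lerD2l.
by rewrite -[leRHS]mulr1 ler_wpM2l.
Qed.

Lemma approx_small (W : R * R -> R) (H : R * R -> R[i]) us (e : R) : approx W H us -> 0 < e ->
  exists N, forall n, (N <= n)%N -> (wsqn W (fun z => fourier (us n) z - H z)%R <= e%:E)%E.
Proof. by move=> [_ h] /h [N _ hN]; exists N => n Nn; exact: hN. Qed.

(** [L + 1] in place of [L] allows for [L = 0]; the cap at 1 is the hypothesis [e <= 1] of
    [product_dist]. *)
Let delta (e : R) : R := Num.min 1 (e / (L + 1)).

Let delta_gt0 e : 0 < e -> 0 < delta e.
Proof. by move=> e0; rewrite lt_min ltr01 divr_gt0// ltr_wpDl. Qed.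

Let delta_le1 e : delta e <= 1. Proof. by rewrite ge_min lexx. Qed.

Let L_delta e : 0 < e -> L * delta e <= e.
Proof.
move=> e0; have h : delta e <= e / (L + 1) by rewrite ge_min lexx orbT.
apply: (le_trans (ler_wpM2l L0 h)).
have L1 : 0 < L + 1 by rewrite ltr_wpDl.
by rewrite mulrA ler_pdivrMr// mulrC ler_wpM2l ?(ltW e0)// lerDl.
Qed.

(** The products of any two pairs of approximations approach each other, so the limit is independent
    of the sequences. The 8 in the norm bound comes from three triangle inequalities for squares,
    one each for [w], [F] and [G]. *)
Lemma product_extension (u0 v0 : nat -> R * R -> R[i]) : approx w1 F u0 -> approx w2 G v0 ->
  exists w : R * R -> R[i], [/\ cmeasurable w,
    (forall us vs, approx w1 F us -> approx w2 G vs ->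
       forall e : R, 0 < e ->
       \forall n \near \oo, (sqn (fun z => us n z * vs n z - w z)%R <= e%:E)%E) &
    (sqn w <= (8 * K * (A * B))%:E)%E].
Proof.
move=> au av.
have close us vs us' vs' (e : R) : approx w1 F us -> approx w2 G vs -> approx w1 F us' -> approx w2 G vs' ->
    0 < e -> exists N, forall n m, (N <= n)%N -> (N <= m)%N ->
    (sqn (fun z => us n z * vs n z - us' m z * vs' m z)%R <= e%:E)%E.
  move=> a1 a2 a3 a4 e0; have d0 := delta_gt0 e0.
  have [N1 h1] := approx_small a1 d0; have [N2 h2] := approx_small a2 d0.
  have [N3 h3] := approx_small a3 d0; have [N4 h4] := approx_small a4 d0.
  exists (maxn (maxn N1 N2) (maxn N3 N4)) => n m.
  rewrite !geq_max => /andP[/andP[n1 n2] _] /andP[_ /andP[m3 m4]].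
  apply: (@le_trans _ _ (L * delta e)%:E); last by rewrite lee_fin L_delta.
  by apply: product_dist; rewrite ?(ltW d0)//; [exact: a1.1|exact: a2.1|exact: a3.1|exact: a4.1|exact: h1|exact: h3|exact: h2|exact: h4].
have mprod us vs n : approx w1 F us -> approx w2 G vs -> cmeasurable (fun z => us n z * vs n z)%R.
  by move=> a1 a2; apply: cmeasurableM; apply: ctame_measurable; [exact: a1.1|exact: a2.1].
have [w mw hw] := sqn_complete (W := fun n z => u0 n z * v0 n z) (fun n => mprod _ _ n au av)
  (fun e e0 => close _ _ _ _ e au av au av e0).
have conv us vs : approx w1 F us -> approx w2 G vs -> forall e : R, 0 < e ->
   \forall n \near \oo, (sqn (fun z => us n z * vs n z - w z)%R <= e%:E)%E.
  move=> a1 a2 e e0; have [N hN] := close _ _ _ _ e a1 a2 au av e0.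
  exists N => // n /= Nn; apply: hw; first exact: mprod.
  by exists N => // m /= Nm; exact: hN.
exists w; split => //.
apply/lee_addgt0Pr => e e0.
have M0 : 0 < 2 + 8 * K * (A + B + 1).
  by rewrite ltr_wpDr// mulr_ge0// ?mulr_ge0// !addr_ge0.
(* The excess over 8 K A B is e1 (2 + 8 K (A + B + e1)), at most [e] because [e1 <= 1]. *)
pose e1 := Num.min 1 (e / (2 + 8 * K * (A + B + 1))).
have e10 : 0 < e1 by rewrite lt_min ltr01 divr_gt0.
have e11 : e1 <= 1 by rewrite ge_min lexx.
have e1e : e1 * (2 + 8 * K * (A + B + 1)) <= e.
  by rewrite -ler_pdivlMr// ge_min lexx orbT.
have [N1 h1] := approx_small au e10; have [N2 h2] := approx_small av e10.
have [N3 _ h3] := conv _ _ au av e1 e10.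
pose n := maxn N3 (maxn N1 N2).
have n1 : (N1 <= n)%N by rewrite /n !leq_max leqnn !orbT.
have n2 : (N2 <= n)%N by rewrite /n !leq_max leqnn !orbT.
have n3 : (N3 <= n)%N by rewrite /n leq_max leqnn.
have z0 : cmeasurable (fun=> 0 : R[i]) by split; exact: measurable_cst.
have mn := mprod _ _ n au av.
have m1 : measurable_fun setT ((fun=> 1) : P -> R) by exact: measurable_cst.
have := wsqnB_le m1 mw mn z0.
rewrite !wsqn1 -[X in (_ * X)%E]wsqn1 wsqnC wsqn1.
rewrite (_ : (fun z => w z - 0) = w); last by apply/funext => z; rewrite subr0.
rewrite (_ : (fun z => u0 n z * v0 n z - 0) = fun z => u0 n z * v0 n z); last by apply/funext => z; rewrite subr0.
move=> /le_trans; apply.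
have hp := prod_le_real (au.1 n) (av.1 n) (wsqn_near_le mw1 mF (au.1 n) FA (h1 n n1))
  (wsqn_near_le mw2 mG (av.1 n) GB (h2 n n2)).
apply: (le_trans (lee_two (h3 n n3) hp)); rewrite -EFinD lee_fin; apply: (@le_trans _ _ (8 * K * (A * B) + e1 * (2 + 8 * K * (A + B + 1)))); last by rewrite lerD2l.
have : 0 <= 8 * K * (e1 * (1 - e1)).
  by rewrite mulr_ge0 ?mulr_ge0 ?subr_ge0// ltW.
rewrite -subr_ge0 => h; rewrite -subr_ge0; apply: le_trans h _.
by rewrite le_eqVlt; apply/orP; left; apply/eqP; ring.
Qed.

End Extension.

(** * Return to the norms of the statement *)

Section SchwartzApproximation.
Context {R : realType}.
Local Notation TR := (measurableTypeR R).
Local Notation P := (TR * TR)%type.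
Implicit Types (F G w : R * R -> R[i]).

Lemma measurable_weight_plane (alpha s b : R) : measurable_fun setT (weight alpha s b : P -> R).
Proof. exact: measurable_weightP. Qed.

Lemma X_approx_approx alpha s b F us : X_approx alpha s b F us -> approx (weight alpha s b) F us.
Proof.
move=> [su cu]; split; first by move=> n; exact: schwartz_ctame.
have X0 n : (0 <= Xhat_norm alpha s b (fun zeta => fourier (us n) zeta - F zeta)%R)%E.
  by rewrite Xhat_norm_wsqn poweR_ge0.
move=> e e0; have := (cvge0P X0).1 cu (Num.sqrt e).
rewrite sqrtr_gt0 => /(_ e0); apply: filterS => n.
by rewrite Xhat_norm_wsqn le_sqrte ?wsqn_ge0 ?sqrtr_ge0// sqr_sqrtr// ltW.
Qed.

Lemma L2norm_cvg0 (f : nat -> P -> R[i]) :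
  (forall e : R, 0 < e -> \forall n \near \oo, (sqn (f n) <= e%:E)%E) ->
  (L2norm (f n) @[n --> \oo] --> 0%E).
Proof.
move=> h; apply/cvge0P; first by move=> n; rewrite L2norm_sqn poweR_ge0.
move=> e e0; apply: filterS (h (e ^+ 2) (exprn_gt0 _ e0)) => n.
by rewrite L2norm_sqn le_sqrte ?sqn_ge0// ltW.
Qed.

Lemma L2norm_le_sqrt w (k M : R) (x y : \bar R) : 0 <= k -> Num.sqrt k <= M ->
  (0 <= x)%E -> (0 <= y)%E -> (sqn w <= k%:E * (x * y))%E ->
  (L2norm w <= M%:E * x `^ 2^-1 * y `^ 2^-1)%E.
Proof.
move=> k0 kM x0 y0 h; rewrite L2norm_sqn.
have itv (z : \bar R) : (0 <= z)%E -> z \in `[0%E, +oo%E] by move=> z0; rewrite in_itv/= z0 leey.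
have i2 : 0 <= (2^-1 : R) by rewrite invr_ge0.
have kxy0 : (0 <= k%:E * (x * y))%E by rewrite mule_ge0 ?mule_ge0.
apply: (le_trans (gt0_ler_poweR i2 (itv _ (sqn_ge0 w)) (itv _ kxy0) h)).
rewrite poweRM ?mule_ge0// poweRM// muleA.
apply: lee_wpmul2r; first exact: poweR_ge0.
apply: lee_wpmul2r; first exact: poweR_ge0.
by rewrite poweR_EFin lee_fin powR12_sqrt.
Qed.

Lemma L2norm0 : L2norm (fun=> 0 : R[i]) = 0%E :> \bar R.
Proof.
rewrite L2norm_sqn /sqn (_ : (\int[leb2]_z _)%E = 0%E) ?poweR0r ?invr_neq0//.
by apply: integral0_eq => z _; rewrite /normsq /= expr0n addr0.
Qed.

Lemma wsqn_fin alpha s b F : (Xhat_norm alpha s b F < +oo)%E ->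
  wsqn (weight alpha s b) F = (fine (wsqn (weight alpha s b) F))%:E.
Proof.
rewrite Xhat_norm_wsqn => h; rewrite fineK// ge0_fin_numE ?wsqn_ge0//.
by apply: lty_poweRy h; rewrite invr_neq0.
Qed.

End SchwartzApproximation.

Unset Implicit Arguments.
Set Strict Implicit.
Local Close Scope classical_set_scope.

Theorem lemma6 (R : realType) (alpha s : R)
  (alpha_gt0 : 0 < alpha) (alpha_le3 : alpha <= 3)
  (s_gt : 1 / 4 - alpha / 4 < s) :
  exists2 eps0 : R, 0 < eps0 &
  forall eps : R, 0 < eps -> eps < eps0 ->
  exists2 C : R, 0 < C &
    (forall u v : R * R -> R[i]%C, schwartz u -> schwartz v ->
       (L2norm (fun z => u z * v z)%R <=
        C%:E * Xnorm alpha (- (1 / 2)) (1 / 2 - eps) u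
             * Xnorm alpha s (1 / 2) v)%E) /\
    (forall F G : R * R -> R[i]%C, cmeasurable F -> cmeasurable G ->
       (Xhat_norm alpha (- (1 / 2)) (1 / 2 - eps) F < +oo)%E ->
       (Xhat_norm alpha s (1 / 2) G < +oo)%E ->
       exists w : R * R -> R[i]%C,
         [/\ cmeasurable w,
             is_product alpha (- (1 / 2)) (1 / 2 - eps) s (1 / 2) F G w &
             (L2norm w <=
              C%:E * Xhat_norm alpha (- (1 / 2)) (1 / 2 - eps) F
                   * Xhat_norm alpha s (1 / 2) G)%E]).
Proof.
have [eps0 eps00 main] := bilinear_estimate alpha_gt0 alpha_le3 s_gt.
exists eps0 => // eps e0 elt; have [C0 C00 bil] := main eps e0 elt.
have mw1 := measurable_weight_plane alpha (- (1 / 2)) (1 / 2 - eps).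
have mw2 := measurable_weight_plane alpha s (1 / 2).
pose K := product_const C0.
have K0 : 0 <= K := product_const_ge0 (ltW C00).
have prod_le := sqn_product_le mw1 mw2 (ltW C00) bil.
have K8 : 0 <= 8 * K by rewrite mulr_ge0.
(* [K] serves Schwartz functions and [8 * K] their limits; the added 1 makes the constant visibly
   positive. *)
exists (Num.sqrt (8 * K) + 1); first by rewrite ltr_wpDl// sqrtr_ge0.
have M8 : Num.sqrt (8 * K) <= Num.sqrt (8 * K) + 1 by rewrite lerDl.
have M1 : Num.sqrt K <= Num.sqrt (8 * K) + 1.
  by apply: le_trans M8; rewrite ler_wsqrtr// ler_peMl// ler1n.
split => [u v su sv|F G mF mG finF finG].
  rewrite /Xnorm !Xhat_norm_wsqn; apply: (L2norm_le_sqrt K0 M1); rewrite ?wsqn_ge0//.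
  by apply: prod_le; exact: schwartz_ctame.
(* If no Schwartz sequence tends to [F], then [is_product] quantifies over an empty set and 0 is a
   product that satisfies the bound; the same holds for [G]. *)
have [[us au]|noF] := pselect (exists us, X_approx alpha (- (1 / 2)) (1 / 2 - eps) F us); last first.
  exists (fun=> 0); split.
  - by split; exact: measurable_cst.
  - by move=> us vs au; case: noF; exists us.
  - by rewrite L2norm0 !mule_ge0// ?Xhat_norm_wsqn ?poweR_ge0// lee_fin addr_ge0 ?sqrtr_ge0.
have [[vs av]|noG] := pselect (exists vs, X_approx alpha s (1 / 2) G vs); last first.
  exists (fun=> 0); split.
  - by split; exact: measurable_cst.
  - by move=> ? vs _ av; case: noG; exists vs.
  - by rewrite L2norm0 !mule_ge0// ?Xhat_norm_wsqn ?poweR_ge0// lee_fin addr_ge0 ?sqrtr_ge0.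
have FA := wsqn_fin finF; have GB := wsqn_fin finG.
have A0 : 0 <= fine (wsqn (weight alpha (- (1 / 2)) (1 / 2 - eps)) F) by rewrite fine_ge0 ?wsqn_ge0.
have B0 : 0 <= fine (wsqn (weight alpha s (1 / 2)) G) by rewrite fine_ge0 ?wsqn_ge0.
have FA' : (wsqn (weight alpha (- (1 / 2)) (1 / 2 - eps)) F <=
  (fine (wsqn (weight alpha (- (1 / 2)) (1 / 2 - eps)) F))%:E)%E by rewrite -FA.
have GB' : (wsqn (weight alpha s (1 / 2)) G <= (fine (wsqn (weight alpha s (1 / 2)) G))%:E)%E.
  by rewrite -GB.
have [w [mw conv wle]] := product_extension mw1 mw2 K0 prod_le mF mG A0 B0 FA' GB'
  (X_approx_approx au) (X_approx_approx av).
exists w; split => //.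
- move=> us' vs' au' av'; apply: L2norm_cvg0 => e ee0.
  exact: (conv _ _ (X_approx_approx au') (X_approx_approx av') e ee0).
- rewrite !Xhat_norm_wsqn; apply: (L2norm_le_sqrt K8 M8); rewrite ?wsqn_ge0//.
  by rewrite FA GB -!EFinM.
Qed.
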